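(* Let $f$ be a transcendental entire function with a multiply connected wandering domain $U$ and let $z_0 \in U$. For large $n\in\mathbb{N}$ let $r_n=|f^n(z_0)|$ and let $A(r_n^{a_n},r_n^{b_n})$ be the maximal annulus centred at $0$ that is contained in $U_n=f^n(U)$ and contains $f^n(z_0)$. (a) As $n\to\infty$, $a_n \to a$ for some $a\in [0,1)$ and $b_n \to b$ for some $b\in (1,\infty]$. (b) For large $n \in \mathbb{N}$, let $\underline{a}_{\,n}$ and $\underline{b}_{\,n}$ denote the smallest values such that $\{z: |z| = r_n^{\underline{a}_{\,n}}\}$ and $\{z: |z| = r_n^{\underline{b}_{\,n}}\}$ meet $\partial_{0}U_n$ and $\partial_{\infty}U_n$ respectively, and let $\overline{a}_n$ and $\overline{b}_{n}$ denote the largest such values. Then (i) $b \geq \underline{b}_{\,n}\ge b_n$ and $b/a \geq \underline{b}_{\,n}/ \underline{a}_{\,n}\ge b_n/a_n$, for all sufficiently large $n$; (ii) $\underline{b}_{\,n} \to b$, $\underline{a}_{\,n} \to a$ and $\overline{a}_n \to a$ as $n \to \infty$.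
   Context: $A(r,R)=\{z\in\mathbb{C}:r<|z|<R\}$ for $0<r<R$. A transcendental entire function is an entire function $f:\mathbb{C}\to\mathbb{C}$ that is not a polynomial; $f^n$ denotes its $n$-th iterate, and $\mathbb{N}=\{1,2,\dots\}$. The Fatou set $F(f)$ is the set of points of $\mathbb{C}$ having a neighbourhood on which the iterates $f^n$ form a normal family (locally uniform convergence to $\infty$ being allowed). A Fatou component is a connected component of $F(f)$. For a Fatou component $U$, $U_n$ denotes the Fatou component containing $f^n(U)$, with $U_0=U$; $U$ is a wandering domain if the sequence $(U_n)$ is not eventually periodic. A domain is multiply connected if it is not simply connected. By results of Baker, if $U$ is a multiply connected wandering domain then each $U_n$ is bounded and multiply connected, $U_n=f^n(U)$, for all large $n$ both $U_n$ and $0$ lie in a bounded complementary component of $U_{n+1}$, and $\mathrm{dist}(U_n,0)\to\infty$ as $n\to\infty$. The maximal annulus is well defined for large $n$: there exists $\alpha>0$ such that, for all large $n$, the maximal annulus centred at $0$ that is contained in $U_n$ and contains $f^n(z_0)$ exists and has the form $A(r_n^{a_n},r_n^{b_n})$ with $0<a_n<1-\alpha<1+\alpha<b_n$; this defines $a_n$ and $b_n$. For a bounded domain $G$, the outer boundary component $\partial_\infty G$ is the boundary of the unbounded component of $\mathbb{C}\setminus G$, and the inner boundary component $\partial_0 G$ is the boundary of the component of $\mathbb{C}\setminus G$ that contains $0$, if there is one (for $G=U_n$ there is one for all large $n$). The quotient $b/a$ is understood as $\infty$ if $a=0$ or $b=\infty$. *)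

(* Defs.v *)
From HB Require Import structures.
From mathcomp Require Import all_boot all_order all_algebra complex.
From mathcomp Require Import all_classical all_reals all_analysis.

Set Implicit Arguments.
Unset Strict Implicit.
Unset Printing Implicit Defensive.

Import Order.TTheory GRing.Theory Num.Theory numFieldNormedType.Exports.

Local Open Scope classical_set_scope.
Local Open Scope ring_scope.
Local Open Scope complex_scope.

(* The topology of R[i] is that of R[i] as a normed space over itself; in
   particular derivable f z 1 is complex differentiability. *)
#[non_forgetful_inheritance]
HB.instance Definition _ (R : realType) := NormedModule.copy R[i] R[i]^o.

(* `|z| has type R[i]; normc z is the same modulus as an element of R. *)
Notation normc := ComplexField.Normc.normc.

Section Topology.
Variable R : realType.
Implicit Types G : set R[i].

Definition boundary G : set R[i] := closure G `\` interior G.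

Definition domain G := [/\ G !=set0, open G & connected G].

(* H (s, t) contracts the loop g inside G relative to its base point; s is the
   time of the homotopy and t the parameter of the loop. *)
Definition null_homotopic G (g : R -> R[i]) :=
  exists H : R * R -> R[i],
    [/\ {within (`[0, 1] `*` `[0, 1])%classic, continuous H},
        forall s t, 0 <= s <= 1 -> 0 <= t <= 1 -> G (H (s, t)),
        forall t, 0 <= t <= 1 -> H (0, t) = g t,
        forall t, 0 <= t <= 1 -> H (1, t) = g 0 &
        forall s, 0 <= s <= 1 -> H (s, 0) = g 0 /\ H (s, 1) = g 0].

Definition simply_connected G :=
  domain G /\
  forall g : R -> R[i], {within `[0, 1]%classic, continuous g} ->
    (forall t, 0 <= t <= 1 -> G (g t)) -> g 0 = g 1 -> null_homotopic G g.

Definition multiply_connected G := domain G /\ ~ simply_connected G.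

(* If G is bounded, exactly one component of its complement is unbounded, and
   the set of points lying in an unbounded component is that component. *)
Definition unbounded_complement G : set R[i] :=
  [set w | ~ bounded_set (connected_component (~` G) w)].

Definition outer_boundary G : set R[i] := boundary (unbounded_complement G).

(* connected_component (~` G) 0 is empty if 0 is in G. *)
Definition inner_boundary G : set R[i] :=
  boundary (connected_component (~` G) 0).

Definition annulus (r s : R) : set R[i] := [set z | r < normc z < s].

Definition maximal_annulus G (z : R[i]) (r s : R) :=
  [/\ 0 < r < s, annulus r s `<=` G, annulus r s z &
      forall r' s' : R, 0 < r' < s' -> annulus r' s' `<=` G ->
        annulus r' s' z -> annulus r' s' `<=` annulus r s].

(* The exponents x such that the circle |z| = r ^ x meets S. *)
Definition circle_exponents (S : set R[i]) (r : R) : set R :=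
  [set x | exists2 z, S z & normc z = r `^ x].

End Topology.

Definition is_smallest (R : realType) (A : set R) (x : R) := A x /\ lbound A x.
Definition is_largest (R : realType) (A : set R) (x : R) := A x /\ ubound A x.

Section Dynamics.
Variable R : realType.
Implicit Types (f : R[i] -> R[i]) (U V : set R[i]).

Definition entire f := forall z, derivable f z 1.

Definition transcendental_entire f :=
  entire f /\ ~ exists p : {poly R[i]}, forall z, f z = p.[z].

Definition locally_uniform_cvg V (g : nat -> R[i] -> R[i]) (h : R[i] -> R[i]) :=
  forall z, V z -> exists2 W, nbhs z W & {uniform W `&` V, g @ \oo --> h}.

Definition locally_uniform_cvg_infty V (g : nat -> R[i] -> R[i]) :=
  forall z, V z -> exists2 W, nbhs z W &
    forall M : R, \forall k \near \oo,
      forall w, (W `&` V) w -> M < normc (g k w).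

Definition normal_family (F : set (R[i] -> R[i])) V :=
  forall g : nat -> R[i] -> R[i], (forall k, F (g k)) ->
  exists2 phi : nat -> nat, {homo phi : j k / (j < k)%N} &
    (exists h, locally_uniform_cvg V (g \o phi) h) \/
    locally_uniform_cvg_infty V (g \o phi).

Definition fatou_set f : set R[i] :=
  [set z | exists V, [/\ open V, V z &
    normal_family [set iter n f | n in [set n | (1 <= n)%N]] V]].

Definition fatou_component f U :=
  exists2 z, fatou_set f z & U = connected_component (fatou_set f) z.

(* The Fatou component containing f^n(U), written as the union over z in U of
   the components of the points f^n(z), which all coincide. *)
Definition fatou_component_orbit f U (n : nat) : set R[i] :=
  \bigcup_(z in U) connected_component (fatou_set f) (iter n f z).

Definition wandering_domain f U :=
  fatou_component f U /\
  ~ exists N p, (0 < p)%N /\ forall n, (N <= n)%N ->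
      fatou_component_orbit f U (n + p)%N = fatou_component_orbit f U n.

End Dynamics.

(* Main.v *)
(* Write L_n = ln |f^n z0|. Since the circle |z| = |f^n z0| lies in U_n, a
   disc mapped strictly inside itself would lie in the Fatou set; hence |f^n z0|
   increases to infinity and, f not being a polynomial, L_{n+2} / L_n does so
   too. For w in U_n put h_k(w) = ln |f^k w| / L_{n+k}. If some points on circles
   of exponent close to h_k(w) escaped U_{n+k} for arbitrarily large k, then, by
   Harnack's inequality and log branches of f^k divided by the omitted values,
   h_k would become constant on U_n, which Hadamard's three circles theorem
   forbids. So U_{n+k} contains an annulus around f^k w whose width in ln |z| is
   proportional to L_{n+k}. On the circle in its middle ln |f| is almost constant,
   and three circles on f drives h_k(w) away from 1 up to summable errors, so
   h_k(w) converges to some h(w). The numbers a and b are the infimum and the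
   supremum of h. The annuli of U_n fill out [a, b] because h takes all
   intermediate values; conversely, three circles compares h at a point of U_n of
   small modulus with its maximum on a compact set that encloses a given disc,
   which bounds the exponents of both boundary components and their quotient. *)
Require Import Defs.
From mathcomp Require Import all_boot all_order all_algebra complex.
From mathcomp Require Import all_classical all_reals all_analysis.
From mathcomp Require Import ring lra.
Import Order.TTheory GRing.Theory Num.Theory numFieldNormedType.Exports.
Local Open Scope classical_set_scope.
Local Open Scope ring_scope.
Local Open Scope complex_scope.

Set Implicit Arguments.
Unset Strict Implicit.
Unset Printing Implicit Defensive.

(** * The plane R[i] *)

Section ComplexPlane.
Variable R : realType.
Local Notation C := R[i].
Local Notation Re := (@complex.Re R).
Local Notation Im := (@complex.Im R).
Implicit Types (z w c : C) (A B G : set C) (f g : C -> C).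

(** All complex analysis here rests on one fact, the mean value property over circles, obtained by
    Goursat's argument for f composed with the exponential on a half-plane. It gives a maximum
    principle for quotients a / b whose zeros cancel; suitable choices of b contain the minimum
    principle, Schwarz-Pick, Borel-Caratheodory and the isolation of zeros, so that neither power
    series nor winding numbers occur. Three circles is always used with inner circle |z| = 1, where
    ln |f^k| is at most L_{k+1}. This error must be negligible against L_{n+k}, while the growth of
    L compares indices two apart; hence n >= 3 and the index [n.+3] throughout. The maximum points
    of f^k on a circle depend on k. Harnack's inequality replaces them by one cluster point, which
    controls infinitely many k only; this is enough because h_k is already known to converge. A disc
    inside the outer boundary component has to be enclosed by a compact subset of U_n on which every
    iterate is at least as large as on the disc. No curve is constructed for this: the set comes
    from a clopen part of the complement. *)

Lemma normr_normc z : `|z| = (normc z)%:C.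
Proof. by case: z. Qed.

Lemma normc_ge0 z : 0 <= normc z.
Proof. by case: z => a b /=; rewrite sqrtr_ge0. Qed.

Lemma normc_eq0 z : (normc z == 0) = (z == 0).
Proof.
apply/eqP/eqP => [/ComplexField.Normc.eq0_normc //|->].
exact: ComplexField.Normc.normc0.
Qed.

Lemma normc_gt0 z : (0 < normc z) = (z != 0).
Proof. by rewrite lt_neqAle normc_ge0 andbT eq_sym normc_eq0. Qed.

Lemma normcD z w : normc (z + w) <= normc z + normc w.
Proof. by rewrite -lecR rmorphD /= -!normr_normc ler_normD. Qed.

Lemma normcM z w : normc (z * w) = normc z * normc w.
Proof. exact: ComplexField.Normc.normcM. Qed.

Lemma normcN z : normc (- z) = normc z.
Proof. by apply: complexI; rewrite -!normr_normc normrN. Qed.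

Lemma normcV z : normc z^-1 = (normc z)^-1.
Proof. exact: ComplexField.Normc.normcV. Qed.

Lemma normc0 : normc (0 : C) = 0.
Proof. exact: ComplexField.Normc.normc0. Qed.

Lemma normc1 : normc (1 : C) = 1.
Proof. exact: ComplexField.Normc.normc1. Qed.

Lemma normcX z n : normc (z ^+ n) = normc z ^+ n.
Proof. by elim: n => [|n IH]; rewrite ?expr0 ?normc1 // !exprS normcM IH. Qed.

Lemma normcB z w : normc (z - w) = normc (w - z).
Proof. by rewrite -normcN opprB. Qed.

Lemma normc_real (x : R) : normc x%:C = `|x|.
Proof. by rewrite /= expr0n /= addr0 sqrtr_sqr. Qed.

Lemma normc_triangle z w c : normc (z - c) <= normc (z - w) + normc (w - c).
Proof. by apply: le_trans (normcD _ _); rewrite addrA subrK. Qed.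

Lemma normc_leBD z w : normc z - normc w <= normc (z - w).
Proof. by rewrite lerBlDr; apply: le_trans (normcD _ _); rewrite subrK. Qed.

Lemma Re_le_normc z : `|Re z| <= normc z.
Proof.
case: z => a b /=; rewrite -sqrtr_sqr ler_sqrt ?addr_ge0 ?sqr_ge0 //.
by rewrite lerDl sqr_ge0.
Qed.

Lemma Im_le_normc z : `|Im z| <= normc z.
Proof.
case: z => a b /=; rewrite -sqrtr_sqr ler_sqrt ?addr_ge0 ?sqr_ge0 //.
by rewrite lerDr sqr_ge0.
Qed.

Lemma normc_le_ReIm z : normc z <= `|Re z| + `|Im z|.
Proof.
rewrite {1}(_ : z = (Re z)%:C + ((Im z) *i)%C); last first.
  by case: z => a b; apply/eqP; rewrite eq_complex /= addr0 add0r !eqxx.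
apply: le_trans (normcD _ _) _.
by rewrite /= !expr0n /= addr0 add0r !sqrtr_sqr.
Qed.

Lemma reD z w : Re (z + w) = Re z + Re w. Proof. by case: z; case: w. Qed.
Lemma imD z w : Im (z + w) = Im z + Im w. Proof. by case: z; case: w. Qed.
Lemma reN z : Re (- z) = - Re z. Proof. by case: z. Qed.
Lemma imN z : Im (- z) = - Im z. Proof. by case: z. Qed.
Lemma reB z w : Re (z - w) = Re z - Re w. Proof. by rewrite reD reN. Qed.
Lemma imB z w : Im (z - w) = Im z - Im w. Proof. by rewrite imD imN. Qed.
Lemma reM z w : Re (z * w) = Re z * Re w - Im z * Im w.
Proof. by case: z; case: w. Qed.
Lemma imM z w : Im (z * w) = Re z * Im w + Im z * Re w.
Proof. by case: z; case: w. Qed.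
Lemma complexP z w : Re z = Re w -> Im z = Im w -> z = w.
Proof. by case: z; case: w => a b c d /= -> ->. Qed.

Lemma gt0_complex (e : C) : 0 < e -> exists2 d : R, 0 < d & e = d%:C.
Proof.
case: e => a b; rewrite ltcE /= => /andP[/eqP -> a0]; by exists a.
Qed.

Definition disc c (e : R) : set C := [set w | normc (w - c) < e].
Definition cdisc c (e : R) : set C := [set w | normc (w - c) <= e].

Lemma nbhsCP z A : nbhs z A <-> exists2 e : R, 0 < e & disc z e `<=` A.
Proof.
split.
- move=> /nbhs_ballP [e /= e0 eA]; have [d d0 ed] := gt0_complex e0.
  exists d => // w wd; apply: eA; rewrite -ball_normE /= normr_normc ed ltcR.
  by rewrite normcB.
- move=> [e e0 eA]; apply/nbhs_ballP; exists e%:C; first by rewrite /= ltcR.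
  move=> w; rewrite -ball_normE /= normr_normc ltcR normcB => wd; exact: eA.
Qed.

Lemma openCP A : open A <-> forall z, A z -> exists2 e : R, 0 < e & disc z e `<=` A.
Proof.
rewrite openE; split=> H z Az; first by apply/nbhsCP; apply: H.
by apply/nbhsCP; apply: H.
Qed.

Lemma disc_open c e : open (disc c e).
Proof.
apply/openCP => z zc; exists (e - normc (z - c)); first by rewrite subr_gt0.
move=> w; rewrite /disc /= ltrBrDr; apply: le_lt_trans.
exact: normc_triangle.
Qed.

Lemma disc_nbhs c e : 0 < e -> nbhs c (disc c e).
Proof. by move=> e0; apply/nbhsCP; exists e. Qed.

Lemma discxx c e : 0 < e -> disc c e c.
Proof. by move=> e0; rewrite /disc /= subrr normc0. Qed.

Lemma cvgCP (T : Type) (F : set_system T) (FF : Filter F) (h : T -> C) z :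
  h @ F --> z <-> forall e : R, 0 < e -> \forall x \near F, normc (h x - z) < e.
Proof.
split.
- move=> hz e e0; have := hz (disc z e) (disc_nbhs z e0); exact.
- move=> H A /nbhsCP [e e0 eA]; have := H e e0; rewrite near_simpl.
  by apply: filterS => x /eA.
Qed.

Lemma continuousCP f z : {for z, continuous f} <->
  forall e : R, 0 < e -> exists2 d : R, 0 < d &
     forall w, normc (w - z) < d -> normc (f w - f z) < e.
Proof.
split.
- by move=> /(cvgCP (nbhs_filter z)) H e /H /nbhsCP [d d0 dH]; exists d => // w /dH.
- move=> H; apply/(cvgCP (nbhs_filter z)) => e /H [d d0 dH]; apply/nbhsCP; exists d => // w /dH.
Qed.

Lemma continuousRP (h : C -> R) z : {for z, continuous h} <->
  forall e : R, 0 < e -> exists2 d : R, 0 < d &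
     forall w, normc (w - z) < d -> `|h w - h z| < e.
Proof.
split.
- move=> /cvgrPdist_lt H e /H /nbhsCP [d d0 dH]; exists d => // w /dH.
  by rewrite distrC.
- move=> H; apply/(@cvgrPdist_lt _ _ _ _ (nbhs_filter z)) => e /H [d d0 dH]; apply/nbhsCP; exists d => // w /dH.
  by rewrite distrC.
Qed.

Lemma Complex_cvg (T : Type) (F : set_system T) (FF : Filter F) (u v : T -> R) a b :
  u @ F --> a -> v @ F --> b -> (fun t => u t +i* v t) @ F --> a +i* b.
Proof.
move=> /cvgrPdist_lt ua /cvgrPdist_lt vb; apply/cvgCP => e e0.
have e20 : 0 < e / 2 by rewrite divr_gt0.
apply: filterS2 (ua _ e20) (vb _ e20) => t h1 h2.
apply: le_lt_trans (normc_le_ReIm _) _ => /=.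
by rewrite distrC [X in _ + X]distrC (splitr e) ltrD.
Qed.

Lemma cdisc_closed c e : closed (cdisc c e).
Proof.
rewrite -openC; apply/openCP => z /negP; rewrite -ltNge => zc.
exists (normc (z - c) - e); first by rewrite subr_gt0.
move=> w; rewrite /disc /= => wz; apply/negP; rewrite -ltNge.
have := normc_triangle z w c; rewrite (normcB z w); lra.
Qed.

Lemma cdisc_compact c e : compact (cdisc c e).
Proof.
pose h (p : R * R) : C := p.1 +i* p.2.
have hc : continuous h.
  by move=> p; apply: Complex_cvg; [exact: cvg_fst|exact: cvg_snd].
pose K := `[Re c - e, Re c + e]%classic `*` `[Im c - e, Im c + e]%classic.
have cK : compact (h @` K).
  apply: continuous_compact; first exact: continuous_subspaceT.
  by apply: compact_setX; exact: segment_compact.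
apply: subclosed_compact cK _; first exact: cdisc_closed.
move=> w wc; exists (Re w, Im w); last by case: w {wc}.
split; rewrite /= in_itv /= -ler_distlC distrC.
  by rewrite -reB (le_trans (Re_le_normc _)).
by rewrite -imB (le_trans (Im_le_normc _)).
Qed.

Lemma bounded_closed_compactC A c e : closed A -> A `<=` cdisc c e -> compact A.
Proof. move=> cA Ac; exact: subclosed_compact cA (@cdisc_compact c e) Ac. Qed.

End ComplexPlane.

(** * Complex derivatives and the exponential *)

Section ComplexDerivative.
Variable R : realType.
Local Notation C := R[i].
Local Notation Re := (@complex.Re R).
Local Notation Im := (@complex.Im R).
Implicit Types (z w c : C) (A B G : set C) (f g : C -> C).

(** Continuity with real tolerances and real moduli, so that estimates take place in the ordered
    field [R] instead of [R[i]]. *)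
Definition ccont f z := forall e : R, 0 < e -> exists2 d : R, 0 < d &
  forall w, normc (w - z) < d -> normc (f w - f z) < e.

Lemma ccontP f z : ccont f z <-> {for z, continuous f}.
Proof. by split=> /continuousCP. Qed.

Lemma ccont_cst c z : ccont (fun=> c) z.
Proof. by move=> e e0; exists 1 => // w _; rewrite subrr normc0. Qed.

Lemma ccont_id z : ccont (fun w => w) z.
Proof. by move=> e e0; exists e. Qed.

Lemma ccontD f g z : ccont f z -> ccont g z -> ccont (fun w => f w + g w) z.
Proof.
move=> fz gz e e0; have e20 : 0 < e / 2 by rewrite divr_gt0.
have [d d0 dH] := fz _ e20; have [t t0 tH] := gz _ e20.
exists (Num.min d t); first by rewrite lt_min d0.
move=> w; rewrite lt_min => /andP[/dH h1 /tH h2].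
rewrite opprD addrACA; apply: le_lt_trans (normcD _ _) _; lra.
Qed.

Lemma ccontM f g z : ccont f z -> ccont g z -> ccont (fun w => f w * g w) z.
Proof.
move=> fz gz e e0; pose M := normc (f z) + normc (g z) + 1.
have f0 := normc_ge0 (f z); have g0 := normc_ge0 (g z).
have M0 : 0 < M by rewrite /M; lra.
have e20 : 0 < e / (2 * M) by rewrite divr_gt0 // mulr_gt0.
have [d d0 dH] := fz _ e20; have [t t0 tH] := gz _ e20.
have [s s0 sH] := gz _ ltr01.
exists (Num.min (Num.min d t) s); first by rewrite !lt_min d0 t0.
move=> w; rewrite !lt_min => /andP[/andP[/dH h1 /tH h2] /sH h3].
rewrite (_ : _ - _ = (f w - f z) * g w + f z * (g w - g z)); last by ring.
apply: le_lt_trans (normcD _ _) _; rewrite !normcM.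
have gw : normc (g w) <= M.
  have := normc_leBD (g w) (g z); rewrite /M; lra.
have fM : normc (f z) <= M by rewrite /M; lra.
have := normc_ge0 (f w - f z); have := normc_ge0 (g w - g z) => a0 b0.
have -> : e = e / (2 * M) * M + M * (e / (2 * M)) by field; apply/eqP; lra.
apply: ler_ltD; first by apply: ler_pM => //; [exact: normc_ge0|exact: ltW].
by apply: le_lt_trans (ler_wpM2r a0 fM) _; rewrite ltr_pM2l.
Qed.

Lemma ccont_comp f g z : ccont g z -> ccont f (g z) -> ccont (fun w => f (g w)) z.
Proof.
move=> gz fz e /fz [d /gz [d' d'0 H]] H'.
by exists d' => // w /H /H'.
Qed.

Lemma ccont_neq0 f z : f z != 0 -> ccont f z ->
  exists2 d : R, 0 < d & forall w, normc (w - z) < d -> normc (f z) / 2 < normc (f w).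
Proof.
move=> fz0 fz; have n0 : 0 < normc (f z) / 2 by rewrite divr_gt0 // normc_gt0.
have [d d0 H] := fz _ n0; exists d => // w /H.
by have := normc_leBD (f z) (f w); rewrite normcB; lra.
Qed.

Lemma ccontV f z : f z != 0 -> ccont f z -> ccont (fun w => (f w)^-1) z.
Proof.
move=> fz0 fz e e0; have n0 : 0 < normc (f z) by rewrite normc_gt0.
have [d d0 H] := ccont_neq0 fz0 fz.
have e20 : 0 < e * (normc (f z) ^+ 2 / 2).
  by rewrite !mulr_gt0 // ?exprn_gt0 // invr_gt0.
have [t t0 tH] := fz _ e20.
exists (Num.min d t); first by rewrite lt_min d0.
move=> w; rewrite lt_min => /andP[/H h1 /tH h2].
have fw0 : f w != 0 by rewrite -normc_gt0; lra.
rewrite (_ : _ - _ = (f z - f w) / (f w * f z)); last by field; rewrite fz0 fw0.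
rewrite normcM normcV normcM normcB ltr_pdivrMr; last by rewrite mulr_gt0 // normc_gt0.
apply: lt_le_trans h2 _; rewrite ler_wpM2l ?(ltW e0) // expr2.
by rewrite -mulrAC ler_wpM2r ?(ltW n0) // ltW.
Qed.

(* Caratheodory's form of complex differentiability. *)
Definition cdiff f z := exists2 q : C -> C,
  ccont q z & forall w, f w = f z + q w * (w - z).

Lemma cdiffP f z : cdiff f z <-> exists d : C, forall e : R, 0 < e ->
  exists2 t : R, 0 < t & forall w, normc (w - z) < t ->
    normc (f w - f z - d * (w - z)) <= e * normc (w - z).
Proof.
split.
- move=> [q qz qE]; exists (q z) => e /qz [t t0 tH].
  exists t => // w wz; rewrite {1}qE.
  rewrite (_ : _ - _ = (q w - q z) * (w - z)); last by ring.
  by rewrite normcM ler_wpM2r ?normc_ge0 // ltW // tH.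
- move=> [d dH]; exists (fun w => if w == z then d else (f w - f z) / (w - z)).
    move=> e e0; have e20 : 0 < e / 2 by rewrite divr_gt0.
    have [t t0 tH] := dH _ e20; exists t => // w wt; rewrite eqxx.
    case: eqVneq => [_|wz]; first by rewrite subrr normc0.
    have wz0 : w - z != 0 by rewrite subr_eq0.
    have n0 : 0 < normc (w - z) by rewrite normc_gt0.
    have -> : (f w - f z) / (w - z) - d = (f w - f z - d * (w - z)) / (w - z).
      by field.
    rewrite normcM normcV ltr_pdivrMr //; apply: le_lt_trans (tH _ wt) _.
    by rewrite ltr_pM2r //; lra.
  move=> w; case: eqVneq => [->|wz]; first by rewrite subrr mulr0 addr0.
  by rewrite divfK ?subr_eq0 // addrC subrK.
Qed.

Lemma derivable_cdiff f z : derivable f z 1 -> cdiff f z.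
Proof.
move=> /cvg_ex [d /cvgCP dH]; apply/cdiffP; exists d => e e0.
have /nbhsCP [t t0 tH] := dH e e0.
exists t => // w wt; case: (eqVneq w z) => [->|wz].
  by rewrite !subrr mulr0 subrr normc0 mulr0.
have wz0 : w - z != 0 by rewrite subr_eq0.
have := tH (w - z); rewrite /disc /= subr0 => /(_ wt wz0).
rewrite [_ *: 1]mulr1 subrK => /ltW H.
have -> : f w - f z - d * (w - z) = ((w - z)^-1 *: (f w - f z) - d) * (w - z).
  by rewrite mulrBl [_ *: _]mulrC divfK.
by rewrite normcM ler_wpM2r // normc_ge0.
Qed.

Lemma cdiff_near f g z : (\forall w \near z, f w = g w) -> cdiff f z -> cdiff g z.
Proof.
move=> /nbhsCP [d d0 dH] /cdiffP [l lH]; apply/cdiffP; exists l => e /lH [t t0 tH].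
exists (Num.min d t); first by rewrite lt_min d0.
move=> w; rewrite lt_min => /andP[wd wt].
by rewrite -!dH; [exact: tH|exact: discxx|].
Qed.

Lemma cdiff_cont f z : cdiff f z -> ccont f z.
Proof.
move=> [q qz qE]; rewrite (_ : f = fun w => f z + q w * (w - z)); last first.
  by apply/funext => w; rewrite -qE.
apply: ccontD; first exact: ccont_cst.
apply: ccontM; first exact: qz.
apply: ccontD; [exact: ccont_id|exact: ccont_cst].
Qed.

Lemma cdiff_cst c z : cdiff (fun=> c) z.
Proof. by exists (fun=> 0); [exact: ccont_cst|move=> w; rewrite mul0r addr0]. Qed.

Lemma cdiff_id z : cdiff id z.
Proof. by exists (fun=> 1); [exact: ccont_cst|move=> w /=; rewrite mul1r addrC subrK]. Qed.

Lemma cdiffD f g z : cdiff f z -> cdiff g z -> cdiff (fun w => f w + g w) z.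
Proof.
move=> [q qz qE] [p pz pE]; exists (fun w => q w + p w); first exact: ccontD.
by move=> w; rewrite qE pE; ring.
Qed.

Lemma cdiffM f g z : cdiff f z -> cdiff g z -> cdiff (fun w => f w * g w) z.
Proof.
move=> df dg; have gc := cdiff_cont dg; case: df dg => [q qz qE] [p pz pE].
exists (fun w => q w * g w + f z * p w).
  apply: ccontD; first exact: ccontM.
  by apply: ccontM => //; exact: ccont_cst.
move=> w; rewrite [RHS](_ : _ = f z * (g z + p w * (w - z)) + q w * (w - z) * g w).
  by rewrite -pE -mulrDl -qE.
by ring.
Qed.

Lemma cdiffN f z : cdiff f z -> cdiff (fun w => - f w) z.
Proof.
move=> df; rewrite (_ : (fun _ => _) = (fun w => (-1) * f w)); last first.
  by apply/funext => w; rewrite mulN1r.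
by apply: cdiffM => //; exact: cdiff_cst.
Qed.

Lemma cdiffB f g z : cdiff f z -> cdiff g z -> cdiff (fun w => f w - g w) z.
Proof. by move=> df dg; apply: cdiffD => //; exact: cdiffN. Qed.

Lemma cdiff_comp f g z : cdiff g z -> cdiff f (g z) -> cdiff (fun w => f (g w)) z.
Proof.
move=> dg; have gc := cdiff_cont dg; case: dg => [q qz qE] [p pz pE].
exists (fun w => p (g w) * q w).
  by apply: ccontM => //; exact: ccont_comp.
by move=> w; rewrite pE -mulrA; congr (_ + _ * _); rewrite qE addrC addKr.
Qed.

(** The identity in [cdiff] is global, but 1 / f has the expected factorization only where f does
    not vanish. The function [g] has it everywhere and agrees with 1 / f near [z]. *)
Lemma cdiffV f z : f z != 0 -> cdiff f z -> cdiff (fun w => (f w)^-1) z.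
Proof.
move=> fz0 df; have fc := cdiff_cont df.
have [d d0 dH] := ccont_neq0 fz0 fc.
case: df => q qz qE; pose g w := (f z)^-1 + (- (f z)^-1 * q w * (f w)^-1) * (w - z).
apply: (@cdiff_near g).
  apply/nbhsCP; exists d => // w /dH h; rewrite /g.
  have fw : f w != 0 by rewrite -normc_gt0; have := normc_ge0 (f z); lra.
  rewrite -[_ * (w - z)]mulrA [_^-1 * (w - z)]mulrC mulrA -[_ * q w * _]mulrA.
  rewrite (_ : q w * (w - z) = f w - f z); first by field; rewrite fw fz0.
  by rewrite [f w]qE addrAC subrr add0r.
exists (fun w => - (f z)^-1 * q w * (f w)^-1).
  apply: ccontM; last exact: ccontV.
  by apply: ccontM; [exact: ccont_cst|exact: qz].
by move=> w; rewrite /g subrr mulr0 addr0.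
Qed.

Lemma cdiffX f n z : cdiff f z -> cdiff (fun w => f w ^+ n) z.
Proof.
move=> df; elim: n => [|n IH]; first exact: cdiff_cst.
rewrite (_ : (fun _ => _) = (fun w => f w * f w ^+ n)); last first.
  by apply/funext => w; rewrite exprS.
exact: cdiffM.
Qed.

Lemma cdiff_sum (I : Type) (r : seq I) (P : pred I) (F : I -> C -> C) z :
  (forall i, cdiff (F i) z) -> cdiff (fun w => \sum_(i <- r | P i) F i w) z.
Proof.
move=> dF; elim: r => [|i r IH].
  rewrite (_ : (fun _ => _) = (fun=> 0)); first exact: cdiff_cst.
  by apply/funext => w; rewrite big_nil.
rewrite (_ : (fun _ => _) = (fun w => (if P i then F i w else 0) +
   \sum_(j <- r | P j) F j w)); last first.
  by apply/funext => w; rewrite big_cons; case: (P i); rewrite ?add0r.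
by apply: cdiffD => //; case: (P i) => //; exact: cdiff_cst.
Qed.

Lemma cdiff_prod (I : Type) (r : seq I) (F : I -> C -> C) z :
  (forall i, cdiff (F i) z) -> cdiff (fun w => \prod_(i <- r) F i w) z.
Proof.
move=> dF; elim: r => [|i r IH].
  rewrite (_ : (fun _ => _) = (fun=> 1)); first exact: cdiff_cst.
  by apply/funext => w; rewrite big_nil.
rewrite (_ : (fun _ => _) = (fun w => F i w * \prod_(j <- r) F j w)); last first.
  by apply/funext => w; rewrite big_cons.
exact: cdiffM.
Qed.

Lemma cdiff_horner (p : {poly C}) z : cdiff (horner p) z.
Proof.
rewrite (_ : horner p = fun w => \sum_(i < size p) p`_i * w ^+ i); last first.
  by apply/funext => w; rewrite horner_coef.
apply: cdiff_sum => i; apply: cdiffM; [exact: cdiff_cst|].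
by apply: cdiffX; exact: cdiff_id.
Qed.

Lemma cdiff_iter f n z : (forall w, cdiff f w) -> cdiff (iter n f) z.
Proof.
move=> df; elim: n z => [|n IH] z; first exact: cdiff_id.
by apply: (@cdiff_comp f (iter n f)).
Qed.

Definition cexp z : C := (expR (Re z) * cos (Im z)) +i* (expR (Re z) * sin (Im z)).

Lemma cexpD z w : cexp (z + w) = cexp z * cexp w.
Proof.
by apply: complexP; rewrite ?reM ?imM /= reD imD expRD ?cosD ?sinD; ring.
Qed.

Lemma cexp0 : cexp 0 = 1.
Proof. by apply: complexP; rewrite /= expR0 mul1r ?cos0 ?sin0. Qed.

Lemma normc_cexp z : normc (cexp z) = expR (Re z).
Proof.
rewrite /cexp /= !exprMn -mulrDr cos2Dsin2 mulr1 sqrtr_sqr ger0_norm // expR_ge0.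
Qed.

Lemma real_deriv_small (h : R -> R) (x d : R) : is_derive x 1 h d ->
  forall e : R, 0 < e -> exists2 t : R, 0 < t &
   forall y, `|y - x| < t -> `|h y - h x - d * (y - x)| <= e * `|y - x|.
Proof.
move=> [dh hd] e e0.
have : (fun t => t^-1 *: (h (t *: 1 + x) - h x)) @ 0^' --> d by rewrite -hd; exact: dh.
move/cvgrPdist_le => /(_ e e0) [t /= t0 H]; exists t => // y yt.
have [->|yx] := eqVneq y x; first by rewrite !subrr mulr0 subrr normr0 mulr0.
have yx0 : y - x != 0 by rewrite subr_eq0.
have := H (y - x); rewrite /= sub0r normrN => /(_ yt yx0).
rewrite [_ *: 1]mulr1 subrK distrC => H'.
have -> : h y - h x - d * (y - x) = ((y - x)^-1 *: (h y - h x) - d) * (y - x).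
  by rewrite mulrBl [_ *: _]mulrC divfK.
by rewrite normrM ler_wpM2r.
Qed.

(** The point 0 is enough, by the functional equation [cexpD]; there the claim follows from the real
    derivatives of expR, cos and sin. *)
Lemma cdiff_cexp0 : cdiff cexp 0.
Proof.
apply/cdiffP; exists 1 => e e0.
(* The four error terms below add up to at most 9 d |w|. The factor 12 leaves room, and d <= 1 / 12
   keeps expR x below 3. *)
pose d : R := Num.min e 1 / 12.
have m0 : 0 < Num.min e 1 by rewrite lt_min e0 ltr01.
have d0 : 0 < d by rewrite divr_gt0.
have d1 : 12 * d <= 1 by rewrite /d mulrC divfK ?pnatr_eq0 // ge_min lexx orbT.
have de : 12 * d <= e by rewrite /d mulrC divfK ?pnatr_eq0 // ge_min lexx.
clearbody d; have [t1 t10 H1] := real_deriv_small (is_derive_expR 0) d0.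
have [t2 t20 H2] := real_deriv_small (is_derive_cos 0) d0.
have [t3 t30 H3] := real_deriv_small (is_derive_sin 0) d0.
exists (Num.min (Num.min t1 t2) (Num.min t3 d)).
  by rewrite !lt_min t10 t20 t30 d0.
move=> w; rewrite subr0 !lt_min => /andP[/andP[h1 h2] /andP[h3 h4]].
rewrite mul1r cexp0.
set x := Re w; set y := Im w.
have wx : `|x| <= normc w by exact: Re_le_normc.
have wy : `|y| <= normc w by exact: Im_le_normc.
have K3 : `|sin y - y| <= d * `|y|.
  have := H3 y; rewrite subr0 sin0 cos0 subr0 mul1r; apply.
  exact: le_lt_trans wy h3.
have K2 : `|cos y - 1| <= d * `|y|.
  have := H2 y; rewrite subr0 sin0 cos0 oppr0 mul0r subr0; apply.
  exact: le_lt_trans wy h2.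
have K1 : `|expR x - 1 - x| <= d * `|x|.
  have := H1 x; rewrite subr0 expR0 mul1r; apply.
  exact: le_lt_trans wx h1.
have n0 := normc_ge0 w.
have dx : d * `|x| <= d * normc w by rewrite ler_wpM2l // ltW.
have dy : d * `|y| <= d * normc w by rewrite ler_wpM2l // ltW.
have dn : d * normc w <= 1 * 1 by apply: ler_pM => //; move: h4 d1 d0; clear; lra.
have E3 : `|expR x| <= 3.
  rewrite (ger0_norm (expR_ge0 x)); move: K1; rewrite ler_norml => /andP[_].
  have : x <= normc w by apply: le_trans wx; exact: ler_norm.
  lra.
have E1 : `|expR x - 1| <= 2 * normc w.
  have -> : expR x - 1 = (expR x - 1 - x) + x by rewrite subrK.
  apply: le_trans (ler_normD _ _) _.
  have : d * normc w <= 1 * normc w by rewrite ler_wpM2r //; lra.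
  lra.
apply: le_trans (normc_le_ReIm _) _.
have -> : Re (cexp w - 1 - w) = (expR x - 1 - x) + expR x * (cos y - 1).
  by rewrite !reB /=; ring.
have -> : Im (cexp w - 1 - w) = expR x * (sin y - y) + (expR x - 1) * y.
  by rewrite !imB /=; ring.
have A1 : `|expR x * (cos y - 1)| <= 3 * (d * normc w).
  by rewrite normrM; apply: ler_pM => //; exact: le_trans dy.
have A2 : `|expR x * (sin y - y)| <= 3 * (d * normc w).
  by rewrite normrM; apply: ler_pM => //; exact: le_trans dy.
have A3 : `|(expR x - 1) * y| <= 2 * normc w * d.
  by rewrite normrM; apply: ler_pM => //; apply: le_trans wy _; exact: ltW.
have B1 := ler_normD (expR x - 1 - x) (expR x * (cos y - 1)).
have B2 := ler_normD (expR x * (sin y - y)) ((expR x - 1) * y).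
have B3 : 12 * d * normc w <= e * normc w by rewrite ler_wpM2r.
have dn0 : 0 <= d * normc w by rewrite mulr_ge0 // ltW.
move: B1 B2 B3 A1 A2 A3 K1 dx dn0; clear; lra.
Qed.

Lemma cdiff_cexp z : cdiff cexp z.
Proof.
rewrite (_ : cexp = fun w => cexp z * cexp (w - z)); last first.
  by apply/funext => w; rewrite -cexpD addrC subrK.
apply: cdiffM; first exact: cdiff_cst.
apply: cdiff_comp; first by apply: cdiffB; [exact: cdiff_id|exact: cdiff_cst].
by rewrite subrr; exact: cdiff_cexp0.
Qed.

(** The argument is acos (Re z / |z|), with the sign of Im z. Its bound pi will be compared with
    logarithms that tend to infinity. *)
Lemma cexp_polar z : z != 0 -> exists2 t : R, `|t| <= pi & z = cexp (ln (normc z) +i* t).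
Proof.
move=> z0; have n0 : 0 < normc z by rewrite normc_gt0.
have zE : Re z ^+ 2 + Im z ^+ 2 = normc z ^+ 2.
  by case: z {z0 n0} => a b /=; rewrite sqr_sqrtr // addr_ge0 ?sqr_ge0.
pose c := Re z / normc z.
have c1 : -1 <= c <= 1.
  by rewrite -ler_norml /c normrM normfV (ger0_norm (ltW n0)) ler_pdivrMr // mul1r Re_le_normc.
have cE : normc z * c = Re z by rewrite mulrC divfK // gt_eqF.
have sE : normc z * Num.sqrt (1 - c ^+ 2) = `|Im z|.
  rewrite -[normc z]ger0_norm ?ltW // -sqrtr_sqr -sqrtrM ?sqr_ge0 //.
  rewrite mulrBr mulr1 -exprMn cE -zE addrAC subrr add0r sqrtr_sqr //.
have [ge0|lt0] := lerP 0 (Im z).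
  exists (acos c); first by rewrite ger0_norm ?acos_ge0 // acos_lepi.
  apply: complexP; rewrite /= lnK ?posrE // ?acosK // ?sin_acos // sE ger0_norm //.
exists (- acos c); first by rewrite normrN ger0_norm ?acos_ge0 // acos_lepi.
apply: complexP; rewrite /= lnK ?posrE // ?cosN ?sinN ?acosK // mulrN sin_acos // sE.
by rewrite ltr0_norm // opprK.
Qed.

Lemma cexp_2pi (x y : R) : cexp (x +i* (y + 2 * pi)) = cexp (x +i* y).
Proof.
have -> : y + 2 * pi = y + pi + pi by ring.
by apply: complexP; rewrite /= ?(cosDpi, sinDpi) ?opprK.
Qed.

End ComplexDerivative.

(** * The mean value property *)

Section Goursat.
Variable R : realType.
Local Notation C := R[i].
Local Notation Re := (@complex.Re R).
Local Notation Im := (@complex.Im R).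
Implicit Types (z w c : C) (A B G : set C) (f g : C -> C).

Lemma primitive_exists (u : R -> R) (a : R) : continuous u ->
  exists P : R -> R, forall x, a < x -> is_derive x 1 P (u x).
Proof.
move=> uc; exists (fun x => \int[lebesgue_measure]_(t in `[a, x]) u t)%R => x ax.
have ax1 : x < x + 1 by rewrite ltrDl.
have iu : lebesgue_measure.-integrable `[a, x + 1] (EFin \o u).
  apply: continuous_compact_integrable; first exact: segment_compact.
  exact: continuous_subspaceT.
have [dF F'] := continuous_FTC1_closed ax1 iu ax (uc x).
exact: (DeriveDef dF (eq_trans (esym (derive1E _ _)) F')).
Qed.

Lemma small_is_derive (h : R -> R) (x d : R) :
  (forall e : R, 0 < e -> exists2 t : R, 0 < t &
   forall y, `|y - x| < t -> `|h y - h x - d * (y - x)| <= e * `|y - x|) ->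
  is_derive x 1 h d.
Proof.
move=> H.
have L : (fun t => t^-1 *: (h (t *: 1 + x) - h x)) @ 0^' --> d.
  apply/cvgrPdist_le => e e0; have [t t0 tH] := H _ e0.
  exists t => // y /=; rewrite sub0r normrN => yt y0.
  have := tH (y + x); rewrite addrK => /(_ yt); rewrite [y *: 1]mulr1.
  move=> K; rewrite -(ler_pM2r (_ : 0 < `|y|)) ?normr_gt0 //.
  apply: le_trans K; rewrite -normrM distrC mulrBl [_ *: _]mulrC divfK //.
have dh : derivable h x 1 by apply/cvg_ex; exists d.
by apply: DeriveDef => //; exact/cvg_lim.
Qed.

Lemma deriv_bounded (k k' : R -> R) (a b e : R) : a <= b ->
  (forall x, a <= x <= b -> is_derive x 1 k (k' x)) ->
  (forall x, a <= x <= b -> `|k' x| <= e) ->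
  `|k b - k a| <= e * (b - a).
Proof.
move=> ab dk k'e.
have [||c cab ->] := @MVT_segment R k k' a b ab.
- move=> x; rewrite in_itv /= => /andP[ax xb]; apply: dk; rewrite !ltW //.
- apply: derivable_within_continuous => x; rewrite in_itv /= => xab.
  by have [] := dk _ xab.
rewrite normrM [`|b - a|]ger0_norm ?subr_ge0 // ler_wpM2r ?subr_ge0 //.
by apply: k'e; move: cab; rewrite in_itv.
Qed.

Definition rderiv (k : R -> C) (x : R) (d : C) :=
  is_derive x 1 (fun t => Re (k t)) (Re d) /\ is_derive x 1 (fun t => Im (k t)) (Im d).

(** The factor 2 comes from applying the mean value theorem to the real and the imaginary part
    separately. *)
Lemma rderiv_bounded (k k' : R -> C) (a b e : R) : a <= b ->
  (forall x, a <= x <= b -> rderiv k x (k' x)) ->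
  (forall x, a <= x <= b -> normc (k' x) <= e) ->
  normc (k b - k a) <= 2 * e * (b - a).
Proof.
move=> ab dk k'e; apply: le_trans (normc_le_ReIm _) _; rewrite reB imB.
have h1 := @deriv_bounded (fun t => Re (k t)) (fun t => Re (k' t)) a b e ab.
have h2 := @deriv_bounded (fun t => Im (k t)) (fun t => Im (k' t)) a b e ab.
have -> : 2 * e * (b - a) = e * (b - a) + e * (b - a) by ring.
apply: lerD; [apply: h1|apply: h2] => x xab; try by have [] := dk _ xab.
- exact: le_trans (Re_le_normc _) (k'e _ xab).
- exact: le_trans (Im_le_normc _) (k'e _ xab).
Qed.

Lemma rderivB (k l : R -> C) x d d' : rderiv k x d -> rderiv l x d' ->
  rderiv (fun t => k t - l t) x (d - d').
Proof.
move=> [k1 k2] [l1 l2]; split.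
  rewrite (_ : (fun t => _) = (fun t => Re (k t)) - (fun t => Re (l t))); last first.
    by apply/funext => t; rewrite reB.
  by rewrite reB; exact: is_deriveB.
rewrite (_ : (fun t => _) = (fun t => Im (k t)) - (fun t => Im (l t))); last first.
  by apply/funext => t; rewrite imB.
by rewrite imB; exact: is_deriveB.
Qed.

Lemma rderiv_small (k : R -> C) x d :
  (forall e : R, 0 < e -> exists2 t : R, 0 < t &
   forall y, `|y - x| < t -> normc (k y - k x - d * (y - x)%:C) <= e * `|y - x|) ->
  rderiv k x d.
Proof.
move=> H; split; apply: small_is_derive => e /H [t t0 tH]; exists t => // y /tH.
- apply: le_trans; apply: le_trans (Re_le_normc _).
  by rewrite !reB reM /= mulr0 subr0.
- apply: le_trans; apply: le_trans (Im_le_normc _).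
  by rewrite !imB imM /= mulr0 add0r.
Qed.

(** A primitive of the affine function a + b (s - s0) along the line p + v x; in the Goursat
    argument [G] is compared with such an affine function. *)
Lemma rderiv_quadratic (a b s0 p v : C) x :
  rderiv (fun t => a * (p + v * t%:C) + b * (p + v * t%:C - s0) ^+ 2 / 2%:R) x
    ((a + b * (p + v * x%:C - s0)) * v).
Proof.
apply: rderiv_small => e e0.
pose M := normc (b * v ^+ 2 / 2%:R) + 1.
have M0 : 0 < M by rewrite ltr_wpDl // normc_ge0.
exists (e / M); first by rewrite divr_gt0.
move=> y yx.
rewrite (_ : _ - _ = (b * v ^+ 2 / 2%:R) * (y - x)%:C ^+ 2); last first.
  by rewrite rmorphB /=; field.
rewrite normcM normcX normc_real expr2 [X in X <= _]mulrA ler_wpM2r //.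
apply: le_trans (_ : M * `|y - x| <= _).
  by rewrite ler_wpM2r // lerDl.
by rewrite mulrC -ler_pdivlMr // ltW.
Qed.

Section Rectangle.
Variables (G : C -> C) (H V : R -> R -> C) (X0 X1 Y0 Y1 : R).
Hypothesis G_diff : forall x y, X0 <= x <= X1 -> Y0 <= y <= Y1 -> cdiff G (x +i* y).
Hypothesis H_deriv : forall x y, X0 <= x <= X1 -> Y0 <= y <= Y1 ->
  rderiv (fun t => H t y) x (G (x +i* y)).
Hypothesis V_deriv : forall x y, X0 <= x <= X1 -> Y0 <= y <= Y1 ->
  rderiv (fun t => V x t) y (G (x +i* y)).

(* The integral of G along the boundary of [x, x + w] x [y, y + h], in terms
   of the horizontal and vertical antiderivatives H and V. *)
Definition boundary_integral (x y w h : R) : C :=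
  (H (x + w) y - H x y) + 'i%C * (V (x + w) (y + h) - V (x + w) y)
  - (H (x + w) (y + h) - H x (y + h)) - 'i%C * (V x (y + h) - V x y).

Lemma boundary_integral_split (x y w h : R) :
  boundary_integral x y w h =
    boundary_integral x y (w / 2) (h / 2) +
    boundary_integral (x + w / 2) y (w / 2) (h / 2) +
    boundary_integral x (y + h / 2) (w / 2) (h / 2) +
    boundary_integral (x + w / 2) (y + h / 2) (w / 2) (h / 2).
Proof.
rewrite /boundary_integral -!addrA -!splitr; ring.
Qed.

(** The affine function has the primitive [Q] and contributes nothing along a closed path. What
    remains is at most 2 e times the length of each of the four sides. *)
Lemma boundary_integral_bound (x y w h : R) (a b s0 : C) (e : R) : 0 <= w -> 0 <= h ->
  X0 <= x -> x + w <= X1 -> Y0 <= y -> y + h <= Y1 ->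
  (forall u v, x <= u <= x + w -> y <= v <= y + h ->
     normc (G (u +i* v) - (a + b * (u +i* v - s0))) <= e) ->
  normc (boundary_integral x y w h) <= 4 * e * (w + h).
Proof.
move=> w0 h0 x0 x1 y0 y1 Ge.
pose Q (s : C) := a * s + b * (s - s0) ^+ 2 / 2%:R.
have hline v : y <= v <= y + h ->
    normc ((H (x + w) v - Q ((x + w) +i* v)) - (H x v - Q (x +i* v))) <= 2 * e * w.
  move=> vy.
  have cE t : (t +i* v)%C = (0 +i* v) + 1 * t%:C :> C.
    by apply: complexP; rewrite /= ?mul1r ?mul0r; ring.
  rewrite -{3}[w](addrK x) [w + x]addrC.
  apply: (@rderiv_bounded (fun t => H t v - Q (t +i* v))
    (fun t => G (t +i* v) - (a + b * (t +i* v - s0)) * 1)).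
  - by rewrite lerDl.
  - move=> t tx; apply: rderivB; first by apply: H_deriv; lra.
    have := rderiv_quadratic a b s0 (0 +i* v) 1 t.
    rewrite /Q (_ : (fun t => _) = (fun t => a * (t +i* v) + b * (t +i* v - s0) ^+ 2 / 2%:R)).
      by rewrite -cE.
    by apply/funext => t'; rewrite cE.
  - by move=> t tx; rewrite mulr1; apply: Ge.
have vline u : x <= u <= x + w ->
    normc (('i%C * V u (y + h) - Q (u +i* (y + h))) - ('i%C * V u y - Q (u +i* y))) <= 2 * e * h.
  move=> ux.
  have cE t : (u +i* t)%C = (u +i* 0) + 'i%C * t%:C :> C.
    by apply: complexP; rewrite /= ?mul1r ?mul0r; ring.
  (* The factor -i, of modulus 1, removes the i in front of [V], so that [rderiv_bounded] applies to
     [V] itself. *)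
  have iE : (- 'i%C) * 'i%C = 1 :> C by apply: complexP; rewrite /=; ring.
  have iN : normc (- 'i%C : C) = 1 by rewrite normcN /= expr0n /= add0r expr1n sqrtr1.
  rewrite -[X in X <= _]mul1r -{1}iN -normcM.
  rewrite (_ : _ * _ = (V u (y + h) - (- 'i%C) * Q (u +i* (y + h))) - (V u y - (- 'i%C) * Q (u +i* y))); last first.
    by rewrite !mulrBr !mulrA iE; ring.
  rewrite -{3}[h](addrK y) [h + y]addrC.
  apply: (@rderiv_bounded (fun t => V u t - (- 'i%C) * Q (u +i* t))
    (fun t => G (u +i* t) - (- 'i%C * a + - 'i%C * b * (u +i* t - s0)) * 'i%C)).
  - by rewrite lerDl.
  - move=> t tx; apply: rderivB; first by apply: V_deriv; lra.
    have := rderiv_quadratic (- 'i%C * a) (- 'i%C * b) s0 (u +i* 0) 'i%C t.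
    rewrite /Q (_ : (fun t => - 'i%C * _) = (fun t => (- 'i%C * a) * (u +i* t) + (- 'i%C * b) * (u +i* t - s0) ^+ 2 / 2%:R)).
      by rewrite -cE; congr rderiv; apply/funext => t'; rewrite -cE.
    by apply/funext => t'; ring.
  - move=> t tx.
    rewrite (_ : (- 'i%C * a + _) * 'i%C = (- 'i%C * 'i%C) * (a + b * (u +i* t - s0))); last by ring.
    by rewrite iE mul1r; apply: Ge.
have yy : y <= y <= y + h by rewrite lexx lerDl.
have yh : y <= y + h <= y + h by rewrite lexx lerDl h0.
have xx : x <= x <= x + w by rewrite lexx lerDl.
have xw : x <= x + w <= x + w by rewrite lexx lerDl w0.
have := hline _ yy; have := hline _ yh; have := vline _ xx; have := vline _ xw.
set k1 := (X in normc X); set k2 := (X in _ -> normc X <= _ -> _).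
set k3 := (X in _ -> _ -> normc X <= _ -> _); set k4 := (X in _ -> _ -> _ -> normc X <= _ -> _).
move=> n1 n2 n3 n4.
have -> : boundary_integral x y w h = k4 + k1 - k3 - k2.
  rewrite /boundary_integral /k1 /k2 /k3 /k4; ring.
apply: le_trans (normcD _ _) _; rewrite normcN.
have := normcD (k4 + k1) (- k3); rewrite normcN; have := normcD k4 k1.
move: n1 n2 n3 n4; clear; lra.
Qed.

(* If the boundary integral of a rectangle is k in modulus, quartering it
   repeatedly gives nested rectangles of size 2^-n on which it is at least
   k / 4^n; differentiability at their common point forces k = 0. *)
Lemma goursat (x y w h : R) : 0 <= w -> 0 <= h ->
  X0 <= x -> x + w <= X1 -> Y0 <= y -> y + h <= Y1 ->
  boundary_integral x y w h = 0.
Proof.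
move=> w0 h0 x0 x1 y0 y1.
pose k := normc (boundary_integral x y w h).
pose good (n : nat) (p : R * R) :=
  k / 4%:R ^+ n <= normc (boundary_integral p.1 p.2 (w / 2 ^+ n) (h / 2 ^+ n)).
pose next (n : nat) (p : R * R) :=
  let a := w / 2 ^+ n.+1 in let b := h / 2 ^+ n.+1 in
  if good n.+1 p then p else if good n.+1 (p.1 + a, p.2) then (p.1 + a, p.2)
  else if good n.+1 (p.1, p.2 + b) then (p.1, p.2 + b) else (p.1 + a, p.2 + b).
have nextP n p : good n p -> good n.+1 (next n p).
  move=> gp; rewrite /next; case: ifP => // g1; case: ifP => // g2; case: ifP => // g3.
  move: gp g1 g2 g3; rewrite /good boundary_integral_split /=.
  have E (t : R) : t / 2 ^+ n / 2 = t / 2 ^+ n.+1 by rewrite exprSr invfM mulrA.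
  rewrite !E; set b1 := boundary_integral _ _ _ _; set b2 := boundary_integral _ _ _ _.
  set b3 := boundary_integral _ _ _ _; set b4 := boundary_integral _ _ _ _ => gp.
  move=> /negbT; rewrite -ltNge => g1 /negbT; rewrite -ltNge => g2 /negbT; rewrite -ltNge => g3.
  have := normcD (b1 + b2 + b3) b4; have := normcD (b1 + b2) b3; have := normcD b1 b2.
  have k4 : k / 4 ^+ n = 4 * (k / 4 ^+ n.+1).
    by rewrite exprS; field; rewrite expf_neq0 // pnatr_eq0.
  move: gp g1 g2 g3; rewrite k4; clear; lra.
pose P := fix P n := if n is m.+1 then next m (P m) else (x, y).
have PS n : P n.+1 = next n (P n) by [].
have Pgood n : good n (P n).
  elim: n => [|n IH]; last by rewrite PS; exact: nextP.
  by rewrite /good /= !expr0 !divr1.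
have two0 n : 0 < 2 ^+ n :> R by rewrite exprn_gt0.
have wn0 n : 0 <= w / 2 ^+ n by rewrite divr_ge0 // ltW.
have hn0 n : 0 <= h / 2 ^+ n by rewrite divr_ge0 // ltW.
have half (t : R) n : t / 2 ^+ n = t / 2 ^+ n.+1 + t / 2 ^+ n.+1.
  by rewrite exprS; field; rewrite gt_eqF.
have nx n : (P n).1 <= (P n.+1).1 /\ (P n.+1).1 + w / 2 ^+ n.+1 <= (P n).1 + w / 2 ^+ n.
  rewrite PS /next; have := wn0 n.+1; rewrite (half w n).
  by do 3?case: ifP => _ /=; lra.
have ny n : (P n).2 <= (P n.+1).2 /\ (P n.+1).2 + h / 2 ^+ n.+1 <= (P n).2 + h / 2 ^+ n.
  rewrite PS /next; have := hn0 n.+1; rewrite (half h n).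
  by do 3?case: ifP => _ /=; lra.
have nested (p : nat -> R) (t : R) : (forall n, 0 <= t / 2 ^+ n) ->
    (forall n, p n <= p n.+1 /\ p n.+1 + t / 2 ^+ n.+1 <= p n + t / 2 ^+ n) ->
    exists q, forall n, p n <= q <= p n + t / 2 ^+ n.
  move=> t0 pn.
  have mono m n : (m <= n)%N -> p m <= p n.
    elim: n => [|n IH]; first by rewrite leqn0 => /eqP ->.
    rewrite leq_eqVlt => /orP[/eqP -> //|/IH mn]; exact: le_trans (pn n).1.
  have anti m n : (m <= n)%N -> p n + t / 2 ^+ n <= p m + t / 2 ^+ m.
    elim: n => [|n IH]; first by rewrite leqn0 => /eqP ->.
    rewrite leq_eqVlt => /orP[/eqP -> //|/IH] H'; exact: le_trans (pn n).2 H'.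
  have ub m n : p m <= p n + t / 2 ^+ n.
    have [mn|nm] := leqP m n.
      by apply: le_trans (mono _ _ mn) _; rewrite lerDl.
    apply: le_trans (anti _ _ (ltnW nm)); by rewrite lerDl.
  exists (sup (range p)) => n; apply/andP; split.
    apply: ub_le_sup; last by exists n.
    by exists (p 0%N + t / 2 ^+ 0) => _ [m _ <-].
  apply: ge_sup; first by exists (p 0%N); exists 0%N.
  by move=> _ [m _ <-].
have [qx qxP] := nested (fun n => (P n).1) w wn0 nx.
have [qy qyP] := nested (fun n => (P n).2) h hn0 ny.
have qx0 : x <= qx <= x + w by have := qxP 0%N; rewrite /= expr0 divr1.
have qy0 : y <= qy <= y + h by have := qyP 0%N; rewrite /= expr0 divr1.
have inP n : x <= (P n).1 /\ (P n).1 + w / 2 ^+ n <= x + w.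
  elim: n => [|n [IH1 IH2]]; first by rewrite /= expr0 divr1.
  have [a1 a2] := nx n; split; [exact: le_trans a1|exact: le_trans IH2].
have inP' n : y <= (P n).2 /\ (P n).2 + h / 2 ^+ n <= y + h.
  elim: n => [|n [IH1 IH2]]; first by rewrite /= expr0 divr1.
  have [a1 a2] := ny n; split; [exact: le_trans a1|exact: le_trans IH2].
have : cdiff G (qx +i* qy) by apply: G_diff; move: qx0 qy0 x0 x1 y0 y1; clear; lra.
move=> /cdiffP [d dP].
have wh0 : 0 <= w + h by rewrite addr_ge0.
(* On the n-th rectangle the affine approximation at the common point has error e (w + h) / 2^n, and
   the perimeter brings a second factor 2^-n; together they match k / 4^n. *)
have kle e : 0 < e -> k <= 4 * e * (w + h) ^+ 2.
  move=> e0; have [t t0 tP] := dP _ e0.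
  have [n nt] : exists n, (w + h) / 2 ^+ n < t.
    have [n _ nP] : \forall n \near \oo, (w + h) / 2 ^+ n < t.
      have : (fun n => (w + h) * 2^-1 ^+ n) @ \oo --> (w + h) * 0.
        apply: cvgM; first exact: cvg_cst.
        apply: cvg_expr; rewrite ger0_norm; lra.
      rewrite mulr0 => /cvgrPdist_lt /(_ t t0); apply: filterS => n.
      rewrite sub0r normrN exprVn ger0_norm ?divr_ge0 // ltW //.
    by exists n; apply: nP => /=.
  have [X1' X2'] := inP n; have [Y1' Y2'] := inP' n.
  have Xq := qxP n; have Yq := qyP n.
  have := Pgood n; rewrite /good.
  have bb : normc (boundary_integral (P n).1 (P n).2 (w / 2 ^+ n) (h / 2 ^+ n))
    <= 4 * (e * ((w + h) / 2 ^+ n)) * (w / 2 ^+ n + h / 2 ^+ n).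
    apply: (@boundary_integral_bound _ _ _ _ (G (qx +i* qy)) d (qx +i* qy)) => //.
    - exact: le_trans X1'.
    - exact: le_trans x1.
    - exact: le_trans Y1'.
    - exact: le_trans y1.
    move=> u v uP vP.
    have dist : normc ((u +i* v) - (qx +i* qy)) <= (w + h) / 2 ^+ n.
      apply: le_trans (normc_le_ReIm _) _ => /=.
      rewrite mulrDl; apply: lerD; rewrite ler_norml; move: uP vP Xq Yq; clear; lra.
    rewrite opprD addrA; apply: le_trans (tP _ _) _; first exact: le_lt_trans nt.
    by rewrite ler_wpM2l // ltW.
  move=> /le_trans /(_ bb); rewrite ler_pdivrMr ?exprn_gt0 // => /le_trans; apply.
  have E4 : 4 ^+ n = 2 ^+ n * 2 ^+ n :> R.
    by rewrite -exprMn; congr (_ ^+ _); rewrite -natrM.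
  rewrite -mulrDl E4 (_ : _ * _ * _ * _ = 4 * e * (w + h) ^+ 2) //.
  by field; rewrite gt_eqF.
apply/eqP; rewrite -normc_eq0 eq_le normc_ge0 andbT.
apply/ler_addgt0Pl => e e0; rewrite addr0.
have S0 : 0 < 4 * ((w + h) ^+ 2 + 1) by rewrite mulr_gt0 // ltr_wpDl // sqr_ge0.
apply: le_trans (kle (e / (4 * ((w + h) ^+ 2 + 1))) _) _; first by rewrite divr_gt0.
rewrite -[X in _ <= X](divfK (lt0r_neq0 S0)) [X in X <= _](_ : _ = e / (4 * ((w + h) ^+ 2 + 1)) * (4 * (w + h) ^+ 2)).
  by rewrite ler_wpM2l ?ler_wpM2l ?lerDl // divr_ge0 // ltW.
by ring.
Qed.

End Rectangle.


Lemma rderiv_primitive (k : R -> C) (a : R) :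
  (forall x e : R, 0 < e -> exists2 d : R, 0 < d &
    forall y, `|y - x| < d -> normc (k y - k x) < e) ->
  exists K : R -> C, forall x, a < x -> rderiv K x (k x).
Proof.
move=> kc.
have k1 : continuous (fun t => Re (k t)).
  move=> x; apply/cvgrPdist_lt => e /(kc x) [d d0 dH].
  apply/nbhs_ballP; exists d => // y; rewrite /ball /= distrC => /dH; apply: le_lt_trans.
  by rewrite distrC -reB; exact: Re_le_normc.
have k2 : continuous (fun t => Im (k t)).
  move=> x; apply/cvgrPdist_lt => e /(kc x) [d d0 dH].
  apply/nbhs_ballP; exists d => // y; rewrite /ball /= distrC => /dH; apply: le_lt_trans.
  by rewrite distrC -imB; exact: Im_le_normc.
have [P1 P1d] := primitive_exists a k1.
have [P2 P2d] := primitive_exists a k2.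
by exists (fun t => P1 t +i* P2 t) => x ax; split; [exact: P1d|exact: P2d].
Qed.

Lemma vertical_primitive (G : C -> C) (x : R) : x <= 0 ->
  (forall s, Re s <= 0 -> cdiff G s) ->
  exists K : R -> C, forall y, -1 < y -> rderiv K y (G (x +i* y)).
Proof.
move=> x0 dG; apply: (@rderiv_primitive (fun t => G (x +i* t))) => y e e0.
have [d d0 dH] := cdiff_cont (dG (x +i* y) x0) e0.
exists d => // y' yy; apply: dH; apply: le_lt_trans yy.
by apply: le_trans (normc_le_ReIm _) _; rewrite /= subrr normr0 add0r.
Qed.

(* Clamping x to x <= 0 makes the horizontal lines globally continuous. *)
Lemma horizontal_primitive (G : C -> C) (a y : R) :
  (forall s, Re s <= 0 -> cdiff G s) ->
  exists K : R -> C, forall x, a < x <= 0 -> rderiv K x (G (x +i* y)).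
Proof.
move=> dG; have [x e e0|K KP] := @rderiv_primitive (fun t => G (Num.min t 0 +i* y)) a.
  have m0 : Num.min x 0 <= 0 by rewrite ge_min lexx orbT.
  have [d d0 dH] := cdiff_cont (dG (Num.min x 0 +i* y) m0) e0.
  exists d => // x' xx; apply: dH; apply: le_lt_trans xx.
  apply: le_trans (normc_le_ReIm _) _; rewrite /= subrr normr0 addr0.
  rewrite !minEle ler_norml; have := ler_norm (x' - x); have := ler_norm (x - x').
  by rewrite (distrC x x'); case: (leP x' 0); case: (leP x 0); clear; lra.
exists K => x /andP[ax x0]; have := KP x ax.
by rewrite (_ : Num.min x 0 = x) //; apply/min_idPl.
Qed.

(** By periodicity the horizontal sides of [t, 0] x [0, 2 pi] cancel, so the integral over a
    vertical period does not depend on t; as t tends to -oo it tends to 2 pi l. For [G] of the form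
    f (z0 + c e^s) this is the mean value property of f. *)
Lemma mean_value_halfplane (G : C -> C) (l : C) :
  (forall s, Re s <= 0 -> cdiff G s) ->
  (forall x : R, x <= 0 -> G (x +i* (2 * pi)) = G (x +i* 0)) ->
  (forall e : R, 0 < e -> exists T : R, forall x y, x <= T -> normc (G (x +i* y) - l) <= e) ->
  exists2 K : R -> C, (forall y : R, -1 < y -> rderiv K y (G (0 +i* y))) &
    K (2 * pi) - K 0 = (2 * pi)%:C * l.
Proof.
move=> dG per lim.
have p0 : 0 < 2 * pi :> R by rewrite mulr_gt0 // pi_gt0.
have /choice [V VP] : forall x, exists K : R -> C, x <= 0 ->
    forall y, -1 < y -> rderiv K y (G (x +i* y)).
  move=> x; case: (leP x 0) => [x0|_]; last by exists (fun=> 0).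
  by have [K KP] := vertical_primitive x0 dG; exists K.
exists (V 0); first exact: VP.
have inc t : t <= 0 -> V 0 (2 * pi) - V 0 0 = V t (2 * pi) - V t 0.
  move=> t0.
  have /choice [H HP] : forall y, exists K : R -> C, forall x, t - 1 < x <= 0 ->
      rderiv K x (G (x +i* y)).
    by move=> y; exact: horizontal_primitive.
  pose H' x y := H y x.
  have t1 : t - 1 < t by lra.
  have E : boundary_integral H' V t 0 (- t) (2 * pi) = 0.
    apply: (@goursat G H' V t 0 0 (2 * pi)) => //; rewrite ?add0r ?subrr ?oppr_ge0 ?addrN //.
    - by move=> x y /andP[_ x0] _; exact: dG.
    - by move=> x y xt _; apply: HP; move: xt; clear; lra.
    - by move=> x y /andP[_ x0] /andP[y0 _]; apply: VP => //; move: y0; clear; lra.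
    - exact: ltW.
  have hz : H (2 * pi) 0 - H 0 0 = H (2 * pi) t - H 0 t.
    apply/eqP; rewrite -subr_eq0 -normc_eq0 eq_le normc_ge0 andbT.
    have := @rderiv_bounded (fun x => H (2 * pi) x - H 0 x) (fun=> 0) t 0 0 t0.
    rewrite mulr0 mul0r; apply; last by move=> *; rewrite normc0.
    move=> x xt; have xt' : t - 1 < x <= 0 by move: xt; clear; lra.
    have <- : G (x +i* (2 * pi)) - G (x +i* 0) = 0.
      by rewrite per ?subrr //; move: xt; clear; lra.
    by apply: rderivB; apply: HP.
  move: E; rewrite /boundary_integral /H' subrr !add0r => E.
  have I0 : 'i%C != 0 :> C by rewrite eq_complex /= oner_eq0 andbF.
  apply: (mulfI I0); apply/eqP; rewrite -subr_eq0; apply/eqP; rewrite -[RHS]E.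
  have -> : H 0 0 = H (2 * pi) 0 - (H (2 * pi) t - H 0 t) by rewrite -hz; ring.
  by ring.
apply/eqP; rewrite -subr_eq0 -normc_eq0 eq_le normc_ge0 andbT.
apply/ler_addgt0Pl => e e0; rewrite addr0.
have e4 : 0 < e / (4 * pi) by rewrite divr_gt0 // mulr_gt0 // pi_gt0.
have [T TP] := lim _ e4; pose t := Num.min T 0.
have tT : t <= T by rewrite ge_min lexx.
have t0 : t <= 0 by rewrite ge_min lexx orbT.
rewrite (inc t t0).
have := @rderiv_bounded (fun y => V t y - (y%:C * l)) (fun y => G (t +i* y) - l) 0 (2 * pi) (e / (4 * pi)) (ltW p0).
rewrite subr0 (_ : 2 * (e / (4 * pi)) * (2 * pi) = e); last first.
  have E (u v : R) : v != 0 -> 2 * (u / (4 * v)) * (2 * v) = u by move=> v0; field.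
  by rewrite E // gt_eqF // pi_gt0.
rewrite (_ : _ - _ - _ = V t (2 * pi) - V t 0 - (2 * pi)%:C * l); last by rewrite rmorph0; ring.
apply; last by move=> y _; exact: TP.
move=> y y0; apply: rderivB; first by apply: VP => //; move: y0; clear; lra.
apply: rderiv_small => d d0; exists 1 => // y' _.
rewrite [X in normc X](_ : _ = 0) ?normc0 ?mulr_ge0 ?(ltW d0) //.
by rewrite rmorphB /=; ring.
Qed.

(** Divided by f z0, the values on the circle have real part at most 1 and mean 1. The primitive [W]
    of Re G - 1 is then nonincreasing with equal end values, hence constant, and Re G = 1 at [w]. *)
Lemma max_modulus_circle f z0 w : w != z0 ->
  (forall z, normc (z - z0) <= normc (w - z0) -> cdiff f z) ->
  (forall z, normc (z - z0) = normc (w - z0) -> normc (f z) <= normc (f z0)) ->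
  normc (f w) = normc (f z0).
Proof.
move=> wz0 df fle.
have p0 : 0 < pi :> R by exact: pi_gt0.
have [fz0|fz0] := eqVneq (f z0) 0.
  by apply/eqP; rewrite eq_le fle // fz0 normc0 normc_ge0.
have rho0 : 0 < normc (w - z0) by rewrite normc_gt0 subr_eq0.
(* The minus sign puts [w] at s = i pi, in the interior of the period [0, 2 pi], where the constancy
   of [W] can be differentiated. *)
pose G s := f (z0 + (- (w - z0)) * cexp s) / f z0.
have argE s : normc (z0 + (- (w - z0)) * cexp s - z0) = normc (w - z0) * expR (Re s).
  by rewrite addrAC subrr add0r normcM normcN normc_cexp.
have dG s : Re s <= 0 -> cdiff G s.
  move=> s0; apply: cdiffM; last exact: cdiff_cst.
  apply: cdiff_comp.
    apply: cdiffD; first exact: cdiff_cst.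
    apply: cdiffM; first exact: cdiff_cst.
    exact: cdiff_cexp.
  by apply: df; rewrite argE ger_pMr // -expR0 ler_expR.
have per (x : R) : x <= 0 -> G (x +i* (2 * pi)) = G (x +i* 0).
  by move=> _; rewrite /G -[2 * pi]add0r cexp_2pi.
have lim (e : R) : 0 < e -> exists T : R, forall x y, x <= T -> normc (G (x +i* y) - 1) <= e.
  move=> e0; have n0 : 0 < normc (f z0) by rewrite normc_gt0.
  have en : 0 < e * normc (f z0) by rewrite mulr_gt0.
  have dz0 : cdiff f z0 by apply: df; rewrite subrr normc0 normc_ge0.
  have [d d0 dH] := cdiff_cont dz0 en.
  exists (ln (d / (2 * normc (w - z0)))) => x y xT.
  rewrite (_ : _ - 1 = (f (z0 + (- (w - z0)) * cexp (x +i* y)) - f z0) / f z0); last first.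
    by rewrite /G mulrBl divff.
  rewrite normcM normcV ler_pdivrMr // ltW // dH // argE /=.
  apply: le_lt_trans (_ : normc (w - z0) * (d / (2 * normc (w - z0))) < _).
    apply: ler_wpM2l; first exact: ltW.
    rewrite -[X in _ <= X](@lnK R) ?ler_expR //.
    by rewrite posrE divr_gt0 // mulr_gt0.
  have -> : normc (w - z0) * (d / (2 * normc (w - z0))) = d / 2.
    by field; rewrite gt_eqF.
  by move: d0; clear; lra.
have [K Kd KE] := mean_value_halfplane dG per lim.
pose W y := Re (K y) - y.
have Wd (y : R) : -1 < y -> is_derive y 1 W (Re (G (0 +i* y)) - 1).
  by move=> /Kd [? _]; exact: is_deriveB.
have G1 (y : R) : Re (G (0 +i* y)) - 1 <= 0.
  rewrite subr_le0; apply: le_trans (ler_norm _) _; apply: le_trans (Re_le_normc _) _.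
  rewrite /G normcM normcV ler_pdivrMr ?normc_gt0 // mul1r.
  by apply: fle; rewrite argE /= expR0 mulr1.
have Wni (a b : R) : 0 <= a -> a <= b -> W b <= W a.
  move=> a0 ab; have [||c cab Wc] := @MVT_segment R W (fun y => Re (G (0 +i* y)) - 1) a b ab.
  - by move=> x; rewrite in_itv /= => /andP[ax xb]; apply: Wd; move: ax a0; clear; lra.
  - apply: derivable_within_continuous => x; rewrite in_itv /= => /andP[ax xb].
    by have [] : is_derive x 1 W (Re (G (0 +i* x)) - 1) by apply: Wd; move: ax a0; clear; lra.
  by rewrite -subr_le0 Wc mulr_le0_ge0 // subr_ge0.
have WE : W (2 * pi) = W 0.
  have := congr1 Re KE; rewrite mulr1 reB /= /W => KE'.
  by move: KE'; clear; lra.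
have Wcst (y : R) : 0 <= y <= 2 * pi -> W y = W 0.
  move=> /andP[y0 y2]; apply/eqP; rewrite eq_le Wni //= -WE Wni //.
have d0 : is_derive pi 1 W 0.
  apply: small_is_derive => e e0; exists pi => // y yp.
  have y2 : 0 <= y <= 2 * pi by move: yp; rewrite ltr_norml; move: p0; clear; lra.
  have p2 : 0 <= (pi : R) <= 2 * pi by rewrite (ltW p0) /= ler_peMl ?(ltW p0) // ler1n.
  by rewrite mul0r subr0 !Wcst // subrr normr0 mulr_ge0 // ltW.
have [|_ W1] := Wd pi; first by move: p0; clear; lra.
have : Re (G (0 +i* pi)) - 1 = 0 by rewrite -W1; have [_] := d0.
move=> /eqP; rewrite subr_eq0 => /eqP Gpi.
have Ge : G (0 +i* pi) = f w / f z0.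
  rewrite /G; congr (f _ / _).
  rewrite (_ : cexp _ = -1); first by ring.
  by apply: complexP; rewrite /= expR0 ?cospi ?sinpi ?mul1r ?oppr0.
apply/eqP; rewrite eq_le fle //=.
have := Re_le_normc (G (0 +i* pi)); rewrite Gpi normr1 Ge normcM normcV.
by rewrite ler_pdivlMr ?normc_gt0 // mul1r.
Qed.

End Goursat.

(** * Maximum principles *)

Section MaxPrinciple.
Variable R : realType.
Local Notation C := R[i].
Local Notation Re := (@complex.Re R).
Local Notation Im := (@complex.Im R).
Implicit Types (z w c : C) (A B G : set C) (f g : C -> C).

Lemma pow_unbounded (q M : R) : 1 < q -> exists n, M < q ^+ n.
Proof.
move=> q1; have q0 : 0 < q by apply: lt_trans q1.
have [n _ nP] : \forall n \near \oo, q^-1 ^+ n < (`|M| + 1)^-1.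
  have : (fun n => q^-1 ^+ n) @ \oo --> (0 : R).
    by apply: cvg_expr; rewrite ger0_norm ?invr_ge0 ?invf_lt1 // ltW.
  have M0 : 0 < (`|M| + 1)^-1 by rewrite invr_gt0 ltr_wpDl.
  move=> /cvgrPdist_lt /(_ _ M0); apply: filterS => n.
  by rewrite sub0r normrN ger0_norm // exprn_ge0 // invr_ge0 ltW.
exists n; have := nP n (leqnn n); rewrite exprVn ltf_pV2 ?posrE ?exprn_gt0 ?ltr_wpDl //.
apply: le_lt_trans; apply: le_trans (ler_norm M) _; by rewrite lerDl.
Qed.

Definition rcont (u : C -> R) z := forall e : R, 0 < e -> exists2 d : R, 0 < d &
  forall w, normc (w - z) < d -> `|u w - u z| < e.

Lemma rcont_normc f z : ccont f z -> rcont (fun w => normc (f w)) z.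
Proof.
move=> fz e /fz [d d0 dH]; exists d => // w /dH; apply: le_lt_trans.
rewrite ler_norml normc_leBD andbT lerNl opprB normcB; exact: normc_leBD.
Qed.

Lemma rcont_within (u : C -> R) (K : set C) : (forall z, K z -> rcont u z) ->
  {within K, continuous u}.
Proof.
move=> uK; apply: continuous_in_subspaceT => z; rewrite inE => Kz.
by apply/continuousRP; exact: uK.
Qed.

Lemma compact_maximum (u : C -> R) (K : set C) : K !=set0 -> compact K ->
  (forall z, K z -> rcont u z) -> exists2 z, K z & forall w, K w -> u w <= u z.
Proof.
move=> K0 cK uK; have [z Kz zP] := compact_EVT_max K0 cK (rcont_within uK).
exists z; first by move: Kz; rewrite inE.
by move=> w Kw; apply: zP; rewrite inE.
Qed.

Lemma Re_rcont z : rcont Re z.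
Proof.
move=> e e0; exists e => // w; apply: le_lt_trans; rewrite -reB; exact: Re_le_normc.
Qed.

(** The part of the sub-mean-value property that a maximum principle needs. It holds trivially at
    the zeros of a nonnegative [u], which allows quotients with cancelling zeros. *)
Definition submax (u : C -> R) z0 := exists2 d : R, 0 < d &
  forall w, 0 < normc (w - z0) < d ->
    (forall z, normc (z - z0) = normc (w - z0) -> u z <= u z0) -> u w = u z0.

Lemma submax_normc f z0 : (\forall z \near z0, cdiff f z) ->
  submax (fun z => normc (f z)) z0.
Proof.
move=> /nbhsCP [d d0 dH]; exists d => // w /andP[w0 wd] H.
apply: max_modulus_circle => //; first by rewrite -subr_eq0 -normc_gt0.
by move=> z zw; apply: dH; apply: le_lt_trans wd.
Qed.

Lemma submax_near (u v : C -> R) z0 (k : R) : 0 < k ->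
  (\forall w \near z0, u w = k * v w) -> submax v z0 -> submax u z0.
Proof.
move=> k0 /nbhsCP [d d0 dH] [t t0 tH]; exists (Num.min d t); first by rewrite lt_min d0.
move=> w; rewrite lt_min => /and3P[w0 wd wt] H.
have uz0 : u z0 = k * v z0 by apply: dH; exact: discxx.
rewrite uz0 dH //; congr (_ * _); apply: tH; first by rewrite w0.
by move=> z zw; have := H z zw; rewrite uz0 dH ?ler_pM2l // /disc /= zw.
Qed.

(* Among the points of K where u is maximal choose one, z0, with largest real
   part; submax gives further maximum points to the right of z0. *)
Lemma max_principle (K A : set C) (u : C -> R) (M : R) : compact K -> open A ->
  A `<=` K -> (forall z, K z -> rcont u z) -> (forall z, A z -> submax u z) ->
  (forall z, K z -> ~ A z -> u z <= M) -> forall z, K z -> u z <= M.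
Proof.
move=> cK oA AK uc us uM z1 Kz1; rewrite leNgt; apply/negP => Mz1.
have [m Km mP] : exists2 z, K z & forall w, K w -> u w <= u z.
  by apply: compact_maximum => //; exists z1.
pose S : set C := [set z | K z /\ u z = u m].
have cS : compact S.
  apply: (@subclosed_compact _ _ K) => //; last by move=> z [].
  rewrite -openC; apply/openCP => z Sz.
  have [Kz|Kz] := pselect (K z); last first.
    have cK' : closed K by apply: compact_closed => //; exact: norm_hausdorff.
    have /openCP /(_ z Kz) [e e0 eH] := closed_openC cK'.
    by exists e => // w /eH Kw [].
  have um : 0 < u m - u z.
    rewrite subr_gt0 lt_neqAle mP // andbT; apply/eqP => uzm; exact: Sz.
  have [d d0 dH] := uc z Kz _ um; exists d => // w /dH wz [Kw uw].
  by move: wz; rewrite uw ltNge ler_norm.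
have [z0 [Kz0 uz0] z0P] : exists2 z, S z & forall w, S w -> Re w <= Re z.
  by apply: compact_maximum => //; [exists m|move=> z _; exact: Re_rcont].
have Az0 : A z0.
  apply: contrapT => /(uM _ Kz0); rewrite uz0 leNgt => /negP; apply.
  exact: lt_le_trans (mP _ Kz1).
have /openCP /(_ _ Az0) [d d0 dH] := oA.
have [t t0 tH] := us _ Az0.
pose x : R := Num.min d t / 2.
have x0 : 0 < x by rewrite divr_gt0 // lt_min d0.
have xd : x < d /\ x < t.
  have : 0 < Num.min d t by rewrite lt_min d0.
  have : Num.min d t <= d by rewrite ge_min lexx.
  have : Num.min d t <= t by rewrite ge_min lexx orbT.
  by rewrite /x; clear; lra.
have nx : normc (z0 + x%:C - z0) = x by rewrite addrAC subrr add0r normc_real gtr0_norm.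
have Sx : S (z0 + x%:C).
  split; first by apply: AK; apply: dH; rewrite /disc /= nx; exact: xd.1.
  rewrite -uz0; apply: tH; first by rewrite nx x0 xd.2.
  move=> z; rewrite nx => zx; rewrite uz0; apply: mP; apply: AK; apply: dH.
  by rewrite /disc /= zx; exact: xd.1.
have := z0P _ Sx; rewrite reD /= gerDl leNgt x0 //.
Qed.

(* |a|^(n+1) / |b|^n extends by 0 to the zeros of b, where a vanishes as well;
   its maximum principle for all n gives the one for a / b. *)
Lemma quotient_max_principle (K A : set C) (a b : C -> C) (k : R) : compact K ->
  open A -> A `<=` K -> 0 <= k ->
  (forall z, K z -> \forall w \near z, cdiff a w /\ cdiff b w) ->
  (forall z, K z -> b z = 0 -> A z /\
     exists L : R, \forall w \near z, normc (a w) <= L * normc (b w)) ->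
  (forall z, K z -> ~ A z -> normc (a z) <= k * normc (b z)) ->
  forall z, K z -> normc (a z) <= k * normc (b z).
Proof.
move=> cK oA AK k0 dab b0 abk z1 Kz1.
have da z : K z -> cdiff a z.
  by move=> /dab /nbhsCP [d d0 /(_ z (discxx _ d0))] [].
have db z : K z -> cdiff b z.
  by move=> /dab /nbhsCP [d d0 /(_ z (discxx _ d0))] [].
have [m Km mP] : exists2 z, K z & forall w, K w -> normc (a w) <= normc (a z).
  apply: compact_maximum => //; first by exists z1.
  by move=> z Kz; apply: rcont_normc; apply: cdiff_cont; exact: da.
have az z : K z -> b z = 0 -> a z = 0.
  move=> Kz bz; have [_ [L /nbhsCP [d d0 /(_ z (discxx _ d0))]]] := b0 z Kz bz.
  by rewrite bz normc0 mulr0 => az; apply/eqP; rewrite -normc_eq0 eq_le az normc_ge0.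
(* Since 0^-1 = 0 and the exponent [n.+1] is positive, [g n] is 0 at the zeros of [b]; the
   additional factor of [a] makes it continuous there. *)
pose g n w := a w ^+ n.+2 * (b w)^-1 ^+ n.+1.
have gE n w : b w = 0 -> g n w = 0.
  by move=> bw; rewrite /g bw invr0 expr0n /= mulr0.
have dg n z : K z -> b z != 0 -> \forall w \near z, cdiff (g n) w.
  move=> Kz bz; have /nbhsCP [d d0 dH] := dab z Kz.
  have [t t0 tH] := ccont_neq0 bz (cdiff_cont (db z Kz)).
  apply/nbhsCP; exists (Num.min d t); first by rewrite lt_min d0.
  move=> w; rewrite /disc /= lt_min => /andP[/dH [daw dbw] /tH bw].
  apply: cdiffM; first exact: cdiffX.
  apply: cdiffX; apply: cdiffV => //; rewrite -normc_gt0.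
  exact: le_lt_trans (divr_ge0 (normc_ge0 _) _) bw.
have gk n z : K z -> normc (g n z) <= k ^+ n.+1 * normc (a m).
  move: z; apply: (max_principle cK oA AK).
  - move=> z Kz; have [bz|bz] := eqVneq (b z) 0; last first.
      apply: rcont_normc; apply: cdiff_cont.
      by have /nbhsCP [d d0] := dg n z Kz bz; apply; exact: discxx.
    move=> e e0; have [_ [L /nbhsCP [d d0 dH]]] := b0 z Kz bz.
    pose M : R := (`|L| + 1) ^+ n.+1.
    have M0 : 0 < M by rewrite exprn_gt0 // ltr_wpDl.
    have eM : 0 < e / M by rewrite divr_gt0.
    have [t t0 tH] := cdiff_cont (da z Kz) eM.
    exists (Num.min d t); first by rewrite lt_min d0.
    move=> w; rewrite lt_min => /andP[/dH aLb /tH]; rewrite (az z Kz bz) subr0 => awM.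
    rewrite [g n z]gE // normc0 subr0 ger0_norm ?normc_ge0 //.
    have [bw|bw] := eqVneq (b w) 0; first by rewrite gE // normc0.
    have bw0 : 0 < normc (b w) by rewrite normc_gt0.
    rewrite /g exprS normcM normcM !normcX normcV -mulrA -exprMn.
    apply: le_lt_trans (_ : normc (a w) * M < _); last by rewrite -ltr_pdivlMr.
    rewrite ler_wpM2l ?normc_ge0 // /M lerXn2r ?nnegrE ?divr_ge0 ?normc_ge0 //.
    rewrite ler_pdivrMr //; apply: le_trans aLb _; rewrite ler_wpM2r ?normc_ge0 //.
    by apply: le_trans (ler_norm _) _; rewrite lerDl.
  - move=> z Az; have Kz := AK _ Az; have [bz|bz] := eqVneq (b z) 0.
      exists 1 => // w _ H; apply/eqP; rewrite eq_le H //.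
      by rewrite [g n z]gE // normc0 normc_ge0.
    by apply: submax_normc; exact: dg.
  - move=> z Kz Az; have bz : b z != 0.
      by apply/eqP => /(b0 _ Kz) [].
    have bz0 : 0 < normc (b z) by rewrite normc_gt0.
    rewrite /g exprS normcM normcM !normcX normcV -mulrA -exprMn mulrC.
    apply: ler_pM; rewrite ?exprn_ge0 ?divr_ge0 ?normc_ge0 ?mP //.
    by rewrite lerXn2r ?nnegrE ?divr_ge0 ?normc_ge0 // ler_pdivrMr // abk.
rewrite leNgt; apply/negP => kab.
have az1 : 0 < normc (a z1) by apply: le_lt_trans kab; rewrite mulr_ge0 // normc_ge0.
have bz1 : b z1 != 0.
  by apply/eqP => /(az _ Kz1) a0; move: az1; rewrite a0 normc0 ltxx.
have bz0 : 0 < normc (b z1) by rewrite normc_gt0.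
have k1 : 0 < k.
  rewrite lt_neqAle k0 andbT; apply/eqP => k00.
  have := gk 0%N z1 Kz1; rewrite -k00 expr0n mul0r /g leNgt => /negP; apply.
  by rewrite normcM !normcX normcV mulr_gt0 // exprn_gt0 // invr_gt0.
(* The bound on [g n] at [z1] reads |a z1| q^(n+1) <= |a m|, which fails for large n if q > 1. *)
pose q := normc (a z1) / (k * normc (b z1)).
have q1 : 1 < q by rewrite /q ltr_pdivlMr ?mulr_gt0 // mul1r.
have [n nq] := pow_unbounded (normc (a m) / normc (a z1)) q1.
have := gk n z1 Kz1; rewrite /g exprS normcM normcM !normcX normcV -mulrA -exprMn.
rewrite -ler_pdivrMl ?exprn_gt0 // leNgt => /negP; apply.
move: nq; rewrite ltr_pdivrMr // => /lt_le_trans; apply.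
rewrite mulrCA mulrC ler_wpM2l ?normc_ge0 // -exprVn -exprMn.
rewrite (_ : _ * _ = q); last by rewrite /q; field; rewrite !gt_eqF.
by rewrite exprS ler_peMl ?exprn_ge0 // ltW // (lt_trans _ q1).
Qed.

End MaxPrinciple.

(** * Zeros and polynomial growth *)

Section Zeros.
Variable R : realType.
Local Notation C := R[i].
Local Notation Re := (@complex.Re R).
Local Notation Im := (@complex.Im R).
Implicit Types (z w c : C) (A B G : set C) (f g : C -> C).

(** Differentiability is required in a neighbourhood of each point, since [A] will mostly be a
    closed disc. *)
Definition holomorphic_on (A : set C) f := forall z, A z -> \forall w \near z, cdiff f w.

Lemma entire_holomorphic (A : set C) f : (forall z, cdiff f z) -> holomorphic_on A f.
Proof. by move=> df z _; apply/nbhsCP; exists 1 => // w _. Qed.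

Lemma holomorphic_open (A : set C) f : open A -> (forall z, A z -> cdiff f z) ->
  holomorphic_on A f.
Proof.
move=> /openCP oA df z /oA [d d0 dH]; apply/nbhsCP; exists d => // w /dH; exact: df.
Qed.

(** The common source of the maximum and minimum modulus principles, of the Schwarz lemma and of the
    division by linear factors, according to the choice of [b]. *)
Lemma disc_quotient_max (a b : C -> C) c (r k : R) : 0 <= k ->
  holomorphic_on (cdisc c r) a -> holomorphic_on (cdisc c r) b ->
  (forall z, cdisc c r z -> b z = 0 -> disc c r z /\
     exists L : R, \forall w \near z, normc (a w) <= L * normc (b w)) ->
  (forall z, normc (z - c) = r -> normc (a z) <= k * normc (b z)) ->
  forall z, normc (z - c) <= r -> normc (a z) <= k * normc (b z).
Proof.
move=> k0 da db b0 abk; apply: (@quotient_max_principle _ (cdisc c r) (disc c r)) => //.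
- exact: cdisc_compact.
- exact: disc_open.
- by move=> z; exact: ltW.
- by move=> z Kz; apply: filterS2 (da z Kz) (db z Kz) => w.
- move=> z Kz nz; apply: abk; apply/eqP; rewrite eq_le; apply/andP; split => //.
  by rewrite leNgt; apply/negP.
Qed.

Lemma max_modulus_disc f c (r M : R) : holomorphic_on (cdisc c r) f ->
  0 <= M -> (forall z, normc (z - c) = r -> normc (f z) <= M) ->
  forall z, normc (z - c) <= r -> normc (f z) <= M.
Proof.
move=> df M0 fM z zr; rewrite -[M]mulr1 -(normc1 R).
apply: (@disc_quotient_max f (fun=> 1) c r M) => //.
- by apply: entire_holomorphic => w; exact: cdiff_cst.
- by move=> w _ /eqP; rewrite oner_eq0.
- by move=> w /fM; rewrite normc1 mulr1.
Qed.

Lemma min_modulus_disc f c (r m : R) : 0 <= r -> 0 < m -> holomorphic_on (cdisc c r) f ->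
  (forall z, cdisc c r z -> f z != 0) ->
  (forall z, normc (z - c) = r -> m <= normc (f z)) -> m <= normc (f c).
Proof.
move=> r0 m0 df f0 fm.
have := @disc_quotient_max (fun=> 1) f c r m^-1; rewrite invr_ge0 (ltW m0) => /(_ isT).
rewrite -(ler_pM2l (_ : 0 < m^-1)) ?invr_gt0 // mulVf ?gt_eqF // -(normc1 R).
apply => //.
- by apply: entire_holomorphic => w; exact: cdiff_cst.
- by move=> z /f0 /eqP.
- by move=> z /fm; rewrite normc1 -ler_pdivrMl ?invr_gt0 // mulr1 invrK.
- by rewrite subrr normc0.
Qed.

Lemma cdiff_lipschitz f z : cdiff f z ->
  exists2 L : R, 0 < L & \forall w \near z, normc (f w - f z) <= L * normc (w - z).
Proof.
move=> /cdiffP [d /(_ 1 ltr01) [t t0 tH]]; exists (1 + normc d).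
  by rewrite ltr_pwDl // normc_ge0.
apply/nbhsCP; exists t => // w /tH; rewrite mul1r => H.
rewrite -[_ - f z](subrK (d * (w - z))) mulrDl mul1r -normcM.
exact: le_trans (normcD _ _) (lerD H _).
Qed.

Definition nodal (s : seq C) z : C := \prod_(x <- s) (z - x).

Lemma cdiff_nodal s z : cdiff (nodal s) z.
Proof.
by apply: cdiff_prod => x; apply: cdiffB; [exact: cdiff_id|exact: cdiff_cst].
Qed.

Lemma nodal_eq0 s z : (nodal s z == 0) = (z \in s).
Proof.
elim: s => [|x s IH]; first by rewrite /nodal big_nil oner_eq0.
by rewrite /nodal big_cons mulf_eq0 -/(nodal s z) IH in_cons subr_eq0.
Qed.

(** The nodes are distinct, so the other factors of [nodal s] stay away from 0 near [z], while f is
    Lipschitz there. *)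
Lemma nodal_quotient_bounded (s : seq C) f z : uniq s -> z \in s -> f z = 0 -> cdiff f z ->
  exists L : R, \forall w \near z, normc (f w) <= L * normc (nodal s w).
Proof.
move=> us zs fz df.
have nE w : nodal s w = (w - z) * nodal (rem z s) w.
  by rewrite /nodal (perm_big _ (perm_to_rem zs)) /= big_cons.
have nz0 : nodal (rem z s) z != 0.
  by rewrite nodal_eq0 mem_rem_uniq // inE eqxx.
have [L L0 /nbhsCP [d d0 dH]] := cdiff_lipschitz df.
have [t t0 tH] := ccont_neq0 nz0 (cdiff_cont (cdiff_nodal _ _)).
set m : R := normc _ / 2 in tH; have m0 : 0 < m by rewrite divr_gt0 // normc_gt0.
exists (L / m); apply/nbhsCP; exists (Num.min d t); first by rewrite lt_min d0.
move=> w; rewrite /disc /= lt_min => /andP[/dH + /tH wm]; rewrite fz subr0 => /le_trans; apply.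
rewrite nE normcM.
have -> : L / m * (normc (w - z) * normc (nodal (rem z s) w)) =
    L * normc (w - z) * (normc (nodal (rem z s) w) / m) by ring.
by rewrite ler_peMr ?mulr_ge0 ?normc_ge0 ?(ltW L0) // ler_pdivlMr // mul1r ltW.
Qed.

Lemma nodal_quotient_max (s : seq C) f (r k : R) : (forall z, cdiff f z) -> uniq s -> 0 <= k ->
  (forall z, z \in s -> normc z < r /\ f z = 0) ->
  (forall z, normc z = r -> normc (f z) <= k * normc (nodal s z)) ->
  forall z, normc z <= r -> normc (f z) <= k * normc (nodal s z).
Proof.
move=> df us k0 sP fk z zr.
apply: (@disc_quotient_max f (nodal s) 0 r k); rewrite ?subr0 //.
- exact: entire_holomorphic.
- by apply: entire_holomorphic => w; exact: cdiff_nodal.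
- move=> w wr /eqP; rewrite nodal_eq0 => ws; have [w1 w2] := sP _ ws.
  by rewrite /disc /= subr0; split => //; exact: nodal_quotient_bounded.
- by move=> w; rewrite subr0; exact: fk.
Qed.

Lemma normc_nodal_ge (s : seq C) z (m : R) : 0 <= m ->
  (forall x, x \in s -> m <= normc (z - x)) -> m ^+ size s <= normc (nodal s z).
Proof.
move=> m0; elim: s => [|x s IH] H; first by rewrite /nodal big_nil normc1 expr0.
rewrite /nodal big_cons normcM exprS ler_pM ?exprn_ge0 ?H ?mem_head //.
by apply: IH => y ys; apply: H; rewrite in_cons ys orbT.
Qed.

Lemma normc_nodal_le (s : seq C) z (m : R) :
  (forall x, x \in s -> normc (z - x) <= m) -> normc (nodal s z) <= m ^+ size s.
Proof.
elim: s => [|x s IH] H; first by rewrite /nodal big_nil normc1 expr0.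
rewrite /nodal big_cons normcM exprS ler_pM ?normc_ge0 ?H ?mem_head //.
by apply: IH => y ys; apply: H; rewrite in_cons ys orbT.
Qed.

Lemma circle_bounded f (r : R) : (forall z, cdiff f z) ->
  exists2 M : R, 0 < M & forall z, normc z <= r -> normc (f z) <= M.
Proof.
move=> df; have [r0|r0] := ltP r 0.
  by exists 1 => // z zr; have := le_lt_trans zr r0; rewrite ltNge normc_ge0.
have [|||m _ mP] := @compact_maximum R (fun z => normc (f z)) (cdisc 0 r).
- by exists 0; rewrite /cdisc /mkset subr0 normc0.
- exact: cdisc_compact.
- by move=> z _; apply: rcont_normc; exact: cdiff_cont.
exists (normc (f m) + 1); first by rewrite ltr_wpDl // normc_ge0.
by move=> z zr; apply: le_trans (mP z _) _; rewrite /cdisc /= ?subr0 // lerDl.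
Qed.

(** Divide f by the product over N zeros. On |z| = 4 p this product is at least (3 p)^N, at [z1] at
    most (2 p)^N, so that |f z1| <= M (2 / 3)^N for every N. *)
Lemma entire_many_zeros f (r : R) : (forall z, cdiff f z) ->
  (forall N, exists s : seq C, [/\ uniq s, size s = N &
     forall z, z \in s -> normc z <= r /\ f z = 0]) ->
  forall z, f z = 0.
Proof.
move=> df H z1.
pose p : R := Num.max (Num.max r (normc z1)) 1.
have rp : r <= p by rewrite !le_max lexx.
have zp : normc z1 <= p by rewrite !le_max lexx orbT.
have p1 : 1 <= p by rewrite !le_max lexx orbT.
have p0 : 0 < p by apply: lt_le_trans p1.
have [M M0 fM] := circle_bounded (4 * p) df.
have bound N : normc (f z1) <= M * (2 / 3) ^+ N.
  have [s [us sN sP]] := H N.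
  have k0 : 0 <= M / (3 * p) ^+ N.
    by rewrite divr_ge0 ?exprn_ge0 ?mulr_ge0 ?(ltW M0) ?(ltW p0).
  have Q := @nodal_quotient_max s f (4 * p) (M / (3 * p) ^+ N) df us k0.
  apply: le_trans (Q _ _ z1 _) _.
  - move=> z /sP [zr ->]; split => //; move: zr rp p0; clear; lra.
  - move=> z z4; apply: le_trans (fM z _) _; first by rewrite z4.
    rewrite mulrAC ler_pdivlMr ?exprn_gt0 ?mulr_gt0 // ler_wpM2l ?(ltW M0) //.
    rewrite -sN; apply: normc_nodal_ge; first by rewrite mulr_ge0 // ltW.
    move=> x /sP [xr _]; have := normc_leBD z x; rewrite z4; move: xr rp; clear; lra.
  - by move: zp p0; clear; lra.
  rewrite -mulrA ler_wpM2l ?(ltW M0) // ler_pdivrMl ?exprn_gt0 ?mulr_gt0 // -exprMn.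
  rewrite (_ : 3 * p * (2 / 3) = 2 * p); last by field.
  rewrite -sN; apply: normc_nodal_le => x /sP [xr _].
  by have := normcD z1 (- x); rewrite normcN; move: xr rp zp; clear; lra.
apply/eqP; rewrite -normc_eq0 eq_le normc_ge0 andbT leNgt; apply/negP => f0.
have q1 : 1 < 3 / 2 :> R by lra.
have [n] := pow_unbounded (M / normc (f z1)) q1.
rewrite ltNge => /negP; apply; rewrite ler_pdivlMr // -ler_pdivlMl ?exprn_gt0 //.
  by rewrite mulrC -exprVn invf_div.
Qed.

(** Otherwise f - f z0 has arbitrarily many zeros in a bounded disc: each new one is taken closer to
    [z0] than all earlier ones, which keeps them distinct. *)
Lemma isolated_value f z0 : (forall z, cdiff f z) -> (exists z, f z != f z0) ->
  exists2 d : R, 0 < d & forall w, 0 < normc (w - z0) <= d -> f w != f z0.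
Proof.
move=> df [z1 z1P]; apply: contrapT => H.
have acc d : 0 < d -> exists w, 0 < normc (w - z0) <= d /\ f w = f z0.
  move=> d0; apply: contrapT => K; apply: H; exists d => // w wd.
  by apply/eqP => fw; apply: K; exists w.
have : f z1 - f z0 = 0.
  apply: (@entire_many_zeros (fun z => f z - f z0) (normc z0 + 1)) => [z|N].
    by apply: cdiffB => //; exact: cdiff_cst.
  suff [s [us sN sP]] : exists s : seq C, [/\ uniq s, size s = N &
      forall z, z \in s -> 0 < normc (z - z0) <= 1 /\ f z = f z0].
    exists s; split=> // z /sP [/andP[_ z1'] ->]; rewrite subrr; split => //.
    by have := normcD (z - z0) z0; rewrite subrK; move: z1'; clear; lra.
  elim: N => [|N [s [us sN sP]]]; first by exists [::].
  have [d d0 dP] : exists2 d : R, 0 < d <= 1 & forall z, z \in s -> d < normc (z - z0).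
    elim: s {us sN} sP => [|x s IH] sP; first by exists 1; rewrite ?ltr01 ?lexx.
    have [z zs|d d0 dP] := IH; first by apply: sP; rewrite in_cons zs orbT.
    have [/andP[x0 _] _] := sP x (mem_head _ _).
    exists (Num.min d (normc (x - z0) / 2)).
      by rewrite lt_min ge_min (andP d0).1 (andP d0).2 divr_gt0.
    move=> z; rewrite in_cons => /orP[/eqP ->|zs].
      by rewrite gt_min; apply/orP; right; move: x0; clear; lra.
    by rewrite gt_min dP.
  have [w [/andP[w0 wd] fw]] := acc d (andP d0).1.
  exists (w :: s); split; [|by rewrite /= sN|move=> z].
    by rewrite /= us andbT; apply/negP => /dP; rewrite ltNge wd.
  rewrite in_cons => /orP[/eqP ->|/sP //]; split => //.
  by rewrite w0 (le_trans wd (andP d0).2).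
by move/eqP; rewrite subr_eq0 (negbTE z1P).
Qed.

(** Let m > 0 be the minimum of |f - f z0| on a small circle. If a value p closer than m / 2 to f z0
    were omitted, the minimum principle for f - p would give m / 2 <= |f z0 - p|. *)
Lemma open_mapping f (A : set C) : (forall z, cdiff f z) ->
  (forall c, exists z, f z != c) -> open A -> open (f @` A).
Proof.
move=> df fn /openCP oA; apply/openCP => _ [z0 Az0 <-].
have [d d0 dA] := oA _ Az0.
have [t t0 tP] := isolated_value df (fn (f z0)).
pose r : R := Num.min (d / 2) t.
have r0 : 0 < r by rewrite lt_min t0 divr_gt0.
have rd : r < d.
  apply: le_lt_trans (_ : d / 2 < d); first by rewrite ge_min lexx.
  by move: d0; clear; lra.
have rt : r <= t by rewrite ge_min lexx orbT.
pose S : set C := [set z | normc (z - z0) = r].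
have S0 : S (z0 + r%:C).
  by rewrite /S /= addrAC subrr add0r normc_real gtr0_norm.
have cS : compact S.
  apply: (@bounded_closed_compactC _ _ z0 r); last first.
    by move=> z Sz; rewrite /cdisc /mkset (Sz : normc (z - z0) = r) lexx.
  rewrite -openC; apply/openCP => z /eqP zS.
  have n0 : 0 < `|normc (z - z0) - r| by rewrite normr_gt0 subr_eq0.
  exists `|normc (z - z0) - r| => // w wz wS; move: wz; rewrite /disc /= ltNge.
  move=> /negP; apply; rewrite -wS ler_norml.
  have := normc_triangle z w z0; have := normc_triangle w z z0.
  by rewrite (normcB z w); clear; lra.
have [||z _|w wS wP] := @compact_maximum R (fun z => - normc (f z - f z0)) S.
- by exists (z0 + r%:C).
- exact: cS.
- have cf : ccont (fun z => f z - f z0) z.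
    by apply: cdiff_cont; apply: cdiffB => //; exact: cdiff_cst.
  move=> e /(rcont_normc cf) [p p0 pH]; exists p => // w /pH.
  by rewrite -opprD normrN.
set m := normc (f w - f z0).
have m0 : 0 < m.
  by rewrite normc_gt0 subr_eq0 tP //; move: wS; rewrite /S /= => ->; rewrite r0.
exists (m / 2); first by rewrite divr_gt0.
move=> p; rewrite /disc /= => pm; apply: contrapT => np.
have : m / 2 <= normc (f z0 - p).
  apply: (@min_modulus_disc (fun z => f z - p) z0 r); rewrite ?(ltW r0) ?divr_gt0 //.
  - by apply: entire_holomorphic => z; apply: cdiffB => //; exact: cdiff_cst.
  - move=> z zr; apply/eqP => /eqP; rewrite subr_eq0 => /eqP fz; apply: np.
    by exists z => //; apply: dA; apply: le_lt_trans rd.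
  - move=> z zr; have := wP z zr; rewrite lerN2 -/m => mz.
    have := normc_triangle (f z) p (f z0); move: mz pm; clear; lra.
by rewrite normcB leNgt pm.
Qed.

Lemma interpolation (s : seq C) f : uniq s ->
  exists p : {poly C}, (size p <= size s)%N /\ forall x, x \in s -> p.[x] = f x.
Proof.
elim: s => [|x s IH] /=; first by exists 0; rewrite size_poly0.
move=> /andP[xs /IH [p [sp pP]]].
pose q := \prod_(y <- s) ('X - y%:P).
have qE z : q.[z] = nodal s z.
  by rewrite /q horner_prod; apply: eq_bigr => y _; rewrite hornerXsubC.
have qx : q.[x] != 0 by rewrite qE nodal_eq0.
exists (p + ((f x - p.[x]) / q.[x]) *: q); split.
  apply: leq_trans (size_polyD _ _) _; rewrite geq_max (leq_trans sp) //=.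
  by apply: leq_trans (size_scale_leq _ _) _; rewrite size_prod_XsubC.
move=> y; rewrite in_cons hornerD hornerZ => /orP[/eqP ->|ys].
  by rewrite divfK // addrC subrK.
rewrite pP // (qE y); have /eqP -> : nodal s y == 0 by rewrite nodal_eq0.
by rewrite mulr0 addr0.
Qed.

Lemma poly_growth (p : {poly C}) d : (size p <= d.+1)%N ->
  exists2 M : R, 0 < M & forall z, 1 <= normc z -> normc p.[z] <= M * normc z ^+ d.
Proof.
move=> sp; exists (\sum_(i < size p) normc p`_i + 1).
  by rewrite ltr_wpDl // sumr_ge0 // => i _; exact: normc_ge0.
move=> z z1; rewrite horner_coef.
apply: le_trans (_ : \sum_(i < size p) normc p`_i * normc z ^+ d <= _).
  elim/big_ind2: _ => [|x y u v xy uv|i _]; first by rewrite normc0.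
    exact: le_trans (normcD _ _) (lerD xy uv).
  rewrite normcM normcX ler_wpM2l ?normc_ge0 // ler_weXn2l //.
  by have := leq_trans (ltn_ord i) sp; rewrite ltnS.
by rewrite -mulr_suml ler_wpM2r ?exprn_ge0 ?normc_ge0 // lerDl.
Qed.

(* (f - p) / nodal with p interpolating f at d + 1 nodes is O(1/|z|) on
   arbitrarily large circles, hence 0. *)
Lemma entire_poly_growth f d : (forall z, cdiff f z) ->
  (forall r0 : R, exists2 r : R, r0 <= r & forall z, normc z = r -> normc (f z) <= r ^+ d) ->
  exists p : {poly C}, forall z, f z = p.[z].
Proof.
move=> df grow.
pose s : seq C := [seq i%:R%:C | i <- iota 0 d.+1].
have us : uniq s.
  rewrite map_inj_uniq ?iota_uniq // => i j /complexI /eqP.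
  by rewrite eqr_nat => /eqP.
have ss : size s = d.+1 by rewrite size_map size_iota.
have sx x : x \in s -> exists2 i : nat, (i < d.+1)%N & x = i%:R%:C.
  by rewrite /s => /mapP[j]; rewrite mem_iota add0n => /andP[_ jd] ->; exists j.
have [p [sp pP]] := interpolation f us; rewrite ss in sp.
have [M M0 pM] := poly_growth sp.
exists p => z1; apply/eqP; rewrite -subr_eq0 -normc_eq0 eq_le normc_ge0 andbT.
apply/ler_addgt0Pl => e e0; rewrite addr0.
pose N := normc (nodal s z1).
(* On |z| = r >= 2 (d + 1) the nodal polynomial is at least (r / 2)^(d+1) and |f - p| at most (1 +
   M) r^d, so the quotient is at most B / r. *)
pose B : R := (1 + M) * 2 ^+ d.+1.
have B0 : 0 < B by rewrite mulr_gt0 ?exprn_gt0 // addr_gt0.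
have N1 : 0 < N + 1 by rewrite ltr_wpDl // normc_ge0.
have [r rR fr] := grow (Num.max (Num.max (normc z1) (2 * d.+1%:R)) (B * (N + 1) / e)).
have [r1 r2 r3] : [/\ normc z1 <= r, 2 * d.+1%:R <= r & B * (N + 1) / e <= r].
  by move: rR; rewrite !ge_max => /andP[/andP[-> ->] ->].
have rr1 : 1 <= r.
  apply: le_trans r2; have : 1 <= d.+1%:R :> R by rewrite ler1n.
  by clear; lra.
have rr0 : 0 < r by apply: lt_le_trans rr1.
have : normc (f z1 - p.[z1]) <= B / r * N.
  apply: (@nodal_quotient_max s (fun z => f z - p.[z]) r (B / r)) => //.
  - by move=> z; apply: cdiffB => //; exact: cdiff_horner.
  - by rewrite divr_ge0 // ltW.
  - move=> z zs; rewrite pP // subrr; split => //.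
    have [i id ->] := sx _ zs.
    rewrite normc_real normr_nat; apply: lt_le_trans r2.
    by rewrite -natrM ltr_nat (leq_trans id) // leq_pmull.
  - move=> z zr; apply: le_trans (_ : (1 + M) * r ^+ d <= _).
      apply: le_trans (normcD _ _) _; rewrite normcN mulrDl mul1r lerD ?fr //.
      by rewrite -zr pM // zr.
    rewrite /B -!mulrA ler_wpM2l ?(addr_ge0 ler01 (ltW M0)) //.
    have Q : (r / 2) ^+ d.+1 <= normc (nodal s z).
      rewrite -ss; apply: normc_nodal_ge; first by rewrite divr_ge0 // ltW.
      move=> x /sx [i id ->].
      have := normc_leBD z i%:R%:C; rewrite zr normc_real normr_nat.
      have : i%:R <= d.+1%:R :> R by rewrite ler_nat ltnW.
      by move: r2; clear; lra.
    have -> : r ^+ d = 2 ^+ d.+1 * (r^-1 * (r / 2) ^+ d.+1).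
      rewrite exprMn exprVn [r ^+ d.+1]exprS; field.
      by rewrite gt_eqF ?exprn_gt0 // gt_eqF.
    by rewrite ler_wpM2l ?exprn_ge0 // ler_wpM2l // invr_ge0 ltW.
move=> /le_trans; apply.
rewrite mulrAC ler_pdivrMr // -ler_pdivrMl // mulrC.
apply: le_trans r3; rewrite ler_wpM2r ?invr_ge0 ?(ltW e0) // ler_wpM2l ?(ltW B0) //.
by rewrite lerDl.
Qed.

End Zeros.

(** * Logarithms and Harnack's inequality *)

Section Harnack.
Variable R : realType.
Local Notation C := R[i].
Local Notation Re := (@complex.Re R).
Local Notation Im := (@complex.Im R).
Implicit Types (z w c : C) (A B G : set C) (f g : C -> C).

Lemma rcont_comp (h : R -> R) (u : C -> R) z : rcont u z -> {for u z, continuous h} ->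
  rcont (fun w => h (u w)) z.
Proof.
move=> uz /cvgrPdist_lt hz e e0.
have /nbhs_ballP [d /= d0 dH] := hz _ e0.
have [t t0 tH] := uz _ d0; exists t => // w /tH wt.
by rewrite distrC; apply: dH; rewrite /ball /= distrC.
Qed.

Lemma rcont_ccont (u v : C -> R) z : rcont u z -> rcont v z ->
  ccont (fun w => u w +i* v w) z.
Proof.
move=> uz vz e e0; have e20 : 0 < e / 2 by rewrite divr_gt0.
have [d d0 dH] := uz _ e20; have [t t0 tH] := vz _ e20.
exists (Num.min d t); first by rewrite lt_min d0.
move=> w; rewrite lt_min => /andP[/dH h1 /tH h2].
apply: le_lt_trans (normc_le_ReIm _) _ => /=; move: h1 h2; clear; lra.
Qed.

Lemma rcontM (u v : C -> R) z : rcont u z -> rcont v z -> rcont (fun w => u w * v w) z.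
Proof.
move=> uz vz.
have r0 : rcont (fun=> 0) z by move=> e e0; exists 1 => // w _; rewrite subrr normr0.
have uv := ccontM (rcont_ccont uz r0) (rcont_ccont vz r0).
move=> e /uv [d d0 dH]; exists d => // w /dH; apply: le_lt_trans.
by apply: le_trans (Re_le_normc _); rewrite /= !mulr0 !subr0.
Qed.

Lemma Im_rcont z : rcont Im z.
Proof.
move=> e e0; exists e => // w; apply: le_lt_trans; rewrite -imB; exact: Im_le_normc.
Qed.

(** The principal branch, but only on the right half-plane, where atan (Im z / Re z) is the
    argument. *)
Definition clog z : C := ln (normc z) +i* atan (Im z / Re z).

Lemma clogK z : 0 < Re z -> cexp (clog z) = z.
Proof.
move=> z0; have z1 : z != 0 by apply: contraTneq z0 => ->; rewrite ltxx.
have n0 : 0 < normc z by rewrite normc_gt0.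
set x := Im z / Re z.
have xE : normc z = Re z * Num.sqrt (1 + x ^+ 2).
  rewrite -[Re z in RHS](ger0_norm (ltW z0)) -sqrtr_sqr -sqrtrM ?sqr_ge0 //.
  rewrite mulrDr mulr1 -exprMn /x mulrC divfK ?gt_eqF //.
  by case: z {z0 z1 n0 x}.
have s0 : 0 < Num.sqrt (1 + x ^+ 2) by rewrite sqrtr_gt0 ltr_pwDl // sqr_ge0.
have cE : normc z * cos (atan x) = Re z.
  by rewrite cos_atan xE -mulrA divff ?mulr1 // gt_eqF.
apply: complexP; rewrite /= lnK ?posrE //.
have cx : cos (atan x) != 0 by rewrite cos_atan gt_eqF // invr_gt0.
have -> : sin (atan (Im z / Re z)) = x * cos (atan x).
  by rewrite -{1}(atanK x) /tan divfK.
by rewrite mulrCA cE /x divfK // gt_eqF.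
Qed.

Lemma clog_cont z : 0 < Re z -> ccont clog z.
Proof.
move=> z0; have z1 : z != 0 by apply: contraTneq z0 => ->; rewrite ltxx.
apply: rcont_ccont.
  apply: (rcont_comp (rcont_normc (@ccont_id _ z))).
  by apply: continuous_ln; rewrite normc_gt0.
apply: rcont_comp; last exact: continuous_atan.
apply: rcontM; first exact: Im_rcont.
apply: (rcont_comp (@Re_rcont _ z)).
by apply: inv_continuous; rewrite gt_eqF.
Qed.

(** If q vanished at z, then e^(z+x) - e^z would be o(x), against e^x - 1 >= x for real x. The
    nonzero quotient serves to differentiate [clog] as an inverse function. *)
Lemma cexp_quotient z : exists q : C -> C, [/\ ccont q z, q z != 0 &
  forall w, cexp w = cexp z + q w * (w - z)].
Proof.
have [q qc qE] := cdiff_cexp z; exists q; split => //; apply/eqP => qz0.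
pose e := expR (Re z); have e0 : 0 < e by exact: expR_gt0.
have [d d0 dH] := qc _ e0.
pose x : R := d / 2; have x0 : 0 < x by rewrite divr_gt0.
have nx : normc (z + x%:C - z) = x by rewrite addrAC subrr add0r normc_real gtr0_norm.
have := dH (z + x%:C); rewrite nx qz0 subr0.
have xd : x < d by move: d0; rewrite /x; clear; lra.
move=> /(_ xd) H; have : normc (q (z + x%:C) * (z + x%:C - z)) < e * x.
  by rewrite normcM nx ltr_pM2r.
have -> : q (z + x%:C) * (z + x%:C - z) = cexp z * (cexp x%:C - 1).
  by rewrite [RHS]mulrBr mulr1 -cexpD [cexp (z + _)]qE [in RHS]addrAC subrr add0r.
rewrite normcM normc_cexp ltr_pM2l // ltNge => /negP; apply.
have -> : cexp x%:C - 1 = (expR x - 1)%:C.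
  by apply: complexP; rewrite ?reB ?imB /= ?cos0 ?sin0 ?mulr1 ?mulr0 ?subr0.
rewrite normc_real; apply: le_trans (ler_norm _).
by rewrite lerBrDl expR_ge1Dx.
Qed.

Lemma cdiff_clog z : 0 < Re z -> cdiff clog z.
Proof.
move=> z0; have [q [qc q0 qE]] := cexp_quotient (clog z).
have lc := clog_cont z0.
have ql : ccont (fun w => q (clog w)) z by apply: ccont_comp.
have [d d0 dH] := ccont_neq0 q0 ql.
pose g w := clog z + (q (clog w))^-1 * (w - z).
apply: (@cdiff_near _ g); last first.
  by exists (fun w => (q (clog w))^-1); [exact: ccontV|move=> w; rewrite /g subrr mulr0 addr0].
apply/nbhsCP; exists (Num.min d (Re z)); first by rewrite lt_min d0.
move=> w; rewrite /disc /= lt_min => /andP[/dH wd wz].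
have w0 : 0 < Re w.
  have := le_lt_trans (Re_le_normc _) wz; rewrite reB ltr_norml; clear; lra.
have qw : q (clog w) != 0.
  by rewrite -normc_gt0; apply: le_lt_trans wd; rewrite divr_ge0 // normc_ge0.
rewrite /g -{2}(clogK w0) qE clogK // [z + _]addrC addrK mulKf //.
by rewrite addrC subrK.
Qed.

Lemma cluster_sequence (K : set C) (w : nat -> C) : compact K -> (forall n, K (w n)) ->
  exists2 p, K p & forall (d : R) N, 0 < d -> exists2 n, (N <= n)%N & normc (w n - p) < d.
Proof.
move=> cK Kw.
have [|p [Kp pw]] := cK (w @ \oo) _; first by exists 0%N => // n _; exact: Kw.
exists p => // d N d0.
have [|_ [[n Nn <-] np]] := pw [set w n | n in [set n | (N <= n)%N]] (disc p d) _ (disc_nbhs p d0).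
  by exists N => // n Nn; exists n.
by exists n.
Qed.

Lemma uniform_cont (K : set C) f (e : R) : compact K -> (forall z, K z -> ccont f z) ->
  0 < e -> exists2 d : R, 0 < d & forall z w, K z -> K w -> normc (z - w) < d ->
    normc (f z - f w) < e.
Proof.
move=> cK fK e0; apply: contrapT => H.
have /choice [p pP] : forall n : nat, exists p : C * C, [/\ K p.1, K p.2,
    normc (p.1 - p.2) < n.+1%:R^-1 & e <= normc (f p.1 - f p.2)].
  move=> n; apply: contrapT => L; apply: H; exists n.+1%:R^-1; first by rewrite invr_gt0.
  move=> z w Kz Kw zw; rewrite ltNge; apply/negP => ze; apply: L.
  by exists (z, w).
have [|q Kq qP] := @cluster_sequence K (fun n => (p n).1) cK.
  by move=> n; have [] := pP n.
have e20 : 0 < e / 2 by rewrite divr_gt0.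
have [d d0 dH] := fK q Kq _ e20.
have d20 : 0 < d / 2 by rewrite divr_gt0.
have [N NP] : exists N : nat, forall n, (N <= n)%N -> n.+1%:R^-1 < d / 2 :> R.
  have /cvgrPdist_lt /(_ _ d20) [N _ NP] := @cvg_harmonic R.
  exists N => n Nn; have := NP n Nn; rewrite sub0r normrN ger0_norm //.
  by rewrite /harmonic /= invr_ge0.
have [n Nn nq] := qP (d / 2) N d20.
have [K1 K2 p12] := pP n; rewrite leNgt => /negP; apply.
have p12' := lt_trans p12 (NP n Nn).
have h1 : normc (f (p n).1 - f q) < e / 2.
  by apply: dH; move: nq d0; clear; lra.
have h2 : normc (f (p n).2 - f q) < e / 2.
  apply: dH; have := normc_triangle (p n).2 (p n).1 q.
  by rewrite (normcB (p n).2 (p n).1); move: nq p12'; clear; lra.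
have := normc_triangle (f (p n).1) (f q) (f (p n).2).
by rewrite (normcB (f q)); move: h1 h2; clear; lra.
Qed.

(* f (z) / f (c) is a product of n quotients of values of f at consecutive
   points of the segment from c to z; for large n each has positive real part. *)
Lemma log_branch f c (r s : R) : s < r ->
  (forall z, disc c r z -> cdiff f z) -> (forall z, disc c r z -> f z != 0) ->
  exists g : C -> C, forall z, cdisc c s z -> cdiff g z /\ cexp (g z) = f z.
Proof.
move=> sr df f0.
have [s0|s0] := ltP s 0.
  exists (fun=> 0) => z zs; have := le_lt_trans zs s0; by rewrite ltNge normc_ge0.
have cs z : cdisc c s z -> disc c r z by move=> zs; exact: le_lt_trans sr.
have K0 : cdisc c s !=set0 by exists c; rewrite /cdisc /mkset subrr normc0.
have [m Km mP] : exists2 z, cdisc c s z & forall w, cdisc c s w -> normc (f w)^-1 <= normc (f z)^-1.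
  apply: compact_maximum => //; first exact: cdisc_compact.
  move=> z /cs zr; apply: rcont_normc; apply: ccontV; first exact: f0.
  by apply: cdiff_cont; exact: df.
have fm0 : 0 < normc (f m) by rewrite normc_gt0 f0 //; exact: cs.
have fm w : cdisc c s w -> normc (f m) <= normc (f w).
  move=> ws; have := mP w ws; rewrite !normcV lef_pV2 ?posrE ?normc_gt0 ?f0 //; exact: cs.
have [d d0 dH] := @uniform_cont (cdisc c s) f (normc (f m)) (@cdisc_compact _ c s)
  (fun z zs => cdiff_cont (df z (cs z zs))) fm0.
have [N NP] : exists N : nat, s / N.+1%:R < d.
  have sd : 0 < d / (s + 1) by rewrite divr_gt0 // ltr_wpDl.
  have /cvgrPdist_lt /(_ _ sd) [N _ NP] := @cvg_harmonic R.
  exists N; have := NP N (leqnn N); rewrite sub0r normrN ger0_norm ?invr_ge0 //.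
  rewrite /harmonic /= ltr_pdivlMr ?ltr_wpDl // mulrDr mulr1 mulrC => /(le_lt_trans _); apply.
  by rewrite lerDl invr_ge0.
pose p (j : nat) z : C := c + (j%:R / N.+1%:R)%:C * (z - c).
have pc j z : (j <= N.+1)%N -> cdisc c s z -> cdisc c s (p j z).
  move=> jN zs; rewrite /cdisc /mkset /p addrAC subrr add0r normcM normc_real.
  rewrite ger0_norm ?divr_ge0 //; apply: le_trans zs.
  rewrite ler_piMl ?normc_ge0 // ler_pdivrMr // mul1r ler_nat //.
have Kc : cdisc c s c by rewrite /cdisc /mkset subrr normc0.
have [t _ tE] := cexp_polar (f0 c (cs c Kc)).
pose h (j : nat) z := clog (f (p j.+1 z) / f (p j z)).
have rp j z : (j < N.+1)%N -> cdisc c s z -> 0 < Re (f (p j.+1 z) / f (p j z)).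
  move=> jN zs; have k1 := pc j.+1 z jN zs; have k2 := pc j z (ltnW jN) zs.
  have fj := f0 _ (cs _ k2).
  have : normc (f (p j.+1 z) / f (p j z) - 1) < 1.
    rewrite (_ : _ - 1 = (f (p j.+1 z) - f (p j z)) / f (p j z)); last by rewrite mulrBl divff.
    rewrite normcM normcV ltr_pdivrMr ?normc_gt0 // mul1r.
    apply: lt_le_trans (fm _ k2); apply: dH => //.
    rewrite /p opprD addrACA subrr add0r -mulrBl -rmorphB /= -mulrBl -natrB ?leqnSn //.
    rewrite subSn // subnn normcM normc_real ger0_norm ?divr_ge0 // mul1r.
    apply: le_lt_trans NP; rewrite mulrC ler_wpM2r ?invr_ge0 //.
  move=> /(le_lt_trans (Re_le_normc _)); rewrite reB ltr_norml /=; clear; lra.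
exists (fun z => \sum_(j < N.+1) h j z + (ln (normc (f c)) +i* t)) => z zs; split.
  apply: cdiffD; last exact: cdiff_cst.
  apply: cdiff_sum => j; rewrite /h; apply: cdiff_comp; last exact/cdiff_clog/rp.
  have dp k : cdiff (p k) z.
    apply: cdiffD; first exact: cdiff_cst.
    apply: cdiffM; first exact: cdiff_cst.
    by apply: cdiffB; [exact: cdiff_id|exact: cdiff_cst].
  apply: cdiffM.
    by apply: cdiff_comp => //; apply: df; apply: cs; exact: pc.
  apply: cdiffV; first by apply: f0; apply: cs; apply: pc => //; exact: ltnW.
  by apply: cdiff_comp => //; apply: df; apply: cs; apply: pc => //; exact: ltnW.
have fp k : (k <= N.+1)%N -> f (p k z) != 0.
  by move=> kN; apply: f0; apply: cs; exact: pc.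
have tel k : (k <= N.+1)%N -> cexp (\sum_(j < k) h j z) = f (p k z) / f (p 0%N z).
  elim: k => [_|k IH kN]; first by rewrite big_ord0 cexp0 divff ?fp.
  rewrite big_ord_recr /= cexpD IH ?(ltnW kN) // /h clogK; last exact: rp.
  by field; rewrite !fp // ltnW.
have -> : f z = f (p N.+1 z).
  by congr f; rewrite /p divff ?pnatr_eq0 // mul1r addrC subrK.
have p0 : p 0%N z = c by rewrite /p mul0r mul0r addr0.
by rewrite cexpD tel // -tE p0 divfK // f0 //; exact: cs.
Qed.

(** With [k] the conjugate of f c, the Cayley transform (f - f c) / (f + k) maps into the unit disc
    and vanishes at c. Schwarz bounds it by |z - c| / r, and |f + k| <= |f - f c| + 2 Re (f c) turns
    this into a bound on f - f c. *)
Lemma half_plane_schwarz f c (r : R) : (forall z, disc c r z -> cdiff f z) ->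
  (forall z, disc c r z -> 0 < Re (f z)) ->
  forall z, disc c r z ->
    normc (f z - f c) * (r - normc (z - c)) <= 2 * Re (f c) * normc (z - c).
Proof.
move=> df fp z zr.
have r0 : 0 < r by apply: le_lt_trans zr; exact: normc_ge0.
have cr : disc c r c by exact: discxx.
pose k : C := Re (f c) -i* Im (f c).
have kp w : disc c r w -> Re (f c) <= normc (f w + k).
  move=> /fp fw; apply: le_trans (Re_le_normc _); apply: le_trans (ler_norm _).
  by rewrite reD /= lerDr ltW.
have kp0 w : disc c r w -> 0 < normc (f w + k).
  by move=> wr; apply: lt_le_trans (kp w wr); exact: fp.
have fk w : disc c r w -> normc (f w - f c) <= normc (f w + k).
  move=> /fp fw; have fc := fp c cr.
  rewrite /k; case: (f w) fw => a b; case: (f c) fc => a' b' /= a0 b0.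
  rewrite ler_sqrt ?addr_ge0 ?sqr_ge0 // lerD2r -subr_ge0.
  rewrite (_ : _ - _ = 4 * (a' * a)); last by ring.
  by rewrite mulr_ge0 // mulr_ge0 // ltW.
have main (s : R) : normc (z - c) < s -> s < r ->
    normc (f z - f c) * s <= normc (z - c) * normc (f z + k).
  move=> zs sr; have s0 : 0 < s by apply: le_lt_trans zs; exact: normc_ge0.
  have csr w : cdisc c s w -> disc c r w by move=> ws; exact: le_lt_trans sr.
  have := @disc_quotient_max R (fun w => f w - f c) (fun w => (w - c) * (f w + k)) c s s^-1.
  rewrite invr_ge0 (ltW s0) => /(_ isT) Q.
  rewrite mulrC -ler_pdivlMl // -normcM; apply: Q; last exact: ltW.
  - move=> w /csr wr; apply: holomorphic_open wr; first exact: disc_open.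
    by move=> v vr; apply: cdiffB; [exact: df|exact: cdiff_cst].
  - move=> w /csr wr; apply: holomorphic_open wr; first exact: disc_open.
    move=> v vr; apply: cdiffM.
      by apply: cdiffB; [exact: cdiff_id|exact: cdiff_cst].
    by apply: cdiffD; [exact: df|exact: cdiff_cst].
  - move=> w ws /eqP; rewrite mulf_eq0 => /orP[|]; last first.
      by rewrite -normc_eq0 gt_eqF // kp0 //; exact: csr.
    rewrite subr_eq0 => /eqP ->; split; first exact: discxx.
    have [L L0 /nbhsCP [d d0 dH]] := cdiff_lipschitz (df c cr).
    exists (L / Re (f c)); apply/nbhsCP; exists (Num.min d r); first by rewrite lt_min d0.
    move=> v; rewrite /disc /= lt_min => /andP[/dH vd /kp vr].
    apply: le_trans vd _; rewrite normcM -mulrA ler_wpM2l ?(ltW L0) // mulrC.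
    by rewrite ler_pdivlMr ?fp // ler_wpM2l ?normc_ge0.
  - move=> w ws; rewrite normcM ws mulrA mulVf ?gt_eqF // mul1r; apply: fk.
    by rewrite /disc /mkset ws.
(* Here [s] tends to [r]; f is given on the open disc only. *)
have main' : normc (f z - f c) * r <= normc (z - c) * normc (f z + k).
  apply/ler_addgt0Pl => e e0.
  pose A : R := normc (f z - f c) + 1.
  have A0 : 0 < A by rewrite ltr_wpDl // normc_ge0.
  pose s : R := Num.max (r - e / A) ((normc (z - c) + r) / 2).
  have eA : 0 < e / A by rewrite divr_gt0.
  have zr' : normc (z - c) < r by [].
  have sr : s < r by rewrite gt_max; apply/andP; split; move: eA zr'; clear; lra.
  have zs : normc (z - c) < s by rewrite lt_max; apply/orP; right; move: zr'; clear; lra.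
  have := main s zs sr.
  have rs : r - s <= e / A by rewrite lerBlDr addrC -lerBlDr le_max lexx.
  have : normc (f z - f c) * (r - s) <= e.
    apply: le_trans (_ : A * (e / A) <= _).
      apply: ler_pM; rewrite ?normc_ge0 ?subr_ge0 ?(ltW sr) //.
      by rewrite lerDl.
    by rewrite mulrC divfK ?gt_eqF.
  rewrite mulrBr; clear; lra.
have : normc (f z + k) <= normc (f z - f c) + 2 * Re (f c).
  rewrite (_ : f z + k = (f z - f c) + (2 * Re (f c))%:C).
    apply: le_trans (normcD _ _) _; rewrite normc_real ger0_norm // mulr_ge0 // ltW //; exact: fp.
  by apply: complexP; rewrite !(reD, imD, reN, imN) /=; ring.
move=> /(ler_wpM2l (normc_ge0 (z - c))) /(le_trans main').
rewrite mulrDr mulrBr; rewrite (mulrC (normc (z - c)) (normc (f z - f c))).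
rewrite (mulrC (normc (z - c)) (2 * _)); clear; lra.
Qed.

Lemma Re_clog_of f g z : cexp (g z) = f z -> Re (g z) = ln (normc (f z)).
Proof. by move=> <-; rewrite normc_cexp expRK. Qed.

(** A logarithm of f on the disc of radius r / 2 has the positive real part ln |f|, so
    [half_plane_schwarz] applies; the constant 8 comes from 2 and r / 2 - |z - c| >= r / 4. *)
Lemma harnack f c (r : R) : (forall z, disc c r z -> cdiff f z) ->
  (forall z, disc c r z -> 1 < normc (f z)) ->
  forall z, 0 < r -> normc (z - c) <= r / 4 ->
    `|ln (normc (f z)) - ln (normc (f c))| <= 8 * (normc (z - c) / r) * ln (normc (f c)).
Proof.
move=> df f1 z r0 zr.
have r2 : r / 2 < r by move: r0; clear; lra.
have zr2 : normc (z - c) < r / 2 by move: zr r0; clear; lra.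
have [|g gP] := log_branch r2 df.
  by move=> w /f1 fw; rewrite -normc_gt0 (lt_trans _ fw).
have gp w : disc c (r / 2) w -> cdiff g w /\ Re (g w) = ln (normc (f w)).
  by move=> /ltW /gP [dg ge]; split => //; exact: Re_clog_of.
have rc : disc c (r / 2) c by apply: discxx; rewrite divr_gt0.
have := @half_plane_schwarz g c (r / 2) (fun w wr => (gp w wr).1) _ z zr2.
rewrite (gp c rc).2 => H.
have : `|ln (normc (f z)) - ln (normc (f c))| * (r / 4) <= 2 * ln (normc (f c)) * normc (z - c).
  apply: le_trans (H _); last first.
    by move=> w wr; rewrite (gp w wr).2 ln_gt0 // f1 // ; exact: lt_trans r2.
  apply: ler_pM => //; first by rewrite divr_ge0 // ltW.
    by rewrite -(gp z zr2).2 -(gp c rc).2 -reB Re_le_normc.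
  by move: zr; clear; lra.
rewrite -ler_pdivlMr ?divr_gt0 // => /le_trans; apply.
by rewrite le_eqVlt; apply/orP; left; apply/eqP; field; rewrite gt_eqF.
Qed.

End Harnack.

(** * Omitted values and three circles *)

Section Schwarz.
Variable R : realType.
Local Notation C := R[i].
Local Notation Re := (@complex.Re R).
Local Notation Im := (@complex.Im R).
Implicit Types (z w c : C) (A B G : set C) (f g : C -> C).

(** If ln |f| comes close to ln |p| at the centre, on the scale L, and p is omitted, then a
    logarithm g of f comes close to an omitted logarithm of p. Harnack for Q / (g - tau) carries
    this over to the smaller disc, at the price of replacing e by a multiple of its square root. *)
Lemma omitted_value f c (p : C) (r L K e : R) : 0 < r -> 0 < L -> 0 < K -> 0 < e <= 1 ->
  (forall z, disc c r z -> cdiff f z) ->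
  (forall z, disc c r z -> 1 < normc (f z)) ->
  p != 0 -> (forall z, disc c r z -> f z != p) ->
  `|ln (normc (f c)) - ln (normc p)| <= e * L -> pi <= e * L ->
  ln (normc (f c)) <= K * L ->
  forall z, normc (z - c) <= r / 64 ->
    (ln (normc (f z)) - ln (normc p)) ^+ 2 <= 2 * e * (2 * K + 3) * L ^+ 2.
Proof.
move=> r0 L0 K0 /andP[e0 e1] df f1 p0 fp fcp pL fcK z zr.
have r2 : r / 2 < r by move: r0; clear; lra.
have f0 w : disc c r w -> f w != 0.
  by move=> /f1 fw; rewrite -normc_gt0 (lt_trans _ fw).
have [g gP] := log_branch r2 df f0.
have gp w : disc c (r / 2) w -> [/\ cdiff g w, Re (g w) = ln (normc (f w)) & cexp (g w) = f w].
  by move=> /ltW /gP [dg ge]; split => //; exact: Re_clog_of.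
have r20 : 0 < r / 2 by rewrite divr_gt0.
have rc : disc c (r / 2) c by apply: discxx.
have [dgc Rgc cgc] := gp c rc.
have fc0 : f c != 0 by apply: f0; exact: discxx.
have pf0 : p / f c != 0 by rewrite mulf_neq0 // invr_eq0.
have [t tpi pE] := cexp_polar pf0.
(* The logarithm of p nearest to g c: the real parts differ by at most e L, the imaginary parts by
   at most pi <= e L. *)
pose tau : C := g c + (ln (normc (p / f c)) +i* t).
have tauE : cexp tau = p by rewrite /tau cexpD cgc -pE mulrC divfK.
have fc1 : 0 < normc (f c) by rewrite normc_gt0.
have pn0 : 0 < normc p by rewrite normc_gt0.
have lnE : ln (normc (p / f c)) = ln (normc p) - ln (normc (f c)).
  by rewrite normcM normcV ln_div ?posrE.
have Rtau : Re tau = ln (normc p) by rewrite /tau reD /= Rgc lnE addrC subrK.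
have gtau : normc (g c - tau) <= 2 * e * L.
  rewrite /tau opprD addrA subrr add0r normcN; apply: le_trans (normc_le_ReIm _) _.
  by rewrite /= lnE distrC; move: fcp pL tpi; clear; lra.
have r4 w : disc c (r / 4) w -> disc c (r / 2) w.
  by move=> wr; apply: lt_trans wr _; move: r0; clear; lra.
have gbound w : disc c (r / 4) w -> normc (g w - tau) < (2 * K + 3) * L.
  move=> wr; have := @half_plane_schwarz R g c (r / 2) _ _ w (r4 _ wr).
  rewrite Rgc => H.
  have H1 : normc (g w - g c) * (r / 4) <= 2 * ln (normc (f c)) * (r / 4).
    apply: le_trans (_ : normc (g w - g c) * (r / 2 - normc (w - c)) <= _).
      rewrite ler_wpM2l ?normc_ge0 //; move: (ltW wr); clear; lra.
    apply: le_trans (H _ _) _.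
    - by move=> v /gp [].
    - move=> v vr; have [_ -> _] := gp v vr; rewrite ln_gt0 // f1 //; exact: lt_trans r2.
    - rewrite ler_wpM2l ?(ltW wr) // mulr_ge0 // ltW // ln_gt0 // f1 //; exact: discxx.
  have := normc_triangle (g w) (g c) tau.
  move: H1; rewrite ler_pM2r ?divr_gt0 //.
  have eL : e * L <= 1 * L by rewrite ler_wpM2r ?(ltW L0).
  have KL : 0 < K * L by rewrite mulr_gt0.
  move: gtau fcK eL KL L0; clear; lra.
have gt0 w : disc c (r / 4) w -> g w - tau != 0.
  move=> wr; rewrite subr_eq0; apply/eqP => gw; have [_ _ cw] := gp w (r4 _ wr).
  have wr' : disc c r w by apply: lt_trans r2; exact: r4.
  by have := fp w wr'; rewrite -cw gw tauE eqxx.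
pose Q : R := (2 * K + 3) * L.
have Q0 : 0 < Q by rewrite mulr_gt0 // addr_gt0 // mulr_gt0.
pose h w := Q%:C / (g w - tau).
have hn w : normc (h w) = Q / normc (g w - tau).
  by rewrite /h normcM normcV normc_real gtr0_norm.
have r40 : 0 < r / 4 by rewrite divr_gt0.
have zr4 : disc c (r / 4) z by apply: le_lt_trans zr _; move: r0; clear; lra.
have cr4 : disc c (r / 4) c by exact: discxx.
have h1 w : disc c (r / 4) w -> 1 < normc (h w).
  move=> wr; rewrite hn ltr_pdivlMr ?normc_gt0 ?gt0 // mul1r; exact: gbound.
have := @harnack R h c (r / 4) _ h1 z r40.
have zr16 : normc (z - c) <= r / 4 / 4 by apply: le_trans zr _; move: r0; clear; lra.
move=> H; have {H} := H _ zr16.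
have dh w : disc c (r / 4) w -> cdiff h w.
  move=> wr; have [dg _ _] := gp w (r4 _ wr).
  apply: cdiffM; first exact: cdiff_cst.
  apply: cdiffV; first exact: gt0.
  by apply: cdiffB => //; exact: cdiff_cst.
move=> /(_ dh) H.
have hc0 : 0 < ln (normc (h c)) by rewrite ln_gt0 // h1.
(* This is where r / 64 comes from: Harnack then yields |h c| <= |h z|^2, that is |g z - tau|^2 <= Q
   |g c - tau|. *)
have t8 : 8 * (normc (z - c) / (r / 4)) <= 1 / 2.
  by rewrite mulrA ler_pdivrMr //; move: zr; clear; lra.
have : ln (normc (h c)) <= 2 * ln (normc (h z)).
  have := ler_wpM2r (ltW hc0) t8; move: H; rewrite ler_norml; clear; lra.
have hz0 : 0 < normc (h z) by apply: lt_trans (h1 z zr4).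
have hcp : 0 < normc (h c) by apply: lt_trans (h1 c cr4).
have -> : 2 * ln (normc (h z)) = ln (normc (h z) ^+ 2) by rewrite lnXn // mulr_natl.
rewrite ler_ln ?posrE ?exprn_gt0 // !hn expr_div_n => hh.
have gz0 : 0 < normc (g z - tau) by rewrite normc_gt0 gt0.
have gc0 : 0 < normc (g c - tau) by rewrite normc_gt0 gt0.
have : normc (g z - tau) ^+ 2 <= Q * normc (g c - tau).
  rewrite -(ler_pM2l (_ : 0 < Q / normc (g c - tau))) ?divr_gt0 //.
  move: hh; rewrite ler_pdivlMr ?exprn_gt0 // => /le_trans; apply.
  by rewrite le_eqVlt; apply/orP; left; apply/eqP; field; rewrite gt_eqF.
have [_ Rgz _] := gp z (r4 z zr4).
have : (ln (normc (f z)) - ln (normc p)) ^+ 2 <= normc (g z - tau) ^+ 2.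
  rewrite -Rgz -Rtau -reB -[X in X <= _]real_normK ?num_real // lerXn2r ?nnegrE ?normc_ge0 //.
  exact: Re_le_normc.
move=> h2 h3; apply: (le_trans h2); apply: (le_trans h3).
apply: le_trans (ler_wpM2l (ltW Q0) gtau) _.
by rewrite le_eqVlt; apply/orP; left; apply/eqP; rewrite /Q; ring.
Qed.

(** The exponent [l] is such that |f| |z|^-l is at most B on both boundary circles. There is no
    global branch of z^-l, but near a point v the factor |z|^-l is a constant times the modulus of
    exp (-l clog (z / v)), which is all that [submax] asks for. *)
Lemma three_circles f (B M r1 r2 : R) : (forall z, cdiff f z) -> 0 < B -> 0 < M ->
  1 < r1 <= r2 ->
  (forall z, normc z = 1 -> normc (f z) <= B) ->
  (forall z, normc z = r2 -> normc (f z) <= M) ->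
  forall z, normc z = r1 -> f z != 0 ->
    ln (normc (f z)) <= (ln M * ln r1 + ln B * (ln r2 - ln r1)) / ln r2.
Proof.
move=> df B0 M0 /andP[r11 r12] fB fM z zr fz0.
have r21 : 1 < r2 by apply: lt_le_trans r12.
have l20 : 0 < ln r2 by rewrite ln_gt0.
pose l : R := (ln M - ln B) / ln r2.
pose u z := normc (f z) * expR (- l * ln (normc z)).
pose K : set C := [set w | 1 <= normc w <= r2].
pose A : set C := [set w | 1 < normc w < r2].
have cK : compact K.
  apply: (@bounded_closed_compactC _ _ 0 r2); last first.
    by move=> w /andP[_ w2]; rewrite /cdisc /mkset subr0.
  rewrite -openC; apply/openCP => w /negP; rewrite negb_and -!ltNge => /orP[w1|w2].
    exists (1 - normc w); first by rewrite subr_gt0.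
    move=> v vw; apply/negP; rewrite negb_and -!ltNge; apply/orP; left.
    by have := normc_leBD v w; move: vw; rewrite /disc /mkset; clear; lra.
  exists (normc w - r2); first by rewrite subr_gt0.
  move=> v vw; apply/negP; rewrite negb_and -!ltNge; apply/orP; right.
  by have := normc_leBD w v; rewrite normcB; move: vw; rewrite /disc /mkset; clear; lra.
have oA : open A.
  apply/openCP => w /andP[w1 w2].
  exists (Num.min (normc w - 1) (r2 - normc w)); first by rewrite lt_min !subr_gt0 w1.
  move=> v; rewrite /disc /mkset lt_min => /andP[vw1 vw2]; apply/andP; split.
    by have := normc_leBD w v; rewrite normcB; move: vw1; clear; lra.
  by have := normc_leBD v w; move: vw2; clear; lra.
have K0 w : K w -> w != 0.
  by move=> /andP[w1 _]; rewrite -normc_gt0 (lt_le_trans _ w1).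
have uM w : K w -> u w <= B.
  apply: (max_principle cK oA).
  - by move=> v /andP[v1 v2]; apply/andP; split; exact: ltW.
  - move=> v Kv; apply: rcontM; first by apply: rcont_normc; exact: cdiff_cont.
    apply: (@rcont_comp _ (fun t => expR (- l * ln t))).
      by apply: rcont_normc; exact: ccont_id.
    apply: (@continuous_comp _ _ _ (fun t => - l * ln t) expR); last exact: continuous_expR.
    suff : (- l * ln t) @[t --> normc v] --> - l * ln (normc v) by [].
    apply: cvgM; first exact: cvg_cst.
    by apply: continuous_ln; rewrite normc_gt0 K0.
  - move=> v Av; have v0 : v != 0.
      by apply: K0; move: Av => /andP[v1 v2]; apply/andP; split; exact: ltW.
    have vn : 0 < normc v by rewrite normc_gt0.
    have near_v : \forall w \near v, 0 < Re (w / v).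
      apply/nbhsCP; exists (normc v) => // w' wv.
      have : normc (w' / v - 1) < 1.
        rewrite (_ : w' / v - 1 = (w' - v) / v); last by rewrite mulrBl divff.
        by rewrite normcM normcV ltr_pdivrMr // mul1r.
      move=> /(le_lt_trans (Re_le_normc _)); rewrite reB ltr_norml /=; clear; lra.
    apply: (@submax_near _ _ (fun w => normc (f w * cexp ((- l)%:C * clog (w / v)))) v (expR (- l * ln (normc v)))).
    + exact: expR_gt0.
    + apply: filterS near_v => w' wv.
      have w0 : w' != 0 by apply: contraTneq wv => ->; rewrite mul0r ltxx.
      rewrite /u normcM normc_cexp reM /= mul0r subr0.
      rewrite mulrCA -expRD normcM normcV ln_div ?posrE ?normc_gt0 //.
      by congr (_ * expR _); ring.
    + apply: submax_normc; move: near_v => /nbhsCP [d d0 dH].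
      apply/nbhsCP; exists d => // w' /dH wv.
      apply: cdiffM => //; apply: cdiff_comp; last exact: cdiff_cexp.
      apply: cdiffM; first exact: cdiff_cst.
      apply: cdiff_comp; last exact: cdiff_clog.
      by apply: cdiffM; [exact: cdiff_id|exact: cdiff_cst].
  - move=> v /andP[v1 v2] /negP; rewrite negb_and -!leNgt => /orP[v1'|v2'].
      have v1E : normc v = 1 by apply/eqP; rewrite eq_le v1 v1'.
      by rewrite /u v1E ln1 mulr0 expR0 mulr1 fB.
    have v2E : normc v = r2 by apply/eqP; rewrite eq_le v2 v2'.
    rewrite /u v2E; apply: le_trans (_ : M * expR (- l * ln r2) <= _).
      by rewrite ler_wpM2r ?expR_ge0 // fM.
    rewrite /l mulNr divfK ?gt_eqF // opprB expRD lnK ?posrE // expRN lnK ?posrE //.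
    by rewrite mulrCA divff ?mulr1 // gt_eqF.
have Kz : K z by apply/andP; rewrite zr (ltW r11).
have fz : 0 < normc (f z) by rewrite normc_gt0.
have uz : 0 < u z by rewrite mulr_gt0 // expR_gt0.
have : ln (u z) <= ln B by rewrite ler_ln ?posrE // uM.
rewrite /u lnM ?posrE ?expR_gt0 // expRK zr => H.
rewrite ler_pdivlMr //.
have -> : ln M * ln r1 + ln B * (ln r2 - ln r1) = (ln B + l * ln r1) * ln r2.
  by rewrite mulrDl /l; field; rewrite gt_eqF.
by rewrite ler_wpM2r ?(ltW l20) //; move: H; clear; lra.
Qed.

Definition cbar z : C := Re z -i* Im z.

Lemma cbarB z w : cbar (z - w) = cbar z - cbar w.
Proof. by apply: complexP; rewrite /= ?(reB, imB) /=; ring. Qed.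

Lemma normc_cbar z : normc (cbar z) = normc z.
Proof. by case: z => a b /=; rewrite sqrrN. Qed.

Lemma mul_cbar z : z * cbar z = (normc z ^+ 2)%:C.
Proof.
case: z => a b; apply: complexP; rewrite ?reM ?imM /=.
  by rewrite sqr_sqrtr ?addr_ge0 ?sqr_ge0 //; ring.
by ring.
Qed.

(** The Blaschke factor r (z - w) / (r^2 - cbar w z), with its denominator moved to the side of f.
    On |z| = r it has modulus 1, because r^2 = z cbar z there. *)
Lemma schwarz_pick f w (r d : R) : (forall z, cdisc 0 r z -> \forall v \near z, cdiff f v) ->
  0 < r -> 0 <= d -> normc w < r -> f w = 0 ->
  (forall z, normc z = r -> normc (f z) <= d) ->
  forall z, normc z <= r -> normc (f z * ((r ^+ 2)%:C - cbar w * z)) <= d * r * normc (z - w).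
Proof.
move=> df r0 d0 wr fw fd z zr.
have wr' : disc 0 r w by rewrite /disc /mkset subr0.
apply: (@disc_quotient_max R (fun z => f z * ((r ^+ 2)%:C - cbar w * z)) (fun z => z - w) 0 r (d * r)).
- by rewrite mulr_ge0 // ltW.
- move=> v /df; apply: filterS => v' dv; apply: cdiffM => //.
  apply: cdiffB; first exact: cdiff_cst.
  by apply: cdiffM; [exact: cdiff_cst|exact: cdiff_id].
- by apply: entire_holomorphic => v; apply: cdiffB; [exact: cdiff_id|exact: cdiff_cst].
- move=> v vr /eqP; rewrite subr_eq0 => /eqP ->; split => //.
  have dg : cdiff (fun z => f z * ((r ^+ 2)%:C - cbar w * z)) w.
    have /nbhsCP [e e0 /(_ w (discxx _ e0)) dfw] := df w (ltW wr').
    apply: cdiffM => //; apply: cdiffB; first exact: cdiff_cst.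
    by apply: cdiffM; [exact: cdiff_cst|exact: cdiff_id].
  have [L L0 H] := cdiff_lipschitz dg; exists L; apply: filterS H => v'.
  by rewrite fw mul0r subr0.
- move=> v; rewrite subr0 => vr; rewrite normcM.
  have -> : (r ^+ 2)%:C - cbar w * v = v * cbar (v - w).
    by rewrite cbarB mulrBr mul_cbar vr [v * _]mulrC.
  by rewrite normcM normc_cbar vr mulrA ler_wpM2r ?normc_ge0 // ler_wpM2r ?(ltW r0) // fd.
- by rewrite subr0.
Qed.

End Schwarz.

(** * Connectedness in the plane *)

Section PlaneTopology.
Variable R : realType.
Local Notation C := R[i].
Local Notation Re := (@complex.Re R).
Local Notation Im := (@complex.Im R).
Implicit Types (z w c : C) (A B G : set C) (f g : C -> C).

Lemma connected_induction (U : set C) (P : C -> Prop) : connected U ->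
  (exists2 z, U z & P z) ->
  (forall z, U z -> P z -> exists2 d : R, 0 < d & forall w, U w -> disc z d w -> P w) ->
  (forall z, U z -> ~ P z -> exists2 d : R, 0 < d & forall w, U w -> disc z d w -> ~ P w) ->
  forall z, U z -> P z.
Proof.
move=> cU [z0 Uz0 Pz0] oP oN.
pose B := U `&` [set z | P z].
pose O (Q : C -> Prop) : set C :=
  [set z | exists d : R, 0 < d /\ forall w, U w -> disc z d w -> Q w].
have oO Q : open (O Q).
  apply/openCP => z [d [d0 dQ]]; exists (d / 2); first by rewrite divr_gt0.
  move=> w wz; exists (d / 2); split; first by rewrite divr_gt0.
  move=> v Uv vw; apply: dQ => //; have := normc_triangle v w z.
  by move: wz vw; rewrite /disc /mkset; clear; lra.
suff : B = U by move=> BU z; rewrite -BU => -[].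
apply: cU; first by exists z0.
- exists (O P) => //; apply/seteqP; split => z [Uz].
    by move=> /(oP z Uz) [d d0 dP]; split => //; exists d.
  by move=> [d [d0 dP]]; split => //; apply: dP => //; exact: discxx.
- exists (~` O (fun z => ~ P z)); first by rewrite closedC; exact: oO.
  apply/seteqP; split => z [Uz].
    move=> Pz; split => // -[d [d0 dP]]; exact: (dP z Uz (discxx _ d0)).
  move=> nO; split => //=; apply: contrapT => /(oN z Uz) [d d0 dP].
  by apply: nO; exists d.
Qed.

Lemma connected_lt (U : set C) (u : C -> R) (t : R) : connected U ->
  (forall z, U z -> rcont u z) -> (forall z, U z -> u z <> t) ->
  (exists2 z, U z & u z < t) -> forall z, U z -> u z < t.
Proof.
move=> cU uc ut ex; apply: connected_induction => // z Uz.
  move=> uzt; have e0 : 0 < t - u z by rewrite subr_gt0.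
  have [d d0 dH] := uc z Uz _ e0; exists d => // w _ /dH; rewrite ltr_norml.
  by clear; lra.
move=> /negP; rewrite -leNgt le_eqVlt => /orP[/eqP zt|tz].
  by have := ut z Uz; rewrite zt.
have e0 : 0 < u z - t by rewrite subr_gt0.
have [d d0 dH] := uc z Uz _ e0; exists d => // w _ /dH; rewrite ltr_norml => wz.
by apply/negP; rewrite -leNgt; move: wz; clear; lra.
Qed.

Lemma connected_intermediate (U : set C) (u : C -> R) (t : R) : connected U ->
  (forall z, U z -> rcont u z) -> (exists2 z, U z & u z <= t) ->
  (exists2 z, U z & t <= u z) -> exists2 z, U z & u z = t.
Proof.
move=> cU uc [z Uz zt] [w Uw tw]; apply: contrapT => H.
have ne v : U v -> u v <> t by move=> Uv vt; apply: H; exists v.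
have zt' : u z < t by rewrite lt_neqAle zt andbT; apply/eqP/ne.
have := @connected_lt U u t cU uc ne _ w Uw; rewrite ltNge tw => H'.
suff : false by [].
by apply: H'; exists z.
Qed.

(* Property P spreads from w to the disc of radius d(w, C \ U) / 64, and by the
   same token back. *)
Lemma connected_chain (U : set C) (P : C -> Prop) : open U -> connected U ->
  (forall w (r : R), 0 < r -> disc w r `<=` U -> P w ->
     forall z, normc (z - w) <= r / 64 -> P z) ->
  forall w, U w -> P w -> forall z, U z -> P z.
Proof.
move=> /openCP oU cU PU w Uw Pw; apply: connected_induction => //; first by exists w.
  move=> z Uz Pz; have [d d0 dU] := oU z Uz.
  exists (d / 64); first by rewrite divr_gt0.
  by move=> v _ /ltW vz; exact: PU Pz _ vz.
move=> z Uz nPz; have [d d0 dU] := oU z Uz.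
exists (d / 128); first by rewrite divr_gt0.
move=> v _ vz Pv; apply: nPz; apply: (PU v (d / 2)) => //.
- by rewrite divr_gt0.
- move=> x xv; apply: dU; have := normc_triangle x v z.
  by move: xv vz; rewrite /disc /mkset; move: d0; clear; lra.
- by rewrite normcB; move: vz; rewrite /disc /mkset; move: d0; clear; lra.
Qed.

Lemma connected_image f (A : set C) : (forall z, A z -> ccont f z) -> connected A ->
  connected (f @` A).
Proof.
move=> fc cA; apply: connected_continuous_connected => //.
apply: continuous_in_subspaceT => z; rewrite inE => Az; apply/ccontP; exact: fc.
Qed.

Lemma star_connected (A : set C) p : A p ->
  (forall z (t : R), A z -> 0 <= t <= 1 -> A (p + t%:C * (z - p))) -> connected A.
Proof.
move=> Ap star.
pose seg z : set C := (fun t : R => p + t%:C * (z - p)) @` `[0, 1]%classic.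
have -> : A = \bigcup_(z in A) seg z.
  apply/seteqP; split => [z Az|w [z Az [t tI <-]]].
    exists z => //; exists 1; first by rewrite /= in_itv /= ler01 lexx.
    by rewrite mul1r addrC subrK.
  by apply: star => //; move: tI; rewrite /= in_itv.
apply: bigcup_connected.
  exists p => z Az; exists 0; first by rewrite /= in_itv /= ler01 lexx.
  by rewrite mul0r addr0.
move=> z Az; apply: connected_continuous_connected; first exact: segment_connected.
apply: continuous_subspaceT => t.
apply/(cvgCP (nbhs_filter t)) => e e0.
pose M : R := normc (z - p) + 1.
have M0 : 0 < M by rewrite ltr_wpDl // normc_ge0.
apply/nbhs_ballP; exists (e / M) => /=; first by rewrite divr_gt0.
move=> s; rewrite /ball /= => st.
rewrite (_ : _ - _ = (s - t)%:C * (z - p)); last by rewrite rmorphB /=; ring.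
rewrite normcM normc_real; apply: le_lt_trans (_ : `|s - t| * M < _).
  by rewrite ler_wpM2l // lerDl.
by rewrite -ltr_pdivlMr // distrC.
Qed.

Lemma disc_connected c (r : R) : connected (disc c r).
Proof.
have [r0|r0] := ltP 0 r; last first.
  rewrite (_ : disc c r = set0); first exact: connected0.
  by apply/seteqP; split => // z zr; have := lt_le_trans zr r0; rewrite ltNge normc_ge0.
apply: (@star_connected _ c); first exact: discxx.
move=> z t zr /andP[t0 t1]; rewrite /disc /mkset addrAC subrr add0r normcM normc_real ger0_norm //.
by apply: le_lt_trans zr; rewrite ler_piMl ?normc_ge0.
Qed.

(* {|z| in I} is the image under exp of the convex set {Re s in log I}. *)
Lemma radial_connected (I : set R) : is_interval I -> (forall x, I x -> 0 < x) ->
  connected [set z : C | I (normc z)].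
Proof.
move=> iI I0.
have [x Ix|nI] := pselect (I !=set0); last first.
  rewrite (_ : [set z | _] = set0); first exact: connected0.
  by apply/seteqP; split => // z Iz; apply: nI; exists (normc z).
case: x Ix => x Ix.
rewrite (_ : [set z : C | _] = (@cexp R) @` [set s : C | I (expR (Re s))]); last first.
  apply/seteqP; split => [z Iz|_ [s Is <-]]; last by rewrite /mkset normc_cexp.
  have z0 : z != 0 by rewrite -normc_gt0; exact: I0.
  have [t _ tE] := cexp_polar z0.
  exists (ln (normc z) +i* t) => //; rewrite /mkset /= lnK // posrE normc_gt0 //.
apply: connected_image; first by move=> s _; apply: cdiff_cont; exact: cdiff_cexp.
apply: (@star_connected _ (ln x)%:C); first by rewrite /mkset /= lnK // posrE I0.
move=> s t Is /andP[t0 t1]; rewrite /mkset.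
have -> : Re ((ln x)%:C + t%:C * (s - (ln x)%:C)) = ln x + t * (Re s - ln x).
  by rewrite reD reM reB /= mul0r subr0.
have Ix' : I (expR (ln x)) by rewrite lnK // posrE I0.
have [xs|sx] := leP (ln x) (Re s).
  apply: (iI _ _ Ix' Is); rewrite !ler_expR lerDl mulr_ge0 ?subr_ge0 //=.
  by rewrite -lerBrDl ler_piMl // subr_ge0.
apply: (iI _ _ Is Ix'); rewrite !ler_expR gerDl mulr_ge0_le0 ?subr_le0 ?(ltW sx) // andbT.
by rewrite -lerBlDl ler_niMl // subr_le0 ltW.
Qed.

Lemma circle_connected (r : R) : 0 < r -> connected [set z : C | normc z = r].
Proof.
move=> r0; apply: (@radial_connected [set x | x = r]); last by move=> x ->.
by move=> x y -> -> z /andP[rz zr]; apply/eqP; rewrite eq_le zr rz.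
Qed.

Lemma exterior_connected (r : R) : 0 < r -> connected [set z : C | r <= normc z].
Proof.
move=> r0; apply: (@radial_connected [set x | r <= x]).
  by move=> x y /= rx ry z /andP[xz _]; exact: le_trans xz.
by move=> x; exact: lt_le_trans.
Qed.

Lemma normc_rcont z : rcont (@ComplexField.Normc.normc R) z.
Proof. apply: rcont_normc; exact: ccont_id. Qed.

Lemma connected_inside (U : set C) (r : R) : connected U ->
  (forall z, U z -> normc z <> r) -> (exists2 z, U z & normc z < r) ->
  forall z, U z -> normc z < r.
Proof. by move=> cU; apply: connected_lt => // z _; exact: normc_rcont. Qed.

Lemma connected_outside (U : set C) (r : R) : connected U ->
  (forall z, U z -> normc z <> r) -> (exists2 z, U z & r < normc z) ->
  forall z, U z -> r < normc z.
Proof.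
move=> cU Ur [z Uz rz] w Uw; rewrite ltNge; apply/negP => wr.
have : normc z < r.
  apply: (connected_inside cU Ur) => //; exists w => //.
  by rewrite lt_neqAle wr andbT; apply/eqP/Ur.
by rewrite ltNge (ltW rz).
Qed.

Lemma ballCP z w (e : R) : ball z e%:C w <-> normc (w - z) < e.
Proof.
by rewrite -ball_normE /ball_ /mkset normr_normc ltcR normcB.
Qed.

Lemma uniform_cvgP (A : set C) (g : nat -> C -> C) (h : C -> C) :
  {uniform A, g @ \oo --> h} <->
  forall e : R, 0 < e -> \forall k \near \oo, forall w, A w -> normc (g k w - h w) < e.
Proof.
split.
- move=> H e e0.
  have : nbhs (h : {uniform` A -> C}) [set k | forall w, A w -> normc (k w - h w) < e].
    apply/uniform_nbhs; exists [set xy | normc (xy.2 - xy.1) < e]; split => //.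
    rewrite -entourage_ballE; exists e%:C; first by rewrite /= ltcR.
    by move=> [x y] /ballCP.
  exact: H.
- move=> H P /uniform_nbhs [E [+ EP]]; rewrite -entourage_ballE => -[e' /= /gt0_complex [e e0 ->]] eE.
  have := H e e0; rewrite near_simpl; apply: filterS => k kh; apply: EP => w Aw.
  by apply: eE; apply/ballCP; exact: kh.
Qed.

End PlaneTopology.

(** * The Fatou set *)

Section FatouSet.
Variable R : realType.
Local Notation C := R[i].
Local Notation Re := (@complex.Re R).
Local Notation Im := (@complex.Im R).
Implicit Types (z w c : C) (A B G : set C) (f g : C -> C).

Lemma extract_subsequence (P : nat -> nat -> Prop) :
  (forall j K, exists2 k, (K <= k)%N & P j k) ->
  exists2 phi : nat -> nat, {homo phi : j k / (j < k)%N} & forall j, P j (phi j).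
Proof.
move=> H; have /choice [c cP] : forall jK : nat * nat, exists k, (jK.2 <= k)%N /\ P jK.1 k.
  by move=> [j K]; have [k] := H j K; exists k.
pose phi := fix phi j := if j is i.+1 then c (i.+1, (phi i).+1) else c (0%N, 0%N).
exists phi; last by case=> [|j]; [exact: (cP (0%N, 0%N)).2|exact: (cP (j.+1, (phi j).+1)).2].
apply: homo_ltn; first exact: ltn_trans.
by move=> j; exact: (cP (j.+1, (phi j).+1)).1.
Qed.

Lemma bounded_pigeonhole (n : nat -> nat) N : (forall K, exists2 k, (K <= k)%N & (n k < N)%N) ->
  exists m, forall K, exists2 k, (K <= k)%N & n k = m.
Proof.
elim: N => [|N IH] H; first by have [k] := H 0%N.
have [L|L] := pselect (forall K, exists2 k, (K <= k)%N & n k = N); first by exists N.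
have /existsNP [K0 K0P] := L; apply: IH => K.
have [k kK nk] := H (maxn K K0); exists k; first by apply: leq_trans kK; exact: leq_maxl.
move: nk; rewrite ltnS leq_eqVlt => /orP[/eqP nk|//]; exfalso; apply: K0P.
by exists k => //; apply: leq_trans kK; exact: leq_maxr.
Qed.

Lemma fatou_open f : open (fatou_set f).
Proof.
apply/openCP => z [V [oV Vz nV]]; have /openCP /(_ z Vz) [d d0 dV] := oV.
by exists d => // w /dV Vw; exists V.
Qed.

(** Composed with f, iterates on f(V) become iterates on V. The limit there takes equal values on
    the fibres of f, by uniqueness of pointwise limits, so it descends to f(V); openness of f
    carries neighbourhoods over. *)
Lemma fatou_forward f z : (forall w, cdiff f w) -> (forall c, exists w, f w != c) ->
  fatou_set f z -> fatou_set f (f z).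
Proof.
move=> df fn [V [oV Vz nV]]; exists (f @` V); split; [exact: open_mapping|by exists z|].
move=> g gP.
have [k|phi phiP] := nV (fun k w => g k (f w)).
  have [n /= n1 <-] := gP k; exists n.+1 => //.
  by apply/funext => w; rewrite iterSr.
have nb z1 (W : set C) : V z1 -> nbhs z1 W ->
    exists N : set C, nbhs (f z1) N /\ forall w, N w -> exists2 z2, (W `&` V) z2 & f z2 = w.
  move=> Vz1 /nbhsCP [d d0 dW]; have /openCP /(_ z1 Vz1) [t t0 tV] := oV.
  have m0 : 0 < Num.min d t by rewrite lt_min d0.
  exists (f @` disc z1 (Num.min d t)); split.
    have /openCP /(_ (f z1)) [|e e0 eH] := @open_mapping R f (disc z1 (Num.min d t)) df fn (@disc_open R _ _).
      by exists z1 => //; exact: discxx.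
    by apply/nbhsCP; exists e.
  move=> w [z2]; rewrite /disc /mkset lt_min => /andP[z2d z2t] <-; exists z2 => //.
  by split; [exact: dW|exact: tV].
move=> [[h' h'P]|inf].
  have ptw z1 (e : R) : V z1 -> 0 < e -> \forall k \near \oo, normc (g (phi k) (f z1) - h' z1) < e.
    move=> Vz1 e0; have [W Wz1 /uniform_cvgP /(_ e e0)] := h'P z1 Vz1.
    apply: filterS => k; apply; split => //.
    by have /nbhsCP [d d0] := Wz1; apply; exact: discxx.
  have uniq_h z1 z2 : V z1 -> V z2 -> f z1 = f z2 -> h' z1 = h' z2.
    move=> V1 V2 fz; apply/eqP; rewrite -subr_eq0 -normc_eq0 eq_le normc_ge0 andbT.
    apply/ler_addgt0Pl => e e0; rewrite addr0; have e20 : 0 < e / 2 by rewrite divr_gt0.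
    have [k _ kP] := filterI (ptw z1 _ V1 e20) (ptw z2 _ V2 e20).
    have [/= k1 k2] := kP k (leqnn k).
    have := normc_triangle (h' z1) (g (phi k) (f z1)) (h' z2).
    rewrite (normcB (h' z1) (g _ _)); move: k2 k1; rewrite -fz; clear; lra.
  have /choice [s sP] : forall w, exists z1, (f @` V) w -> V z1 /\ f z1 = w.
    move=> w; have [[z1 V1 <-]|nw] := pselect ((f @` V) w); first by exists z1.
    by exists 0 => /nw.
  exists phi => //; left; exists (h' \o s) => _ [z1 V1 <-].
  have [W Wz1 /uniform_cvgP Wu] := h'P z1 V1.
  have [N [Nz NP]] := nb z1 W V1 Wz1.
  exists N => //; apply/uniform_cvgP => e e0; have := Wu e e0.
  apply: filterS => k kP w [/NP [z2 Wz2 <-] _].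
  have fVz2 : (f @` V) (f z2) by exists z2 => //; exact: Wz2.2.
  have [Vs fs] := sP _ fVz2.
  by rewrite /= (uniq_h _ _ Vs Wz2.2 fs); exact: kP.
exists phi => //; right => _ [z1 V1 <-].
have [W Wz1 WM] := inf z1 V1.
have [N [Nz NP]] := nb z1 W V1 Wz1.
exists N => // M; have := WM M; apply: filterS => k kP w [/NP [z2 Wz2 <-] _].
exact: kP.
Qed.

(** It keeps the Blaschke factor of the disc of radius p away from 1 in modulus as long as z and w
    stay in a smaller disc. *)
Lemma blaschke_identity (p : R) z w : normc ((p ^+ 2)%:C - cbar w * z) ^+ 2 =
  p ^+ 2 * normc (z - w) ^+ 2 + (p ^+ 2 - normc z ^+ 2) * (p ^+ 2 - normc w ^+ 2).
Proof.
case: z => x y; case: w => u v /=.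
by rewrite !sqr_sqrtr ?addr_ge0 ?sqr_ge0 //; ring.
Qed.

(* Schwarz-Pick makes f contract the pseudo-hyperbolic metric of the disc of
   radius rho, so its iterates converge uniformly to a constant. *)
Lemma contracted_disc_fatou f (r rho : R) : (forall w, cdiff f w) -> 0 < r -> r < rho ->
  (forall z, normc z < rho -> normc (f z) < r) ->
  forall z, normc z < rho -> fatou_set f z.
Proof.
move=> df r0 rrho fr.
have rho0 : 0 < rho by exact: lt_trans rrho.
pose p : R := (r + rho) / 2.
have rp : r < p by rewrite /p; move: rrho; clear; lra.
have prho : p < rho by rewrite /p; move: rrho; clear; lra.
have p0 : 0 < p by exact: lt_trans rp.
(* For |z|, |w| < r, [k] bounds the last term of [blaschke_identity] from below, and |z - w|^2 <= 4
   r^2. Hence the squared Blaschke factor is at most 1 / (1 + d). *)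
pose k := (p ^+ 2 - r ^+ 2) ^+ 2.
have k0 : 0 < k by rewrite exprn_gt0 // subr_gt0 ltr_pXn2r ?nnegrE ?ltW.
pose d : R := k / (4 * r ^+ 2 * p ^+ 2).
have den0 : 0 < 4 * r ^+ 2 * p ^+ 2 by apply: mulr_gt0; [apply: mulr_gt0 => //; exact: exprn_gt0|exact: exprn_gt0].
have d0 : 0 < d by rewrite divr_gt0.
have itr n z : normc z < rho -> normc (iter n f z) < rho.
  by move=> zr; elim: n => //= n IH; apply: lt_trans rrho; exact: fr.
have contr n z w : normc z < rho -> normc w < rho ->
    normc (iter n f z - iter n f w) ^+ 2 * (1 + d) ^+ n <= 4 * rho ^+ 2.
  elim: n z w => [|n IH] z w zr wr.
    rewrite expr0 mulr1 (_ : 4 * rho ^+ 2 = (2 * rho) ^+ 2); last by ring.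
    rewrite lerXn2r ?nnegrE ?normc_ge0 ?mulr_ge0 ?(ltW rho0) //.
    by have := normcD z (- w); rewrite normcN /=; move: zr wr; clear; lra.
  rewrite !iterSr; set z' := f z; set w' := f w.
  have zr' : normc z' < r by exact: fr.
  have wr' : normc w' < r by exact: fr.
  (* The induction hypothesis bounds |f^n v - f^n w'| by [D] on |v| = p; Schwarz-Pick at z' supplies
     one more factor 1 / (1 + d) after squaring. *)
  pose D := 2 * rho / Num.sqrt ((1 + d) ^+ n).
  have s0 : 0 < (1 + d) ^+ n by rewrite exprn_gt0 // addr_gt0.
  have D0 : 0 <= D by rewrite divr_ge0 ?sqrtr_ge0 // mulr_ge0 // ltW.
  have D2 : D ^+ 2 * (1 + d) ^+ n = 4 * rho ^+ 2.
    rewrite /D expr_div_n sqr_sqrtr ?(ltW s0) // divfK ?gt_eqF //; ring.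
  have GD v : normc v = p -> normc (iter n f v - iter n f w') <= D.
    move=> vp; rewrite -(ler_pXn2r (_ : (0 < 2)%N)) ?nnegrE ?normc_ge0 //.
    rewrite -(ler_pM2r s0) D2; apply: IH; first by rewrite vp.
    exact: lt_trans rrho.
  have dG v : cdiff (fun v => iter n f v - iter n f w') v.
    by apply: cdiffB; [exact: cdiff_iter|exact: cdiff_cst].
  have := @schwarz_pick R (fun v => iter n f v - iter n f w') w' p D.
  move=> /(_ (entire_holomorphic dG) p0 D0 (lt_trans wr' rp) (subrr _) GD z' (ltW (lt_trans zr' rp))).
  rewrite normcM; set g := normc _; set b := normc _ => gb.
  have b2 : p ^+ 2 * normc (z' - w') ^+ 2 * (1 + d) <= b ^+ 2.
    have bE : b ^+ 2 = p ^+ 2 * normc (z' - w') ^+ 2 +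
        (p ^+ 2 - normc z' ^+ 2) * (p ^+ 2 - normc w' ^+ 2).
      exact: blaschke_identity.
    rewrite bE mulrDr mulr1 lerD2l.
    apply: le_trans (_ : k <= _); last first.
      rewrite /k expr2; have := ltW zr'; have := ltW wr'.
      have sq x : 0 <= x -> x <= r -> p ^+ 2 - r ^+ 2 <= p ^+ 2 - x ^+ 2.
        by move=> x0 xr; rewrite lerD2l lerN2 lerXn2r ?nnegrE ?(ltW r0).
      have q0 : 0 <= p ^+ 2 - r ^+ 2 by rewrite subr_ge0 lerXn2r ?nnegrE ?ltW.
      move=> wr2 zr2; apply: ler_pM => //; apply: sq => //; exact: normc_ge0.
    rewrite /d mulrA ler_pdivrMr // mulrC ler_wpM2l ?(ltW k0) // mulrC ler_wpM2r ?sqr_ge0 //.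
    rewrite (_ : 4 * r ^+ 2 = (2 * r) ^+ 2); last by ring.
    rewrite lerXn2r ?nnegrE ?normc_ge0 ?mulr_ge0 ?(ltW r0) //.
    by have := normcD z' (- w'); rewrite normcN; move: zr' wr'; clear; lra.
  have [zw|zw] := eqVneq (normc (z' - w')) 0.
    move/eqP: zw; rewrite normc_eq0 subr_eq0 => /eqP zw.
    have -> : g = 0 by rewrite /g zw subrr normc0.
    by rewrite expr0n mul0r mulr_ge0 // sqr_ge0.
  have zw0 : 0 < normc (z' - w') by rewrite lt_neqAle eq_sym zw normc_ge0.
  have pz0 : 0 < p ^+ 2 * normc (z' - w') ^+ 2 by rewrite mulr_gt0 // exprn_gt0.
  have g0 : 0 <= g by exact: normc_ge0.
  have b0 : 0 <= b by exact: normc_ge0.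
  rewrite -D2 [(1 + d) ^+ n.+1]exprS mulrA ler_wpM2r ?(ltW s0) // -(ler_pM2r pz0).
  have : (g * b) ^+ 2 <= (D * p * normc (z' - w')) ^+ 2.
        have Dpz : 0 <= D * p * normc (z' - w').
      by apply: mulr_ge0; [apply: mulr_ge0 => //; exact: ltW|exact: normc_ge0].
    by rewrite lerXn2r ?nnegrE // mulr_ge0.
  clearbody b D; clearbody g; have E1 (x y : R) : (x * y) ^+ 2 = x ^+ 2 * y ^+ 2 by rewrite exprMn.
  have E2 (x y t : R) : (x * y * t) ^+ 2 = x ^+ 2 * (y ^+ 2 * t ^+ 2) by rewrite !exprMn mulrA.
  rewrite (E2 D p _) (E1 g b); apply: le_trans.
  rewrite -mulrA ler_wpM2l ?sqr_ge0 // mulrC //.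
pose small (e : R) := exists N, forall n z w, (N <= n)%N -> normc z < rho -> normc w < rho ->
   normc (iter n f z - iter n f w) < e.
have smallP e : 0 < e -> small e.
  move=> e0; have d1 : 1 < 1 + d by rewrite ltrDl.
  have [N NP] := pow_unbounded (4 * rho ^+ 2 / e ^+ 2) d1; exists N => n z w Nn zr wr.
  rewrite -(ltr_pXn2r (_ : (0 < 2)%N)) ?nnegrE ?normc_ge0 ?(ltW e0) //.
  have s0 : 0 < (1 + d) ^+ n by rewrite exprn_gt0 // addr_gt0.
  rewrite -(ltr_pM2r s0); apply: le_lt_trans (contr n z w zr wr) _.
  rewrite -ltr_pdivrMl ?exprn_gt0 // mulrC; apply: lt_le_trans NP _.
  by rewrite ler_weXn2l // ltW.
have z0r : normc (0 : C) < rho by rewrite normc0.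
have [|c _ cP] := @cluster_sequence R (cdisc 0 rho) (fun n => iter n f 0) (@cdisc_compact R 0 rho).
  by move=> n; rewrite /cdisc /mkset subr0 ltW // itr.
have lim e : 0 < e -> exists N, forall n z, (N <= n)%N -> normc z < rho -> normc (iter n f z - c) < e.
  move=> e0; have e20 : 0 < e / 2 by rewrite divr_gt0.
  have [N NP] := smallP _ e20; exists N => n z Nn zr.
  have [m nm mc] := cP _ n e20.
  have := NP n z (iter (m - n) f 0) Nn zr (itr _ _ z0r).
  rewrite -iterD subnKC // => h1.
  by have := normc_triangle (iter n f z) (iter m f 0) c; move: h1 mc; clear; lra.
move=> z zr; exists (disc 0 rho); split; [exact: disc_open|by rewrite /disc /mkset subr0|].
move=> g gP; have /choice [n nP] : forall k, exists n, iter n f = g k.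
  by move=> j; have [n _ nj] := gP j; exists n.
(* A sequence in the family consists of iterates in arbitrary order. If their orders are unbounded,
   a subsequence tends to [c]; otherwise one iterate recurs and gives a constant subsequence. *)
have [unb|bnd] := pselect (forall N K, exists2 k, (K <= k)%N & (N <= n k)%N).
  have [phi phiP phin] := @extract_subsequence (fun j k => (j <= n k)%N) unb.
  exists phi => //; left; exists (fun=> c) => w _; exists setT; first exact: filterT.
  apply/uniform_cvgP => e /lim [N NP]; exists N => // j /= Nj v [_].
  rewrite /disc /mkset subr0 => vr; rewrite -nP; apply: NP => //.
  exact: leq_trans (phin j).
have [m mP] : exists m, forall K, exists2 k, (K <= k)%N & n k = m.
  have /existsNP [N /existsNP [K KP]] := bnd.
  apply: (@bounded_pigeonhole n N) => K'; exists (maxn K K'); first exact: leq_maxr.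
  rewrite ltnNge; apply/negP => Nn; apply: KP; exists (maxn K K') => //.
  exact: leq_maxl.
have [phi phiP phin] := @extract_subsequence (fun j k => n k = m) (fun j => mP).
exists phi => //; left; exists (iter m f) => w _; exists setT; first exact: filterT.
apply/uniform_cvgP => e e0; exists 0%N => // j _ v _.
by rewrite /= -nP phin subrr normc0.
Qed.

End FatouSet.

(** * Radii of the iterates *)

Section WanderingRadii.
Variable R : realType.
Local Notation C := R[i].
Local Notation Re := (@complex.Re R).
Local Notation Im := (@complex.Im R).
Implicit Types (z w c : C) (A B G : set C) (f g : C -> C).

Lemma bounded_closure_disc f (r M : R) : (forall z, cdiff f z) -> 0 < r ->
  (forall z, normc z < r -> normc (f z) <= M) ->
  forall z, normc z <= r -> normc (f z) <= M.
Proof.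
move=> df r0 fM z zr; apply/ler_addgt0Pl => e e0.
have [d d0 dH] := cdiff_cont (df z) e0.
pose t : R := Num.min 1 (d / (2 * r)).
have t0 : 0 < t by rewrite lt_min ltr01 divr_gt0 // mulr_gt0.
have t1 : t <= 1 by rewrite ge_min lexx.
have td : t * r < d.
  apply: le_lt_trans (_ : d / (2 * r) * r < d).
    by rewrite ler_wpM2r ?(ltW r0) // ge_min lexx orbT.
  have -> : d / (2 * r) * r = d / 2 by field; rewrite gt_eqF.
  by move: d0; clear; lra.
pose w := (1 - t)%:C * z.
have wr : normc w < r.
  rewrite normcM normc_real ger0_norm ?subr_ge0 //.
  apply: le_lt_trans (_ : (1 - t) * r < r).
    by rewrite ler_wpM2l // subr_ge0.
  by rewrite gtr_pMl // gtrBl.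
have wz : normc (w - z) < d.
  rewrite (_ : w - z = (- t)%:C * z); last by rewrite /w rmorphB rmorphN /= rmorph1; ring.
  rewrite normcM normc_real normrN ger0_norm ?(ltW t0) //.
  by apply: le_lt_trans td; rewrite ler_wpM2l // ltW.
have := dH w wz; have := fM w wr; have := normc_leBD (f z) (f w).
by rewrite normcB; clear; lra.
Qed.

Section Radii.
Variables (f : C -> C) (U : set C) (z0 : C) (n1 : nat).
Hypothesis df : forall z, cdiff f z.
Hypothesis f_nonpoly : ~ exists p : {poly C}, forall z, f z = p.[z].
Hypothesis wU : wandering_domain f U.
Hypothesis Uz0 : U z0.
Let zn n := iter n f z0.
Let r n := normc (zn n).
Let Un n : set C := iter n f @` U.
Hypothesis round_annulus : forall n, (n1 <= n)%N -> exists s t : R,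
  [/\ 0 < s, s < r n < t & forall w, s < normc w < t -> Un n w].

Lemma nonconstant c : exists w, f w != c.
Proof.
apply: contrapT => H; apply: f_nonpoly; exists c%:P => z; rewrite hornerC.
by apply/eqP/negP => zc; apply: H; exists z; exact/negP.
Qed.

Let F := fatou_set f.
Let comp n := connected_component F (zn n).

Lemma UnS n : Un n.+1 = f @` Un n.
Proof.
apply/seteqP; split => [_ [w Uw <-]|_ [_ [w Uw <-] <-]]; last by exists w.
by exists (iter n f w) => //; exists w.
Qed.

Lemma U_fatou z : U z -> F z.
Proof. by have [[z1 _ ->] _] := wU; exact: connected_component_sub. Qed.

Lemma iter_fatou n z : F z -> F (iter n f z).
Proof.
move=> Fz; elim: n => //= n IH; apply: fatou_forward => //; exact: nonconstant.
Qed.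

Lemma Un_connected n : connected (Un n).
Proof.
apply: connected_image; first by move=> z _; apply: cdiff_cont; exact: cdiff_iter.
by have [[z1 _ ->] _] := wU; exact: component_connected.
Qed.

Lemma Un_open n : open (Un n).
Proof.
elim: n => [|n IH]; last by rewrite UnS; apply: open_mapping => //; exact: nonconstant.
rewrite (_ : Un 0 = U); last by apply/seteqP; split => [_ [w Uw <-]|w Uw] //; exists w.
apply/openCP => z Uz; have /openCP /(_ z (U_fatou Uz)) [d d0 dF] := @fatou_open R f.
exists d => // w wd; have [[z1 _ UE] _] := wU; rewrite UE.
apply: (@connected_component_trans _ F z); first by rewrite -UE.
apply: (@connected_component_max _ F (disc z d)) => //; first exact: discxx.
exact: disc_connected.
Qed.

Lemma zn_Un n : Un n (zn n).
Proof. by exists z0. Qed.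

Lemma zn_fatou n : F (zn n).
Proof. exact/iter_fatou/U_fatou. Qed.

Lemma Un_comp n : Un n `<=` comp n.
Proof.
apply: connected_component_max; [exact: zn_Un| |exact: Un_connected].
by move=> _ [w Uw <-]; exact/iter_fatou/U_fatou.
Qed.

Lemma orbit_comp n : fatou_component_orbit f U n = comp n.
Proof.
apply/seteqP; split => [w [z Uz zw]|w cw]; last by exists z0.
have zc : comp n (iter n f z) by apply: Un_comp; exists z.
by rewrite /comp (same_connected_component zc).
Qed.

Lemma comp_forward n w : comp n w -> comp n.+1 (f w).
Proof.
move=> cw; apply: (@connected_component_max _ F (f @` comp n)); last by exists w.
- by exists (zn n) => //; apply: connected_component_refl; exact: zn_fatou.
- move=> _ [v cv <-]; apply: fatou_forward => //; first exact: nonconstant.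
  exact: connected_component_sub cv.
- apply: connected_image; first by move=> z _; exact: cdiff_cont.
  exact: component_connected.
Qed.

(** Components that meet coincide. By forward invariance the sequence of components would then have
    period j - i from index i on, which wandering excludes. *)
Lemma comp_disjoint i j w : (i < j)%N -> comp i w -> ~ comp j w.
Proof.
move=> ij iw jw; have [_] := wU; apply.
have zij : comp i (zn j).
  apply: connected_component_trans iw _; exact: connected_component_sym.
have step k : comp (i + k) (zn (j + k)).
  elim: k => [|k IH]; first by rewrite !addn0.
  by rewrite !addnS; exact: comp_forward.
exists i, (j - i)%N; split; first by rewrite subn_gt0.
move=> n ni; rewrite !orbit_comp; apply/esym/same_connected_component.
have := step (n - i)%N; rewrite subnKC //; congr (connected_component _ _ (zn _)).
by rewrite addnBA // addnC -addnBA // ltnW.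
Qed.

Lemma Un_disjoint i j w : i != j -> Un i w -> ~ Un j w.
Proof.
move=> ij /Un_comp iw /Un_comp jw.
move: ij; rewrite neq_ltn => /orP[ij|ij]; [exact: (comp_disjoint ij iw)|exact: (comp_disjoint ij jw)].
Qed.

Lemma circle_Un n w : (n1 <= n)%N -> normc w = r n -> Un n w.
Proof. by move=> /round_annulus [s [t [_ st H]]] wr; apply: H; rewrite wr. Qed.

Lemma r_gt0 n : (n1 <= n)%N -> 0 < r n.
Proof. by move=> /round_annulus [s [t [s0 /andP[sr _] _]]]; exact: lt_trans sr. Qed.

(* Otherwise f maps a disc of radius larger than r n into the disc of radius
   r n, so that disc is in the Fatou set and U_n = U_{n+1}. *)
Lemma r_lt n : (n1 <= n)%N -> r n < r n.+1.
Proof.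
move=> n1n; have r0 := r_gt0 n1n.
have avoid w : Un n.+1 w -> normc w <> r n.
  move=> Uw wr; have nn : n.+1 != n by rewrite gtn_eqF.
  by apply: (Un_disjoint nn Uw); exact: circle_Un.
rewrite ltNge le_eqVlt; apply/negP => /orP[/eqP rr|rr].
  exact: avoid (zn_Un n.+1) rr.
have inside : forall w, Un n.+1 w -> normc w < r n.
  by apply: connected_inside => //; [exact: Un_connected|exists (zn n.+1) => //; exact: zn_Un].
have [s [t [s0 /andP[sr rt] HU]]] := round_annulus n1n.
pose p : R := (r n + t) / 2.
have rp : r n < p by rewrite /p; move: rt; lra.
have pt : p < t by rewrite /p; move: rt; lra.
have fp z : normc z <= p -> normc (f z) <= r n.
  move=> zp; apply: (@max_modulus_disc R f 0 p (r n)); rewrite ?subr0 //.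
  - exact: entire_holomorphic.
  - exact: ltW.
  - move=> w; rewrite subr0 => wp; apply: ltW; apply: inside; rewrite UnS; exists w => //.
    by apply: HU; rewrite wp pt andbT; exact: lt_trans rp.
have pF : disc 0 p `<=` F.
  move=> z; rewrite /disc /mkset subr0; apply: (@contracted_disc_fatou R f ((r n + p) / 2)) => //.
  - by move: rp r0; lra.
  - by move: rp; lra.
  - by move=> w /ltW /fp; move: rp; lra.
have pc : disc 0 p `<=` comp n.
  apply: connected_component_max => //; last exact: disc_connected.
  by rewrite /disc /mkset subr0.
apply: (@comp_disjoint n n.+1 (zn n.+1)) => //.
  by apply: pc; rewrite /disc /mkset subr0; exact: lt_trans rp.
apply: connected_component_refl; exact: zn_fatou.
Qed.

Lemma r_homo m n : (n1 <= m)%N -> (m <= n)%N -> r m <= r n.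
Proof.
move=> n1m; elim: n => [|n IH]; first by rewrite leqn0 => /eqP ->.
rewrite leq_eqVlt => /orP[/eqP -> //|]; rewrite ltnS => mn.
by apply: le_trans (IH mn) (ltW (r_lt _)); exact: leq_trans mn.
Qed.

(** The set U_n is connected and disjoint from the circle |z| = r (n+1), which lies in U_{n+1}; the
    next lemma argues in the same way. *)
Lemma Un_lt n w : (n1 <= n)%N -> Un n w -> normc w < r n.+1.
Proof.
move=> n1n; move: w; apply: connected_inside; first exact: Un_connected.
  move=> w Uw wr; have nn : n != n.+1 by rewrite ltn_eqF.
  by apply: (Un_disjoint nn Uw); apply: circle_Un => //; exact: leqW.
by exists (zn n); [exact: zn_Un|exact: r_lt].
Qed.

Lemma Un_gt n w : (n1 <= n)%N -> Un n.+1 w -> r n < normc w.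
Proof.
move=> n1n; move: w; apply: connected_outside; first exact: Un_connected.
  move=> w Uw wr; have nn : n.+1 != n by rewrite gtn_eqF.
  by apply: (Un_disjoint nn Uw); exact: circle_Un.
by exists (zn n.+1); [exact: zn_Un|exact: r_lt].
Qed.

(** The circle |z| = r n lies in U_n, so f^k maps it into U_{n+k}, which lies inside |z| < r
    (n+k+1); the maximum principle does the rest. *)
Lemma iter_disc_lt n k w : (n1 <= n)%N -> normc w <= r n -> normc (iter k f w) <= r (n + k).+1.
Proof.
move=> n1n wr; apply: (@max_modulus_disc R (iter k f) 0 (r n)); rewrite ?subr0 //.
- by apply: entire_holomorphic => z; exact: cdiff_iter.
- exact: normc_ge0.
move=> z; rewrite subr0 => zr; apply/ltW/Un_lt; first exact: leq_trans (leq_addr _ _).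
have [v Uv <-] := circle_Un n1n zr; exists v => //.
by rewrite -iterD addnC.
Qed.

(* Otherwise f maps the disc of radius s = sup r into itself and is larger than
   |z| on the circles |z| = r n, which contradicts Schwarz-Pick at a zero of f
   and the minimum principle if there is none. *)
Lemma r_unbounded (M : R) : exists2 n, (n1 <= n)%N & M < r n.
Proof.
apply: contrapT => H.
have rM n : (n1 <= n)%N -> r n <= M.
  by move=> n1n; rewrite leNgt; apply/negP => Mr; apply: H; exists n.
pose S : set R := [set x | exists2 n, (n1 <= n)%N & x = r n].
have S0 : S !=set0 by exists (r n1); exists n1.
have Sub : has_ubound S by exists M => _ [n n1n ->]; exact: rM.
pose s := sup S.
have rs n : (n1 <= n)%N -> r n < s.
  move=> n1n; apply: lt_le_trans (r_lt n1n) _; apply: ub_le_sup => //.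
  by exists n.+1 => //; exact: leqW.
have sr (x : R) : x < s -> exists2 n, (n1 <= n)%N & x < r n.
  move=> xs; have [||_ [n n1n ->] xn] := @sup_adherent _ S (s - x).
  - by rewrite subr_gt0.
  - by split.
  by exists n => //; move: xn; rewrite /s; lra.
have s0 : 0 < s by apply: lt_trans (r_gt0 (leqnn _)) (rs _ _).
have fs w : normc w < s -> normc (f w) < s.
  move=> /sr [n n1n wn]; have := @iter_disc_lt n 1 w n1n (ltW wn); rewrite /= addn1.
  by move=> /le_lt_trans; apply; apply: rs; apply: leqW; exact: leqW.
have fs' w : normc w <= s -> normc (f w) <= s.
  by apply: bounded_closure_disc => // v /fs /ltW.
have fC n w : (n1 <= n)%N -> normc w = r n -> r n < normc (f w).
  move=> n1n wr; apply: Un_gt => //; rewrite UnS; exists w => //; exact: circle_Un.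
have [[w1 w1s fw1]|nz] := pselect (exists2 w, normc w < s & f w = 0); last first.
  have fr n : (n1 <= n)%N -> r n <= normc (f 0).
    move=> n1n; apply: (@min_modulus_disc R f 0 (r n)).
    - exact: normc_ge0.
    - exact: r_gt0.
    - exact: entire_holomorphic.
    - move=> z; rewrite /cdisc /mkset subr0 => zr; apply/eqP => fz; apply: nz.
      by exists z => //; apply: le_lt_trans zr _; exact: rs.
    - by move=> z; rewrite subr0 => zr; apply/ltW/fC.
  have : normc (f 0) < s by apply: fs; rewrite normc0.
  by move=> /sr [n n1n]; rewrite ltNge fr.
have [n n1n w1n] := sr _ w1s.
(* At the point v of modulus r n on the ray through the zero w1, Schwarz-Pick becomes a real
   inequality: r (s^2 - x r) < s^2 (r - x) with x = |w1| and r = r n < s, so that x s^2 < x r^2,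
   which is absurd. *)
have [u nu uE] : exists2 u : C, normc u = 1 & w1 = (normc w1)%:C * u.
  have [->|w10] := eqVneq w1 0; first by exists 1; rewrite ?normc1 // normc0 mul0r.
  have n0 : normc w1 != 0 by rewrite normc_eq0.
  exists (w1 / (normc w1)%:C).
    by rewrite normcM normcV normc_real ger0_norm ?normc_ge0 // divff.
  by rewrite mulrC divfK // eq_complex /= negb_and n0.
set x := normc w1 in w1s w1n uE.
have x0 : 0 <= x by exact: normc_ge0.
pose v := (r n)%:C * u.
have rn0 : 0 <= r n by exact: normc_ge0.
have vn : normc v = r n by rewrite normcM normc_real nu mulr1 ger0_norm.
have rns := rs n n1n.
have := @schwarz_pick R f w1 s s (entire_holomorphic df) s0 (ltW s0) w1s fw1 _ v.
rewrite vn => /(_ _ (ltW rns)).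
have vw : normc (v - w1) = r n - x.
  by rewrite {1}uE -mulrBl -rmorphB /= normcM normc_real nu mulr1 ger0_norm // subr_ge0 ltW.
have cu : cbar w1 * v = (x * r n)%:C.
  have -> : cbar w1 * v = (x * r n)%:C * (u * cbar u).
    by rewrite {1}uE; apply: complexP; rewrite ?(reM, imM) /= ?(reM, imM) /=; ring.
  by rewrite mul_cbar nu expr1n mulr1.
have sE : (s ^+ 2)%:C - (x * r n)%:C = (s ^+ 2 - x * r n)%:C :> C by rewrite rmorphB.
rewrite vw cu normcM sE normc_real.
have xr : x * r n < s ^+ 2.
  by rewrite expr2; apply: ltr_pM.
rewrite ger0_norm ?subr_ge0 ?(ltW xr) // => H'.
have {}H' : normc (f v) * (s ^+ 2 - x * r n) <= s * s * (r n - x).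
  by apply: H' => z zs; apply: fs'; rewrite zs.
have fv := fC n v n1n vn.
have : r n * (s ^+ 2 - x * r n) < s * s * (r n - x).
  by apply: lt_le_trans H'; rewrite ltr_pM2r // subr_gt0.
have : x * r n ^+ 2 <= x * s ^+ 2.
  by rewrite ler_wpM2l // lerXn2r ?nnegrE // ltW.
rewrite !expr2; lra.
Qed.

(** On |z| = r n, |f| is at most r (n+2) by [iter_disc_lt]. Were this below (r n)^d for arbitrarily
    large n, f would be a polynomial. *)
Lemma r_growth d : exists N, forall n, (N <= n)%N -> r n ^+ d <= r n.+2.
Proof.
apply: contrapT => H.
have often N : exists2 n, (N <= n)%N & r n.+2 < r n ^+ d.
  apply: contrapT => K; apply: H; exists N => n Nn; rewrite leNgt; apply/negP => rn.
  by apply: K; exists n.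
apply: f_nonpoly; apply: (@entire_poly_growth R f d) => // s.
have [n n1n sn] := r_unbounded s.
have [m nm rm] := often n.
have n1m : (n1 <= m)%N by exact: leq_trans nm.
exists (r m); first by apply: le_trans (ltW sn) _; exact: r_homo.
move=> z zr; have := @iter_disc_lt m 1 z n1m; rewrite zr lexx addn1 => /(_ isT) /le_trans; apply.
exact: ltW.
Qed.

End Radii.
End WanderingRadii.

(** * Orbits of ring domains *)

Section AnnularOrbits.
Variable R : realType.
Local Notation C := R[i].
Local Notation Re := (@complex.Re R).
Local Notation Im := (@complex.Im R).
Implicit Types (z w c : C) (A B G : set C) (f g : C -> C).

Lemma closed_superlevel (u : C -> R) (t : R) : (forall z, rcont u z) -> closed [set z | t <= u z].
Proof.
move=> cu; rewrite -[X in closed X]setCK closedC; apply/openCP => z /negP; rewrite -ltNge => ut.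
have [|d d0 dH] := cu z (t - u z); first by rewrite subr_gt0.
exists d => // w /dH; rewrite ltr_norml => /andP[_ h]; apply/negP; rewrite -ltNge; lra.
Qed.

Lemma closed_sublevel (u : C -> R) (t : R) : (forall z, rcont u z) -> closed [set z | u z <= t].
Proof.
move=> cu; rewrite -[X in closed X]setCK closedC; apply/openCP => z /negP; rewrite -ltNge => ut.
have [|d d0 dH] := cu z (u z - t); first by rewrite subr_gt0.
exists d => // w /dH; rewrite ltr_norml => /andP[h _]; apply/negP; rewrite -ltNge; lra.
Qed.

Lemma circle_compact (t : R) : compact [set z : C | normc z = t].
Proof.
apply: (@bounded_closed_compactC R _ 0 t); last by move=> z zt; rewrite /cdisc /mkset subr0 zt.
rewrite (_ : [set _ | _] = [set z | normc z <= t] `&` [set z | t <= normc z]).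
  by apply: closedI; [apply: closed_sublevel|apply: closed_superlevel] => z; exact: normc_rcont.
apply/seteqP; split => [z /= ->|z /= [h1 h2]]; first by split.
by apply/eqP; rewrite eq_le h1.
Qed.

(* Un n and r n stand for U_{n0+n} and |f^(n0+n) z|, with n0 so large that
   everything holds from index 0 on. *)
Record annular_orbit f (Un : nat -> set C) z0 (r : nat -> R) : Prop := AnnularOrbit {
  orbit_diff : forall z, cdiff f z;
  orbit_open : forall n, open (Un n);
  orbit_connected : forall n, connected (Un n);
  orbit_step : forall n, Un n.+1 = f @` Un n;
  orbit_modulus : forall n, normc (iter n f z0) = r n;
  orbit_circle : forall n, exists2 t : R,
    r n < t & forall w, r n <= normc w < t -> Un n w;
  orbit_r0 : 1 < r 0;
  orbit_r_lt : forall n, r n < r n.+1;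
  orbit_lt : forall n w, Un n w -> normc w < r n.+1;
  orbit_gt : forall n w, Un n.+1 w -> r n < normc w;
  orbit_disc : forall n k w, normc w <= r n -> normc (iter k f w) <= r (n + k).+1;
  orbit_growth : forall d, exists N, forall n, (N <= n)%N -> r n ^+ d <= r n.+2
}.

Definition logm f k w : R := ln (normc (iter k f w)).

Section Orbit.
Variables (f : C -> C) (Un : nat -> set C) (z0 : C) (r : nat -> R).
Hypothesis O : annular_orbit f Un z0 r.
Local Notation L n := (ln (r n)).

Lemma r_homo_le m n : (m <= n)%N -> r m <= r n.
Proof.
elim: n => [|n IH]; first by rewrite leqn0 => /eqP ->.
rewrite leq_eqVlt => /orP[/eqP -> //|]; rewrite ltnS => mn.
by apply: le_trans (IH mn) (ltW (orbit_r_lt O _)).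
Qed.

Lemma r_gt1 n : 1 < r n.
Proof. exact: lt_le_trans (orbit_r0 O) (r_homo_le (leq0n n)). Qed.

Lemma r_pos n : 0 < r n.
Proof. exact: lt_trans (r_gt1 n). Qed.

Lemma L_gt0 n : 0 < L n.
Proof. by rewrite ln_gt0 // r_gt1. Qed.

Lemma L_homo m n : (m <= n)%N -> L m <= L n.
Proof. by move=> mn; rewrite ler_ln ?posrE ?r_pos //; exact: r_homo_le. Qed.

Lemma Un_gt1 n w : Un n.+1 w -> 1 < normc w.
Proof. by move=> /(orbit_gt O); apply: lt_trans; exact: r_gt1. Qed.

Lemma Un_iter n k w : Un n w -> Un (n + k) (iter k f w).
Proof.
move=> Uw; elim: k => [|k IH]; first by rewrite addn0.
by rewrite addnS (orbit_step O); exists (iter k f w).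
Qed.

Lemma Un_preimage n k w : Un (n + k) w -> exists2 v, Un n v & iter k f v = w.
Proof.
elim: k w => [|k IH] w; first by rewrite addn0; exists w.
by rewrite addnS (orbit_step O) => -[v /IH [u Uu <-] <-]; exists u.
Qed.

Lemma iter_gt1 n k w : Un n.+1 w -> 1 < normc (iter k f w).
Proof. by move=> /(Un_iter k); rewrite addSn; exact: Un_gt1. Qed.

Lemma logm_gt0 n k w : Un n.+1 w -> 0 < logm f k w.
Proof. by move=> /(iter_gt1 k) w1; exact: ln_gt0. Qed.

Lemma orbit_point n : Un n (iter n f z0).
Proof.
have [t rt H] := orbit_circle O n; apply: H.
by rewrite (orbit_modulus O) lexx.
Qed.

Lemma logm_orbit n k : logm f k (iter n f z0) = L (n + k).
Proof. by rewrite /logm -iterD (orbit_modulus O) addnC. Qed.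

Lemma circle_sub n w : normc w = r n -> Un n w.
Proof. by move=> wr; have [t rt H] := orbit_circle O n; apply: H; rewrite wr lexx. Qed.

Lemma L_growth d : exists N, forall n, (N <= n)%N -> d%:R * L n <= L n.+2.
Proof.
have [N NH] := orbit_growth O d; exists N => n /NH.
rewrite -(@ler_ln R) ?posrE ?exprn_gt0 ?r_pos // lnXn ?r_pos //.
by rewrite mulr_natl.
Qed.

(** A factor 4 in two steps. Errors of order 1 / L n thereby become summable. *)
Lemma L_exp : exists2 c : R, 0 < c & forall n, c * 2 ^+ n <= L n.
Proof.
have [N NH] := L_growth 4.
have p0 m : (0 : R) < 2 ^+ m by rewrite exprn_gt0.
exists (L 0 / 2 ^+ N.+1); first by rewrite divr_gt0 ?L_gt0.
move=> n; have [m] := ubnP n; elim: m n => // m IH n; rewrite ltnS => nm.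
have [nN|Nn] := leqP n N.+1.
  apply: le_trans (L_homo (leq0n n)).
  rewrite mulrAC ler_pdivrMr // ler_wpM2l ?(ltW (L_gt0 0)) //.
  by rewrite ler_weXn2l // ler1n.
case: n nm Nn => [//|[//|n]] nm Nn.
have := IH n (leq_trans (leqnSn _) nm).
have := NH n; rewrite -ltnS => /(_ Nn).
rewrite (exprD 2 2 n : 2 ^+ n.+2 = _) mulrCA [2 ^+ 2](_ : _ = 4); last by ring.
lra.
Qed.

(** The quantity L (k+1) bounds ln |f^k| on |z| = 1. Since [L_growth] compares indices two apart, it
    takes n >= 3 to make it small against L (n+k). *)
Lemma L_ratio (e : R) : 0 < e -> exists N, forall k n, (N <= k)%N -> (2 < n)%N ->
  L k.+1 <= e * L (n + k).
Proof.
move=> e0; have [d de] : exists d : nat, e^-1 <= d%:R.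
  by exists (Num.truncn e^-1).+1; apply/ltW/truncnS_gt.
have [N NH] := L_growth d; exists N => k n Nk n2.
have := NH k.+1 (leqW Nk) => H.
have H2 : L k.+3 <= L (n + k) by apply: L_homo; rewrite -(addn3 k) addnC leq_add2r.
have H3 : e^-1 * L k.+1 <= d%:R * L k.+1 by rewrite ler_wpM2r // ltW // L_gt0.
rewrite -ler_pdivrMl //; lra.
Qed.

Lemma harnack_iter n k w z (s : R) : 0 < s -> disc w s `<=` Un n.+1 -> normc (z - w) <= s / 4 ->
  `|logm f k z - logm f k w| <= 8 * (normc (z - w) / s) * logm f k w.
Proof.
move=> s0 sU zs; apply: (@harnack R (iter k f)) => // v vs.
  by apply: cdiff_iter; exact: (orbit_diff O).
by apply: (@iter_gt1 n); exact: sU vs.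
Qed.

(** At the orbit point X = 1 serves. By Harnack each link of a chain of discs doubles X, and k does
    not enter. *)
Lemma logm_bounds n w : Un n.+1 w -> exists2 X : R, 0 < X &
  forall k, L (n.+1 + k) <= X * logm f k w /\ logm f k w <= X * L (n.+1 + k).
Proof.
move: w; apply: (@connected_chain R (Un n.+1) _ _ _ _ (iter n.+1 f z0)).
- exact: orbit_open O _.
- exact: orbit_connected O _.
- move=> w s s0 sU [X X0 XH] z zs; exists (2 * X); first by rewrite mulr_gt0.
  move=> k; have zs4 : normc (z - w) <= s / 4 by move: s0 zs; lra.
  have lw : 0 < logm f k w by apply: (@logm_gt0 n); apply: sU; exact: discxx.
  have : 8 * (normc (z - w) / s) * logm f k w <= 1 / 8 * logm f k w.
    rewrite ler_wpM2r ?(ltW lw) //.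
    have : normc (z - w) / s <= 1 / 64.
      by rewrite ler_pdivrMr //; move: zs; lra.
    lra.
  have := harnack_iter k s0 sU zs4; rewrite ler_norml => /andP[h1 h2] h3.
  have [k1 k2] := XH k.
  have h4 : X * logm f k w <= X * (2 * logm f k z) by rewrite ler_wpM2l ?(ltW X0) //; lra.
  split; [move: h4 k1; lra|have := L_gt0 (n.+1 + k); move: h1 h2 h3 k2; lra].
- exact: orbit_point.
- by exists 1 => // k; rewrite logm_orbit !mul1r.
Qed.

(** Three circles for f^k with radii 1, |w| and rho, where z is a maximum point of |f^k| on |z| =
    rho. On |z| = 1 the bound r (k+1) holds because 1 < r 0. *)
Lemma radial_growth n k w (rho : R) : Un n.+1 w -> normc w <= rho ->
  exists2 z, normc z = rho &
    logm f k w * ln rho <= logm f k z * ln (normc w) + L k.+1 * (ln rho - ln (normc w)).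
Proof.
move=> Uw wrho; have w1 := Un_gt1 Uw; have rho1 : 1 < rho by exact: lt_le_trans w1 wrho.
have df := orbit_diff O.
have [|||z /= zr zM] := @compact_maximum R (fun z => normc (iter k f z)) [set z | normc z = rho].
- by exists rho%:C; rewrite /mkset normc_real ger0_norm // ltW // (lt_trans ltr01).
- exact: circle_compact.
- by move=> z _; apply: rcont_normc; apply: cdiff_cont; exact: cdiff_iter.
exists z => //.
have M0 : 0 < normc (iter k f z).
  apply: lt_le_trans (lt_trans ltr01 (iter_gt1 k Uw)) _.
  apply: (@max_modulus_disc R (iter k f) 0 rho); rewrite ?subr0 //.
  - by apply: entire_holomorphic => v; exact: cdiff_iter.
  - exact: normc_ge0.
  - by move=> v; rewrite subr0; exact: zM.
have rho0 : 0 < ln rho by exact: ln_gt0.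
have := @three_circles R (iter k f) (r k.+1) (normc (iter k f z)) (normc w) rho.
have di v : cdiff (iter k f) v by exact: cdiff_iter.
move=> /(_ di (r_pos _) M0); rewrite w1 wrho => /(_ isT).
have B1 v : normc v = 1 -> normc (iter k f v) <= r k.+1.
  by move=> v1; apply: (orbit_disc O (n := 0)); rewrite v1 ltW // r_gt1.
move=> /(_ B1 zM w erefl); rewrite -normc_eq0 gt_eqF ?(lt_trans ltr01 (iter_gt1 k Uw)) //.
by move=> /(_ isT); rewrite ler_pdivlMr.
Qed.

(** Maximum points v j that change with the iterate are replaced by a single point p, at the price
    of a factor 1 + e and of passing to infinitely many j. *)
Lemma harnack_cluster n K (v : nat -> C) : compact K -> K `<=` Un n.+1 -> (forall j, K (v j)) ->
  exists2 p, K p & forall (e : R) N, 0 < e -> exists2 j, (N <= j)%N &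
    forall k, logm f k (v j) <= (1 + e) * logm f k p.
Proof.
move=> cK KU Kv; have [p Kp pH] := cluster_sequence cK Kv.
exists p => // e N e0.
have /openCP /(_ p (KU p Kp)) [s s0 sU] := (orbit_open O) (n.+1).
have [|j Nj jd] := pH (Num.min (s / 4) (s * e / 8)) N.
  by rewrite lt_min !divr_gt0 ?mulr_gt0.
exists j => // k; move: jd; rewrite lt_min => /andP[j1 j2].
have := harnack_iter k s0 sU (ltW j1); rewrite ler_norml => /andP[_ h].
have lp : 0 < logm f k p by exact: logm_gt0 (KU p Kp).
have : 8 * (normc (v j - p) / s) * logm f k p <= e * logm f k p.
  rewrite ler_wpM2r ?(ltW lp) // mulrA ler_pdivrMr //; move: j2; lra.
rewrite mulrDl mul1r; lra.
Qed.

End Orbit.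
End AnnularOrbits.

(** * Level annuli *)

Section LevelSets.
Variable R : realType.
Local Notation C := R[i].
Local Notation Re := (@complex.Re R).
Local Notation Im := (@complex.Im R).
Implicit Types (z w c : C) (A B G : set C) (f g : C -> C).

Lemma cvgnP (u : nat -> R) (l : R) : u @ \oo --> l <->
  forall e : R, 0 < e -> exists N, forall n, (N <= n)%N -> `|u n - l| <= e.
Proof.
split=> [/cvgrPdist_le H e e0|H].
  have [N _ NH] := H e e0; exists N => n Nn; rewrite distrC; exact: NH.
apply/cvgrPdist_le => e e0; have [N NH] := H e e0; exists N => // n /= Nn.
by rewrite distrC; exact: NH.
Qed.

Lemma geometric_small (C0 e : R) : 0 < e -> exists N, forall n, (N <= n)%N -> C0 / 2 ^+ n <= e.
Proof.
move=> e0; have [N NH] := @pow_unbounded R 2 (C0 / e) (ltr1n R 2).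
exists N => n Nn; rewrite ler_pdivrMr ?exprn_gt0 // mulrC -ler_pdivrMr //.
by apply: le_trans (ltW NH) _; rewrite ler_weXn2l // ler1n.
Qed.

(* |y k| - 2 C0 / 2^k is nondecreasing, and y keeps its sign once |y k| stays
   above the errors. *)
Lemma drift_away_cvg (y : nat -> R) (B C0 : R) N : 0 <= C0 -> (forall k, `|y k| <= B) ->
  (forall k, (N <= k)%N -> 0 <= y k -> y k - C0 / 2 ^+ k <= y k.+1) ->
  (forall k, (N <= k)%N -> y k <= 0 -> y k.+1 <= y k + C0 / 2 ^+ k) ->
  exists l : R, y @ \oo --> l.
Proof.
move=> C00 yB yp yn.
have step k : (N <= k)%N -> `|y k| - C0 / 2 ^+ k <= `|y k.+1| /\
    (C0 / 2 ^+ k < `|y k| -> 0 < y k * y k.+1).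
  move=> Nk; have ck : 0 <= C0 / 2 ^+ k by rewrite divr_ge0 // exprn_ge0.
  have [y0|y0] := leP 0 (y k).
    have := yp k Nk y0 => H; split.
      by rewrite (ger0_norm y0); apply: le_trans H (ler_norm _).
    by rewrite (ger0_norm y0) => H2; rewrite mulr_gt0 //; lra.
  have := yn k Nk (ltW y0) => H; split.
    by rewrite (ltr0_norm y0) -[`|y k.+1|]normrN; apply: le_trans (ler_norm _); lra.
  by rewrite (ltr0_norm y0) => H2; rewrite nmulr_rgt0 //; lra.
pose t (k : nat) : R := `|y (k + N)%N| - 2 * (C0 / 2 ^+ (k + N)%N).
have tS k : t k <= t k.+1.
  have := (step (k + N)%N (leq_addl _ _)).1; rewrite /t addSn exprS invfM; lra.
have [l tl] : exists l : R, t @ \oo --> l.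
  exists (lim (t @ \oo)); apply: nondecreasing_is_cvgn; first by apply/nondecreasing_seqP.
  exists B => _ [k _ <-]; rewrite /t; have := yB (k + N)%N.
  have : 0 <= C0 / 2 ^+ (k + N) by rewrite divr_ge0 // exprn_ge0.
  lra.
move/cvgnP in tl.
have al (e : R) : 0 < e -> exists2 K, (N <= K)%N & forall k, (K <= k)%N -> `| `|y k| - l| <= e.
  move=> e0; have [|K KH] := tl (e / 2); first by rewrite divr_gt0.
  have [|M MH] := @geometric_small C0 (e / 4); first by rewrite divr_gt0.
  exists (maxn (K + N) M) => [|k]; first by rewrite leq_max leq_addl.
  rewrite geq_max => /andP[KNk Mk]; have := MH k Mk; have Nk : (N <= k)%N by exact: leq_trans (leq_addl _ _) KNk.
  have /KH : (K <= k - N)%N by rewrite leq_subRL // addnC.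
  rewrite /t subnK // ler_norml => /andP[h1 h2].
  have : 0 <= C0 / 2 ^+ k by rewrite divr_ge0 // exprn_ge0.
  by rewrite ler_norml; lra.
have l0 : 0 <= l.
  rewrite leNgt; apply/negP => l0; have [|K _ KH] := al (- l / 2); first by lra.
  have := KH K (leqnn _); rewrite ler_norml => /andP[_]; have := normr_ge0 (y K); lra.
move: l0; rewrite le_eqVlt => /orP[/eqP l0|l0].
  exists 0; apply/cvgnP => e /al [K _ KH]; exists K => k /KH.
  by rewrite -l0 !subr0 normr_id.
have [|K1 NK1 K1H] := al (l / 4); first by lra.
have [|K2 K2H] := @geometric_small C0 (l / 4); first by lra.
pose K := maxn K1 K2.
have KH k : (K <= k)%N -> 0 < y k * y k.+1 /\ l / 2 <= `|y k|.
  rewrite geq_max => /andP[k1 k2]; have := K1H k k1; rewrite ler_norml => /andP[h1 h2].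
  have := K2H k k2 => h3; split; last by lra.
  by apply: (step k (leq_trans NK1 k1)).2; lra.
have conclude (s : R) : s * s = 1 -> (forall k, (K <= k)%N -> y k = s * `|y k|) ->
    exists l' : R, y @ \oo --> l'.
  move=> ss ys; exists (s * l); apply/cvgnP => e /al [K' _ K'H]; exists (maxn K K') => k.
  rewrite geq_max => /andP[k1 /K'H k2]; rewrite (ys k k1) -mulrBr normrM.
  suff -> : `|s| = 1 by rewrite mul1r.
  by apply/eqP; rewrite -sqrp_eq1 // expr2 -normrM ss normr1.
have [yK|yK] := leP 0 (y K).
  have pos i : 0 < y (K + i)%N.
    elim: i => [|i IH].
      have [_] := KH K (leqnn _); rewrite addn0 (ger0_norm yK); lra.
    by have [] := KH (K + i)%N (leq_addr _ _); rewrite pmulr_rgt0 // addnS.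
  apply: (conclude 1); first by rewrite mulr1.
  by move=> k kK; rewrite mul1r gtr0_norm // -(subnKC kK).
have neg i : y (K + i)%N < 0.
  elim: i => [|i IH]; first by rewrite addn0.
  by have [] := KH (K + i)%N (leq_addr _ _); rewrite nmulr_rgt0 // addnS.
apply: (conclude (-1)); first by rewrite mulrNN mulr1.
by move=> k kK; rewrite mulN1r ltr0_norm ?opprK // -(subnKC kK).
Qed.

Section Orbit.
Variables (f : C -> C) (Un : nat -> set C) (z0 : C) (r : nat -> R).
Hypothesis O : annular_orbit f Un z0 r.
Local Notation L n := (ln (r n)).

Lemma L_unbounded (M : R) : exists N, forall n, (N <= n)%N -> M <= L n.
Proof.
have [c c0 cH] := L_exp O; have [N NH] := @pow_unbounded R 2 (M / c) (ltr1n R 2).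
exists N => n Nn; apply: le_trans (L_homo O Nn); apply: le_trans (cH N).
by rewrite mulrC -ler_pdivrMr // ltW.
Qed.

(* f^(phi j) omits p j, so that its exponents agree on Un n.+3 in the limit; but
   on a circle slightly larger than |z| = r n.+3 they exceed 1. *)
Lemma level_avoided n v : Un n.+3 v ->
  ~ (forall j K, exists2 k, (K <= k)%N & exists p, [/\ p != 0,
     `|ln (normc p) - logm f k v| <= j.+1%:R^-1 * L (n.+3 + k) & ~ Un (n.+3 + k) p]).
Proof.
move=> Uv /extract_subsequence [phi phi_homo /choice [p pH]].
have phi_ge j : (j <= phi j)%N.
  by elim: j => // j IH; apply: leq_ltn_trans IH (phi_homo j j.+1 (ltnSn j)).
have Lp k : 0 < L k by exact: L_gt0 O k.
pose P w := forall e : R, 0 < e -> exists J, forall j, (J <= j)%N ->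
  `|logm f (phi j) w - ln (normc (p j))| <= e * L (n.+3 + phi j).
have Pv : P v.
  move=> e e0; exists (Num.truncn e^-1).+1 => j Jj; have [_ h _] := pH j.
  rewrite distrC; apply: le_trans h _; rewrite ler_wpM2r ?(ltW (Lp _)) //.
  rewrite invf_ple ?posrE //; apply: le_trans (ltW (truncnS_gt _)) _.
  by rewrite ler_nat ltnW.
have Pall w : Un n.+3 w -> P w.
  apply: (@connected_chain R (Un n.+3) P _ _ _ v) => //.
  - exact: (orbit_open O).
  - exact: (orbit_connected O).
  move=> {Uv Pv}w s s0 sU Pw z zs e e0.
  have Uw : Un n.+3 w by apply: sU; exact: discxx.
  have [X X0 XH] := logm_bounds O Uw.
  have X3 : 0 < 2 * (2 * X + 3) by move: X0; lra.
  (* Then the bound 2 e' (2 X + 3) L^2 of [omitted_value] is at most (e L)^2. *)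
  pose e' : R := Num.min 1 (e ^+ 2 / (2 * (2 * X + 3))).
  have e'0 : 0 < e' by rewrite lt_min ltr01 divr_gt0 // exprn_gt0.
  have e'1 : e' <= 1 by rewrite ge_min lexx.
  have [J JH] := Pw e' e'0.
  have [N NH] := L_unbounded (pi / e').
  exists (maxn J N) => j; rewrite geq_max => /andP[Jj Nj].
  have [p0 _ pU] := pH j.
  set k := phi j in pU *; set Lk := L (n.+3 + k).
  have Lk0 : 0 < Lk by exact: Lp.
  have := @omitted_value R (iter k f) w (p j) s Lk X e' s0 Lk0 X0.
  rewrite e'0 e'1 => /(_ isT) H.
  have {}H : (logm f k z - ln (normc (p j))) ^+ 2 <= 2 * e' * (2 * X + 3) * Lk ^+ 2.
    apply: H => //.
    - by move=> u _; apply: cdiff_iter; exact: (orbit_diff O).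
    - by move=> u us; apply: (@iter_gt1 R f Un z0 r O n.+2); exact: sU.
    - move=> u us; apply/eqP => up; apply: pU; rewrite -up.
      by apply: (Un_iter O); exact: sU.
    - exact: JH.
    - rewrite mulrC -ler_pdivrMr //; apply: NH; apply: leq_trans Nj _.
      by apply: leq_trans (phi_ge j) _; rewrite leq_addl.
    - exact: (XH k).2.
  rewrite -ler_sqr ?nnegrE ?normr_ge0 ?mulr_ge0 ?(ltW e0) ?(ltW Lk0) //.
  rewrite real_normK ?num_real //; apply: le_trans H _.
  rewrite exprMn ler_wpM2r ?exprn_ge0 ?(ltW Lk0) //.
  have : e' * (2 * (2 * X + 3)) <= e ^+ 2 by rewrite -ler_pdivlMr // ge_min lexx orbT.
  by rewrite mulrA [e' * 2]mulrC.
pose w := iter n.+3 f z0.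
have Uw : Un n.+3 w by exact: (orbit_point O).
have [t rt tU] := orbit_circle O n.+3.
pose rho : R := (r n.+3 + t) / 2.
have r3 := r_pos O n.+3.
have rrho : r n.+3 < rho by rewrite /rho; move: rt; lra.
have rhot : rho < t by rewrite /rho; move: rt; lra.
have wr : normc w = r n.+3 by exact: (orbit_modulus O).
have Lrho : L n.+3 < ln rho by rewrite ltr_ln ?posrE // (lt_trans r3).
have wrho : normc w <= rho by rewrite wr ltW.
have [z zH] := choice (fun j => let: ex_intro2 z h1 h2 := radial_growth O (phi j) Uw wrho in
  ex_intro (fun z => normc z = rho /\ logm f (phi j) w * ln rho <= logm f (phi j) z * ln (normc w) + L (phi j).+1 * (ln rho - ln (normc w))) z (conj h1 h2)).
have KU : [set u | normc u = rho] `<=` Un n.+3.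
  by move=> u /= ur; apply: tU; rewrite ur rhot ltW.
have [q qK qH] := harnack_cluster O (@circle_compact R rho) KU (fun j => (zH j).1).
have Uq := KU q qK.
pose D := ln rho - L n.+3.
have D0 : 0 < D by rewrite /D; move: Lrho; lra.
have Lm := Lp n.+3.
have S0 : 0 < 2 * (5 * L n.+3 + D) by lra.
(* The estimates below end in D <= e (5 L + D), with 5 from (1 + e) (1 + 2 e) <= 1 + 5 e; this
   choice makes the right side at most D / 2. *)
pose e : R := Num.min 1 (D / (2 * (5 * L n.+3 + D))).
have e0 : 0 < e by rewrite lt_min ltr01 divr_gt0.
have e1 : e <= 1 by rewrite ge_min lexx.
have eD : e * (2 * (5 * L n.+3 + D)) <= D by rewrite -ler_pdivlMr // ge_min lexx orbT.
have [J1 J1H] := Pall w Uw e e0.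
have [J2 J2H] := Pall q Uq e e0.
have [J3 J3H] := L_ratio O e0.
have [j] := qH e (maxn J1 (maxn J2 J3)) e0.
rewrite !geq_max => /and3P[j1 j2 j3] /(_ (phi j)) hq.
have := J1H j j1; have := J2H j j2; have := J3H (phi j) n.+3 (leq_trans j3 (phi_ge j)) isT.
have := (zH j).2; rewrite wr (logm_orbit O) -/w.
have := Lp (n.+3 + phi j)%N; set La := L (n.+3 + phi j)%N; set Lb := L (phi j).+1.
have Lb0 : 0 < Lb by exact: Lp.
set a1 := logm f (phi j) q in hq *; set a2 := ln (normc (p j)); set a3 := logm f (phi j) (z j) in hq *.
rewrite !ler_norml => La0 h1 h2 /andP[_ h3] /andP[h4 h4'].
have h5 : a1 <= La * (1 + 2 * e) by lra.
have h6 : a3 <= La * ((1 + e) * (1 + 2 * e)).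
  apply: le_trans hq _; rewrite mulrCA ler_wpM2l //; lra.
have h7 : a3 <= La * (1 + 5 * e).
  apply: le_trans h6 _; rewrite ler_wpM2l ?(ltW La0) //.
  have : e * e <= e by rewrite ler_piMl // ltW.
  lra.
have h8 : a3 * L n.+3 <= La * (1 + 5 * e) * L n.+3 by rewrite ler_wpM2r ?(ltW Lm).
have h9 : Lb * D <= e * La * D by rewrite ler_wpM2r ?(ltW D0).
have : La * ln rho <= La * ((1 + 5 * e) * L n.+3 + e * D).
  by rewrite -/D in h1; lra.
rewrite ler_pM2l // => h10.
have : ln rho = D + L n.+3 by rewrite /D; ring.
lra.
Qed.

Lemma level_annulus n v : Un n.+3 v -> exists2 e : R, 0 < e & exists N, forall k p,
  (N <= k)%N -> p != 0 -> `|ln (normc p) - logm f k v| <= e * L (n.+3 + k) ->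
  Un (n.+3 + k) p.
Proof.
move=> Uv; apply: contrapT => H; apply: (level_avoided Uv) => j K; apply: contrapT => H2; apply: H.
exists j.+1%:R^-1; first by rewrite invr_gt0.
exists K => k p Kk p0 pH; apply: contrapT => pU; apply: H2; exists k => //; exists p; split => //.
Qed.

End Orbit.
End LevelSets.

(** * The limit exponent *)

Section LimitFunction.
Variable R : realType.
Local Notation C := R[i].
Local Notation Re := (@complex.Re R).
Local Notation Im := (@complex.Im R).
Implicit Types (z w c : C) (A B G : set C) (f g : C -> C).

Section Orbit.
Variables (f : C -> C) (Un : nat -> set C) (z0 : C) (r : nat -> R).
Hypothesis O : annular_orbit f Un z0 r.
Local Notation L n := (ln (r n)).

(* Harnack's inequality for s |-> f^j (f^k v * exp s), whose values exceed 1 in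
   modulus on a disc of radius proportional to L (n.+3 + k). *)
Lemma circle_flat n v : Un n.+3 v -> exists2 a : R, 0 < a & exists N, forall k j p,
  (N <= k)%N -> normc p = normc (iter k f v) ->
  logm f j p <= (1 + a / L (n.+3 + k)) * logm f (j + k) v.
Proof.
move=> Uv; have [e e0 [N NH]] := level_annulus O Uv.
have pi0 := @pi_gt0 R.
(* This makes pi at most a quarter of the radius e L, as Harnack requires; its constant 8 and |t| <=
   pi then give 8 pi / e. *)
have [N' N'H] := L_unbounded O (4 * pi / e).
exists (8 * pi / e); first by rewrite divr_gt0 // mulr_gt0.
exists (maxn N N') => k j p; rewrite geq_max => /andP[Nk N'k] pk.
have Lk0 := L_gt0 O (n.+3 + k).
set Lk := L (n.+3 + k) in Lk0 *.
have Lkpi : pi <= e * Lk / 4.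
  have : 4 * pi / e <= Lk by apply: N'H; apply: leq_trans N'k _; exact: leq_addl.
  by rewrite ler_pdivrMr // mulrC; lra.
set c := iter k f v in pk *.
have c1 : 1 < normc c by exact: (@iter_gt1 R f Un z0 r O n.+2).
have c0 : c != 0 by rewrite -normc_eq0 gt_eqF // (lt_trans ltr01).
have p0 : p != 0 by rewrite -normc_eq0 pk normc_eq0.
have [t tpi tE] : exists2 t : R, `|t| <= pi & p = c * cexp (0 +i* t).
  have [|t tpi tE] := @cexp_polar R (p / c); first by rewrite mulf_neq0 // invr_eq0.
  exists t => //; have h : ln (normc (p / c)) = 0.
    by rewrite normcM normcV pk divff ?ln1 // normc_eq0.
  by rewrite h in tE; rewrite -tE mulrC divfK.
pose g s := iter j f (c * cexp s).
have inU s : disc 0 (e * Lk) s -> Un (n.+3 + k) (c * cexp s).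
  rewrite /disc /mkset subr0 => sl; apply: NH => //.
    by rewrite mulf_neq0 // -normc_eq0 normc_cexp gt_eqF // expR_gt0.
  rewrite normcM normc_cexp lnM ?posrE ?expR_gt0 ?(lt_trans ltr01) // expRK.
  rewrite /logm addrAC subrr add0r; exact: le_trans (Re_le_normc _) (ltW sl).
have ti : normc (0 +i* t) = `|t|.
  by rewrite /normc expr0n add0r sqrtr_sqr.
have := @harnack R g 0 (e * Lk) _ _ (0 +i* t); rewrite subr0 ti => H.
have {}H : `|ln (normc (g (0 +i* t))) - ln (normc (g 0))| <= 8 * (`|t| / (e * Lk)) * ln (normc (g 0)).
  apply: H.
  - move=> s _; apply: (@cdiff_comp R (iter j f) (fun s => c * cexp s)).
      by apply: cdiffM; [exact: cdiff_cst|exact: cdiff_cexp].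
    by apply: cdiff_iter; exact: (orbit_diff O).
  - by move=> s sl; apply: (@iter_gt1 R f Un z0 r O (n.+2 + k)); rewrite -addSn; exact: inU.
  - exact: mulr_gt0.
  - exact: le_trans tpi Lkpi.
move: H; rewrite /g cexp0 mulr1 -tE /c -iterD -/(logm f j p) -/(logm f (j + k) v).
have l0 : 0 < logm f (j + k) v by exact: (@logm_gt0 R f Un z0 r O n.+2).
rewrite ler_norml => /andP[_ H].
have : 8 * (`|t| / (e * Lk)) * logm f (j + k) v <= 8 * pi / e / Lk * logm f (j + k) v.
  rewrite ler_wpM2r ?(ltW l0) //.
  have -> : 8 * (`|t| / (e * Lk)) = 8 * `|t| / e / Lk by field; rewrite !gt_eqF.
  by rewrite ler_wpM2r ?invr_ge0 ?(ltW Lk0) // ler_wpM2r ?invr_ge0 ?(ltW e0) // ler_wpM2l.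
by rewrite mulrDl mul1r; move: H; lra.
Qed.

Lemma exponent_bounded n v : Un n.+1 v -> exists2 X : R, 0 < X & forall k,
  X^-1 <= logm f k v / L (n.+1 + k) <= X.
Proof.
move=> /(logm_bounds O) [X X0 XH]; exists X => // k; have [h1 h2] := XH k.
have Lk := L_gt0 O (n.+1 + k).
by rewrite ler_pdivlMr // ler_pdivrMr // h2 ler_pdivrMl // h1.
Qed.

(** Three circles for f with radii 1, |p| and |q|. On |z| = 1 the bound is r 2, since 1 < r 0 and f
    maps |z| <= r 0 into |z| <= r 2. *)
Lemma circles_step p q (M : R) : 1 < normc p <= normc q -> f p != 0 ->
  (forall z, normc z = normc q -> logm f 1 z <= M) ->
  logm f 1 p * ln (normc q) <= M * ln (normc p) + L 2 * (ln (normc q) - ln (normc p)).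
Proof.
move=> pq fp qM; have /andP[p1 pq'] := pq.
have q0 : 0 < ln (normc q) by apply: ln_gt0; exact: lt_le_trans pq'.
have B1 z : normc z = 1 -> normc (f z) <= r 2.
  by move=> z1; apply: (orbit_disc O (n := 0) 1); rewrite z1 ltW // (r_gt1 O).
have BM z : normc z = normc q -> normc (f z) <= expR M.
  move=> /qM; rewrite /logm /=; have := normc_ge0 (f z); rewrite le_eqVlt => /orP[/eqP <- _|fz h].
    exact: expR_ge0.
  by rewrite -(lnK fz) ler_expR.
have := @three_circles R f (r 2) (expR M) (normc p) (normc q) (orbit_diff O) (r_pos O 2) (expR_gt0 M) pq B1 BM p erefl fp.
by rewrite expRK ler_pdivlMr.
Qed.

(* Comparison with the orbit of z0, whose exponents are 1, by three circles for
   f: exponents above 1 cannot decrease and those below 1 cannot increase, up to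
   errors O(2^-k). *)
Lemma exponent_cvg n v : Un n.+3 v ->
  exists l : R, (fun k => logm f k v / L (n.+3 + k)) @ \oo --> l.
Proof.
move=> Uv; have [X X0 XH] := exponent_bounded Uv.
have Uw := orbit_point O n.+3; set w := iter n.+3 f z0 in Uw.
have [c c0 cH] := L_exp O.
have [a1 a10 [N1 N1H]] := circle_flat Uv.
have [a2 a20 [N2 N2H]] := circle_flat Uw.
pose x (k : nat) : R := logm f k v / L (n.+3 + k); rewrite -/x.
have {}XH k : X^-1 <= x k <= X := XH k.
have L2 := L_gt0 O 2.
(* The terms with a1 and a2 come from the variation of ln |f| on the circles through f^k v and f^k
   w, those with L 2 from the inner circle |z| = 1; all are divided by an L of index at least k,
   which exceeds c 2^k. *)
pose C1 := (a1 * X + L 2 * X + a2 + L 2) / c.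
have aX : 0 < a1 * X by exact: mulr_gt0.
have LX : 0 < L 2 * X by exact: mulr_gt0.
have [l lH] : exists l : R, (fun k => x k - 1) @ \oo --> l.
  have small k j (b : R) : (k <= j)%N -> 0 <= b -> b / L j <= b / (c * 2 ^+ k).
    move=> kj b0; rewrite ler_wpM2l // lef_pV2 ?posrE ?(L_gt0 O) ?mulr_gt0 ?exprn_gt0 //.
    exact: le_trans (cH k) (L_homo O kj).
  have errE k : C1 / 2 ^+ k = a1 * X / (c * 2 ^+ k) + L 2 * X / (c * 2 ^+ k) + a2 / (c * 2 ^+ k) + L 2 / (c * 2 ^+ k).
    by rewrite /C1 -!mulrDl -mulrA -invfM.
  have step k : (maxn N1 N2 <= k)%N ->
     (1 <= x k -> x k <= x k.+1 + C1 / 2 ^+ k) /\ (x k <= 1 -> x k.+1 <= x k + C1 / 2 ^+ k).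
    rewrite geq_max => /andP[Nk1 Nk2].
    have kn : (k <= n.+3 + k)%N by exact: leq_addl.
    have kn1 : (k <= n.+3 + k.+1)%N by apply: leq_trans (leq_addl _ _).
    have La0 := L_gt0 O (n.+3 + k); have Lb0 := L_gt0 O (n.+3 + k.+1).
    have := small k _ (a1 * X) kn (ltW aX); have := small k _ (L 2 * X) kn1 (ltW LX).
    have := small k _ a2 kn (ltW a20); have := small k _ (L 2) kn1 (ltW L2).
    rewrite errE; move: {errE}(a1 * X / (c * 2 ^+ k)) (L 2 * X / (c * 2 ^+ k)) (a2 / (c * 2 ^+ k)) (L 2 / (c * 2 ^+ k)) => e1 e2 e3 e4.
    set La := L (n.+3 + k) in La0 *; set Lb := L (n.+3 + k.+1) in Lb0 *.
    move=> s4 s3 s2 s1.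
    have xk : logm f k v = x k * La by rewrite /x divfK // gt_eqF.
    have xk1 : logm f k.+1 v = x k.+1 * Lb by rewrite /x divfK // gt_eqF.
    have /andP[xX' xX] := XH k; have /andP[_ xX1] := XH k.+1.
    have x0 : 0 < x k by apply: lt_le_trans xX'; rewrite invr_gt0.
    have x10 : 0 < x k.+1 by apply: lt_le_trans (andP (XH k.+1)).1; rewrite invr_gt0.
    have p0 : 0 < a1 / La by exact: divr_gt0. have q0 : 0 < L 2 / Lb by exact: divr_gt0.
    have t0 : 0 < a2 / La by exact: divr_gt0.
    have vg j : 1 < normc (iter j f v) by exact: (@iter_gt1 R f Un z0 r O n.+2).
    have wr : normc (iter k f w) = r (n.+3 + k) by rewrite -iterD addnC (orbit_modulus O).
    have wg : 1 < normc (iter k f w) by rewrite wr (r_gt1 O).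
    have w1 : logm f 1 (iter k f w) = Lb.
      by rewrite /logm -!iterD (orbit_modulus O) /Lb ?addnA addnC add1n.
    have lv : ln (normc (iter k f v)) = x k * La by [].
    have lw : ln (normc (iter k f w)) = La by rewrite wr.
    have v1 : logm f 1 (iter k f v) = x k.+1 * Lb by [].
    have nz (u : C) : 1 < normc u -> u != 0 by move=> u1; rewrite -normc_eq0 gt_eqF // (lt_trans ltr01).
    have fv0 : f (iter k f v) != 0 by apply: nz; exact: (vg k.+1).
    have fw0 : f (iter k f w) != 0.
      by apply: nz; rewrite -iterS -iterD (orbit_modulus O) (r_gt1 O).
    (* If x k >= 1 then f^k v is the outer point and bounds the image of the orbit point, whose
       exponent stays 1; if x k <= 1 the roles are exchanged. *)
    split=> xk'.
      have wv : 1 < normc (iter k f w) <= normc (iter k f v).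
        rewrite wg /= -ler_ln ?posrE ?(lt_trans ltr01) // lv lw.
        by rewrite ler_peMl // ltW.
      have := circles_step wv fw0 (fun z zq => N1H k 1%N z Nk1 zq).
      rewrite w1 lv lw add1n xk1 => H.
      have {}H : x k <= (1 + a1 / La) * x k.+1 + L 2 / Lb * (x k - 1).
        rewrite -(ler_pM2r La0) -(ler_pM2r Lb0).
        have -> : ((1 + a1 / La) * x k.+1 + L 2 / Lb * (x k - 1)) * La * Lb =
            (1 + a1 / La) * (x k.+1 * Lb) * La + L 2 * (x k * La - La).
          by field; rewrite !gt_eqF.
        by apply: le_trans H; rewrite mulrC.
      have g1 : a1 / La * x k.+1 <= a1 / La * X by rewrite ler_wpM2l // ltW.
      have g2 : L 2 / Lb * (x k - 1) <= L 2 / Lb * X by rewrite ler_wpM2l ?(ltW q0) //; lra.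
      move: s1 s2; rewrite (mulrAC a1) (mulrAC (L 2)); lra.
    have vw : 1 < normc (iter k f v) <= normc (iter k f w).
      rewrite vg /= -ler_ln ?posrE ?(lt_trans ltr01) // lv lw.
      by rewrite ler_piMl // ltW.
    have := circles_step vw fv0 (fun z zq => N2H k 1%N z Nk2 zq).
    rewrite v1 lv lw (_ : logm f (1 + k) w = Lb); last by rewrite add1n -w1 /logm -iterD.
    move=> H.
    have {}H : x k.+1 <= (1 + a2 / La) * x k + L 2 / Lb * (1 - x k).
      rewrite -(ler_pM2r Lb0) -(ler_pM2r La0).
      have -> : ((1 + a2 / La) * x k + L 2 / Lb * (1 - x k)) * Lb * La =
          (1 + a2 / La) * Lb * (x k * La) + L 2 * (La - x k * La).
        by field; rewrite !gt_eqF.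
      exact: H.
    have g1 : a2 / La * x k <= a2 / La * 1 by rewrite ler_wpM2l // ltW.
    have g2 : L 2 / Lb * (1 - x k) <= L 2 / Lb * 1 by rewrite ler_wpM2l ?(ltW q0) //; lra.
    have E1 : 0 < a1 * X / La by exact: divr_gt0.
    have E2 : 0 < L 2 * X / Lb by exact: divr_gt0.
    lra.
  apply: (@drift_away_cvg R (fun k => x k - 1) (X + 1) C1 (maxn N1 N2)).
  - by rewrite divr_ge0 ?(ltW c0) //; lra.
  - move=> k; have /andP[h1 h2] := XH k; have : 0 < X^-1 by rewrite invr_gt0.
    by rewrite -/(x k) in h1 h2; rewrite ler_norml; lra.
  - by move=> k /step [h _]; rewrite subr_ge0 => /h; lra.
  - by move=> k /step [_ h]; rewrite subr_le0 => /h; lra.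
exists (l + 1); rewrite (_ : x = (fun k => x k - 1 + 1)); last by apply/funext => k; rewrite subrK.
by apply: cvgD => //; exact: cvg_cst.
Qed.


(** The index n is that of the domain containing v, so that f^k v is measured against the orbit
    point of its own domain. Convergence is known on [Un n.+3], by [exponent_cvg]. *)
Definition exponent n v : R := lim ((fun k => logm f k v / L (n + k)) @ \oo).

Lemma exponent_near n v (e : R) : Un n.+3 v -> 0 < e -> exists N, forall k, (N <= k)%N ->
  `|logm f k v / L (n.+3 + k) - exponent n.+3 v| <= e.
Proof.
move=> /exponent_cvg [l lH] e0; rewrite /exponent.
have -> : lim ((fun k => logm f k v / L (n.+3 + k)) @ \oo) = l by exact/cvg_lim.
by move/cvgnP: lH; exact.
Qed.

Lemma exponent_gt0 n v : Un n.+3 v -> 0 < exponent n.+3 v.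
Proof.
move=> Uv; have [X X0 XH] := exponent_bounded Uv.
have [|N NH] := @exponent_near n v (X^-1 / 2) Uv; first by rewrite divr_gt0 // invr_gt0.
have := NH N (leqnn _); have /andP[h _] := XH N; rewrite ler_norml => /andP[_].
have : 0 < X^-1 by rewrite invr_gt0.
lra.
Qed.

Lemma exponent_orbit n : exponent n (iter n f z0) = 1.
Proof.
rewrite /exponent (_ : (fun k => _) = (fun=> 1)); first exact: lim_cst.
by apply/funext => k; rewrite (logm_orbit O) divff // gt_eqF // (L_gt0 O).
Qed.

(** Since both limits exist, an inequality for infinitely many k suffices; this is what makes
    cluster points usable. *)
Lemma exponent_le n v v' (a b : R) : Un n.+3 v -> Un n.+3 v' -> 0 <= a ->
  (forall N, exists2 k, (N <= k)%N & logm f k v <= a * logm f k v' + b * L (n.+3 + k)) ->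
  exponent n.+3 v <= a * exponent n.+3 v' + b.
Proof.
move=> Uv Uv' a0 H; rewrite leNgt; apply/negP => Hl.
pose D := exponent n.+3 v - (a * exponent n.+3 v' + b).
have D0 : 0 < D by rewrite /D; lra.
pose e := D / (2 * (a + 1)).
have a1 : 0 < 2 * (a + 1) by lra.
have e0 : 0 < e by exact: divr_gt0.
have [N1 N1H] := exponent_near Uv e0; have [N2 N2H] := exponent_near Uv' e0.
have [k] := H (maxn N1 N2); rewrite geq_max => /andP[k1 k2].
have Lk := L_gt0 O (n.+3 + k).
move=> h0; have h : logm f k v / L (n.+3 + k) <= (a * logm f k v' + b * L (n.+3 + k)) / L (n.+3 + k).
  by rewrite ler_pM2r ?invr_gt0.
have := N1H k k1; have := N2H k k2; rewrite !ler_norml => /andP[_ h2] /andP[h3 _].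
have {}h : logm f k v / L (n.+3 + k) <= a * (logm f k v' / L (n.+3 + k)) + b.
  by move: h; rewrite mulrDl mulfK ?gt_eqF // mulrA.
have h4 : a * (logm f k v' / L (n.+3 + k)) <= a * (exponent n.+3 v' + e) by rewrite ler_wpM2l //; lra.
have : e * (2 * (a + 1)) = D by rewrite /e divfK // gt_eqF.
rewrite /D; lra.
Qed.

Lemma exponent_iter n j v : Un n.+3 v -> exponent (n.+3 + j) (iter j f v) = exponent n.+3 v.
Proof.
move=> /exponent_cvg [l lH]; rewrite /exponent.
transitivity l; last by apply/esym/cvg_lim.
apply/cvg_lim => //; apply/cvgnP => e e0; move/cvgnP: lH => /(_ e e0) [N NH].
exists N => k Nk; have := NH (k + j)%N (leq_trans Nk (leq_addr _ _)).
by rewrite /logm iterD [(k + j)%N]addnC addnA.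
Qed.

Lemma exponent_rcont n v : Un n.+3 v -> rcont (exponent n.+3) v.
Proof.
move=> Uv e e0; have /openCP /(_ v Uv) [s s0 sU] := (orbit_open O) (n.+3).
have hv := exponent_gt0 Uv; set h := exponent n.+3 v in hv *.
exists (Num.min (s / 16) (s * e / (16 * h))).
  by rewrite lt_min !divr_gt0 ?mulr_gt0.
move=> z; rewrite lt_min => /andP[z1 z2].
have Uz : Un n.+3 z by apply: sU; apply: lt_trans z1 _; lra.
pose q : R := 8 * (normc (z - v) / s).
have q0 : 0 <= q by rewrite mulr_ge0 // divr_ge0 ?normc_ge0 // ltW.
have hk k : `|logm f k z - logm f k v| <= q * logm f k v.
  by apply: (@harnack_iter R f Un z0 r O n.+2 k v z s s0 sU); move: z1; lra.
have qh : q * h < e.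
  move: z2; rewrite ltr_pdivlMr ?mulr_gt0 // => z2.
  have -> : q * h = normc (z - v) * (16 * h) / (2 * s) by rewrite /q; field; rewrite gt_eqF.
  rewrite ltr_pdivrMr ?mulr_gt0 //; have : 0 < s * e by exact: mulr_gt0.
  lra.
have q1 : q < 1.
  have : normc (z - v) / s < 1 / 16 by rewrite ltr_pdivrMr //; lra.
  by rewrite /q; lra.
apply: le_lt_trans qh; rewrite ler_norml; apply/andP; split.
  have q1' : 0 < 1 - q by lra.
  have : exponent n.+3 v <= (1 - q)^-1 * exponent n.+3 z + 0.
    apply: exponent_le => //; first by rewrite invr_ge0 ltW.
    move=> N; exists N => //; rewrite mul0r addr0 -(ler_pM2l q1') mulrA mulfV ?gt_eqF // mul1r.
    by have := hk N; rewrite ler_norml => /andP[h1 _]; lra.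
  rewrite addr0 -(ler_pM2l q1') mulrA mulfV ?gt_eqF // mul1r -/h; lra.
have : exponent n.+3 z <= (1 + q) * exponent n.+3 v + 0.
  apply: exponent_le => //; first by lra.
  move=> N; exists N => //; have := hk N; rewrite ler_norml => /andP[_]; lra.
rewrite -/h; lra.
Qed.

(** In the limit the contribution of |z| = 1 disappears by [L_ratio], and three circles says that
    the exponent at w divided by ln |w| is at most the exponent at p divided by ln rho. The set K is
    the circle |z| = rho itself when it lies in U_n, and otherwise a compact set from
    [hull_dominated]. *)
Lemma exponent_radial n w (rho : R) K : Un n.+3 w -> normc w <= rho ->
  compact K -> K `<=` Un n.+3 ->
  (forall k z, normc z = rho -> exists2 v, K v & normc (iter k f z) <= normc (iter k f v)) ->
  exists2 p, K p & exponent n.+3 w * ln rho <= exponent n.+3 p * ln (normc w).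
Proof.
move=> Uw wrho cK KU dom.
have w1 : 1 < normc w by exact: (@Un_gt1 R f Un z0 r O n.+2).
have lw0 : 0 < ln (normc w) by exact: ln_gt0.
have lwrho : ln (normc w) <= ln rho by rewrite ler_ln ?posrE // ?(lt_le_trans _ wrho) // (lt_trans ltr01).
have /choice [v vH] : forall k, exists v : C, K v /\
    logm f k w * ln rho <= logm f k v * ln (normc w) + L k.+1 * (ln rho - ln (normc w)).
  move=> k.
  have [z zr zH] := radial_growth O k Uw wrho; have [v Kv zv] := dom k z zr.
  exists v; split => //; apply: le_trans zH _; rewrite lerD2r ler_wpM2r ?(ltW lw0) //.
  (* As ln 0 = 0, a zero of f^k at z is handled through the positivity of [logm] at v. *)
  have := normc_ge0 (iter k f z); rewrite le_eqVlt => /orP[/eqP z00|z00].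
    rewrite /logm -z00 ln0 //; apply: ltW; exact: (@logm_gt0 R f Un z0 r O n.+2 k v (KU _ Kv)).
  by rewrite /logm ler_ln ?posrE // (lt_le_trans z00).
have [p Kp pH] := harnack_cluster O cK KU (fun j => (vH j).1).
exists p => //; have Up := KU p Kp.
have hp := exponent_gt0 Up; have lr0 : 0 < ln rho by lra.
have main (e : R) : 0 < e -> exponent n.+3 w <= (1 + e) * ln (normc w) / ln rho * exponent n.+3 p + e.
  move=> e0; apply: exponent_le => //.
    by rewrite divr_ge0 ?(ltW lr0) // mulr_ge0 ?(ltW lw0) //; lra.
  move=> N; have [N' N'H] := L_ratio O e0.
  have [k] := pH e (maxn N N') e0; rewrite geq_max => /andP[Nk N'k] /(_ k) hk.
  exists k => //; rewrite -(ler_pM2r lr0); apply: le_trans (vH k).2 _.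
  have Lk := N'H k n.+3 N'k isT; have Lp := L_gt0 O k.+1.
  have h1 : logm f k (v k) * ln (normc w) <= (1 + e) * logm f k p * ln (normc w) by rewrite ler_wpM2r ?(ltW lw0).
  have h2 : L k.+1 * (ln rho - ln (normc w)) <= e * L (n.+3 + k) * ln rho.
    apply: le_trans (_ : L k.+1 * ln rho <= _); last by rewrite ler_wpM2r // ltW.
    by rewrite ler_wpM2l ?(ltW Lp) //; lra.
  rewrite mulrDl (_ : (1 + e) * ln (normc w) / ln rho * logm f k p * ln rho = (1 + e) * logm f k p * ln (normc w)); first by lra.
  by field; rewrite gt_eqF.
apply/ler_addgt0Pl => d d0.
(* The coefficient of e in [main] after multiplication by ln rho. *)
pose S : R := ln (normc w) * exponent n.+3 p + ln rho.
have S0 : 0 < S by rewrite addr_gt0 // mulr_gt0.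
have := main (d / S) (divr_gt0 d0 S0); rewrite -(ler_pM2r lr0).
have : d / S * S = d by rewrite divfK // gt_eqF.
move: (d / S) => e eS.
rewrite mulrDl (_ : (1 + e) * ln (normc w) / ln rho * exponent n.+3 p * ln rho = (1 + e) * ln (normc w) * exponent n.+3 p); last by field; rewrite gt_eqF.
move: eS; rewrite /S; lra.
Qed.

(** One use of [circle_flat], at f^3 z0, covers all circles |z| = r (n+3), so that a does not depend
    on n. *)
Lemma exponent_circle : exists2 a : R, 0 < a & exists N, forall n p, (N <= n)%N ->
  normc p = r n.+3 -> exponent n.+3 p <= 1 + a / L n.+3.
Proof.
have [a a0 [N NH]] := circle_flat (orbit_point O 3).
exists a => //; exists N => n p Nn pr.
have Up := circle_sub O pr; have Uw := orbit_point O n.+3.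
have : exponent n.+3 p <= (1 + a / L n.+3) * exponent n.+3 (iter n.+3 f z0) + 0.
  apply: exponent_le => //; first by rewrite addr_ge0 // divr_ge0 // ltW // (L_gt0 O).
  move=> k; exists k => //; rewrite mul0r addr0.
  have := NH n k p Nn; rewrite pr -iterD (orbit_modulus O) addn3 => /(_ erefl).
  rewrite (logm_orbit O) addnC addn3 (logm_orbit O).
  rewrite (_ : (3 + (k + n))%N = (n.+3 + k)%N) //.
  by rewrite [(k + n)%N]addnC.
by rewrite exponent_orbit mulr1 addr0.
Qed.

End Orbit.
End LimitFunction.

(** * The range of the limit exponent *)

Section ExponentRange.
Variable R : realType.
Local Notation C := R[i].
Local Notation Re := (@complex.Re R).
Local Notation Im := (@complex.Im R).
Implicit Types (z w c : C) (A B G : set C) (f g : C -> C).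

Section Orbit.
Variables (f : C -> C) (Un : nat -> set C) (z0 : C) (r : nat -> R).
Hypothesis O : annular_orbit f Un z0 r.
Local Notation L n := (ln (r n)).
Local Notation exponent := (exponent f r).

(** The exponent is invariant along orbits and f^n maps U_3 onto U_{n+3}, so all these domains share
    one range. *)
Definition exponent_range : set R := exponent 3 @` Un 3.

Lemma exponent_in_range n v : Un n.+3 v -> exponent_range (exponent n.+3 v).
Proof.
move=> Uv; have [u Uu uv] := @Un_preimage R f Un z0 r O 3 n v Uv.
by exists u => //; rewrite -uv -(exponent_iter O n Uu).
Qed.

Lemma range_gt0 x : exponent_range x -> 0 < x.
Proof. by move=> [v Uv <-]; exact: (exponent_gt0 O). Qed.

Lemma range_one : exponent_range 1.
Proof.
by rewrite -(exponent_orbit O 3); apply: exponent_in_range; exact: (orbit_point O).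
Qed.

Lemma range_interval x1 x2 x : exponent_range x1 -> exponent_range x2 -> x1 <= x <= x2 ->
  exponent_range x.
Proof.
move=> [v1 U1 <-] [v2 U2 <-] /andP[h1 h2].
have [v Uv vx] : exists2 v, Un 3 v & exponent 3 v = x.
  apply: (@connected_intermediate R (Un 3) (exponent 3)).
  - exact: (orbit_connected O).
  - by move=> z; exact: (exponent_rcont O).
  - by exists v1.
  - by exists v2.
by exists v.
Qed.

Lemma range_level x : exponent_range x -> exists2 e : R, 0 < e & exists N, forall n p,
  (N <= n)%N -> p != 0 -> `|ln (normc p) / L n.+3 - x| <= e -> Un n.+3 p.
Proof.
move=> [v Uv <-]; have [e e0 [N NH]] := level_annulus O Uv.
have [|N' N'H] := @exponent_near R f Un z0 r O 0 v (e / 2) Uv; first by rewrite divr_gt0.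
exists (e / 2); first by rewrite divr_gt0.
exists (maxn N N') => n p; rewrite geq_max => /andP[Nn N'n] p0 pe.
apply: (NH n p) => //; have Ln := L_gt0 O (3 + n).
have E (y : R) : y = y / L (3 + n) * L (3 + n) by rewrite divfK // gt_eqF.
rewrite (E (ln _)) (E (logm f n v)) -mulrBl normrM (gtr0_norm Ln) ler_pM2r //.
by have := N'H n N'n; move: pe; rewrite !ler_norml => /andP[h1 h2] /andP[h3 h4]; lra.
Qed.

(* Otherwise the exponents of the missing points cluster at a value of the range. *)
Lemma range_fill x1 x2 : exponent_range x1 -> exponent_range x2 ->
  exists N, forall n p, (N <= n)%N -> p != 0 -> x1 <= ln (normc p) / L n.+3 <= x2 -> Un n.+3 p.
Proof.
move=> E1 E2; apply: contrapT => H.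
have /choice [q qH] : forall N, exists np : nat * C, [/\ (N <= np.1)%N, np.2 != 0,
    x1 <= ln (normc np.2) / L np.1.+3 <= x2 & ~ Un np.1.+3 np.2].
  move=> N; apply: contrapT => H2; apply: H; exists N => n p Nn p0 px.
  by apply: contrapT => pU; apply: H2; exists (n, p).
pose x N := ln (normc (q N).2) / L (q N).1.+3.
have xH N : x1 <= x N <= x2 by have [] := qH N.
have [|c _ cH] := @cluster_sequence R (cdisc 0 (`|x1| + `|x2|)) (fun N => (x N)%:C) (@cdisc_compact R _ _).
  move=> N; rewrite /cdisc /mkset subr0 normc_real ler_norml.
  have /andP[h1 h2] := xH N.
  have := ler_norm x2; have := ler_norm (- x1); rewrite normrN.
  have := normr_ge0 x1; have := normr_ge0 x2; lra.
have near (d : R) N : 0 < d -> exists2 n, (N <= n)%N & `|x n - Re c| < d.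
  move=> d0; have [n Nn nd] := cH d N d0; exists n => //; apply: le_lt_trans nd.
  by have := @Re_le_normc R ((x n)%:C - c); rewrite reB.
have cx : x1 <= Re c <= x2.
  rewrite !leNgt; apply/andP; split; apply/negP => h.
    have [|n _] := near (x1 - Re c) 0%N; first by rewrite subr_gt0.
    by rewrite ltr_norml => /andP[_]; have /andP[] := xH n; lra.
  have [|n _] := near (Re c - x2) 0%N; first by rewrite subr_gt0.
  by rewrite ltr_norml => /andP[h' _]; have /andP[] := xH n; lra.
have [e e0 [N NH]] := range_level (range_interval E1 E2 cx).
have [n Nn nd] := near e N e0; have [qn q0 _] := qH n; apply.
by apply: NH => //; [exact: leq_trans qn|exact: ltW].
Qed.

(** This is [exponent_radial] with K the circle |z| = r (n+3), where exponents are at most 1 + a /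
    L. *)
Lemma inner_bound : exists2 a : R, 0 < a & exists N, forall n w, (N <= n)%N ->
  Un n.+3 w -> normc w <= r n.+3 ->
  exponent n.+3 w * L n.+3 <= (1 + a / L n.+3) * ln (normc w).
Proof.
have [a a0 [N NH]] := exponent_circle O; exists a => //; exists N => n w Nn Uw wr.
have [||k z zr|p pr] := @exponent_radial R f Un z0 r O n w (r n.+3) [set z | normc z = r n.+3] Uw wr.
- exact: circle_compact.
- by move=> z /=; exact: (circle_sub O).
- by exists z.
have lw : 0 < ln (normc w) by apply: ln_gt0; exact: (@Un_gt1 R f Un z0 r O n.+2).
have : exponent n.+3 p * ln (normc w) <= (1 + a / L n.+3) * ln (normc w).
  by rewrite ler_wpM2r ?(ltW lw) //; exact: NH.
by move=> h1 h2; exact: le_trans h1.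
Qed.

Lemma outer_bound n (rho : R) K : r n.+3 <= rho -> compact K -> K `<=` Un n.+3 ->
  (forall k z, normc z = rho -> exists2 v, K v & normc (iter k f z) <= normc (iter k f v)) ->
  exists2 x, exponent_range x & ln rho / L n.+3 <= x.
Proof.
move=> rrho cK KU dom; have Uw := orbit_point O n.+3.
have wr : normc (iter n.+3 f z0) = r n.+3 by exact: (orbit_modulus O).
have [|p Kp] := @exponent_radial R f Un z0 r O n (iter n.+3 f z0) rho K Uw _ cK KU dom.
  by rewrite wr.
rewrite wr (exponent_orbit O) mul1r => H; exists (exponent n.+3 p); first exact/exponent_in_range/KU.
by rewrite ler_pdivrMr // (L_gt0 O).
Qed.

Lemma ratio_bound n w (rho : R) K : Un n.+3 w -> normc w <= rho -> compact K -> K `<=` Un n.+3 ->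
  (forall k z, normc z = rho -> exists2 v, K v & normc (iter k f z) <= normc (iter k f v)) ->
  exists x y, [/\ exponent_range x, exponent_range y & x * ln rho <= y * ln (normc w)].
Proof.
move=> Uw wrho cK KU dom.
have [p Kp pH] := @exponent_radial R f Un z0 r O n w rho K Uw wrho cK KU dom.
by exists (exponent n.+3 w), (exponent n.+3 p); split => //; apply: exponent_in_range => //; exact: KU.
Qed.

(** It yields a < 1 < b. Above 1, [outer_bound] is used on a circle slightly larger than |z| = r 3.
    Below 1, a point of modulus (r n)^(1 - e') has exponent at most (1 + e') (1 - e') < 1 by
    [inner_bound], once a / L <= e'. *)
Lemma range_near1 : exists2 e : R, 0 < e & exponent_range (1 - e) /\ exponent_range (1 + e).
Proof.
have [x2 E2 x21] : exists2 x, exponent_range x & 1 < x.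
  have [t rt tU] := (orbit_circle O) 3%N; pose rho : R := (r 3 + t) / 2.
  have rrho : r 3 < rho by rewrite /rho; move: rt; lra.
  have rhot : rho < t by rewrite /rho; move: rt; lra.
  have [||k z zr|x Ex xr] := @outer_bound 0 rho [set z | normc z = rho] (ltW rrho).
  - exact: circle_compact.
  - by move=> z /= zr; apply: tU; rewrite zr rhot ltW.
  - by exists z.
  exists x => //; apply: lt_le_trans xr; rewrite ltr_pdivlMr ?(L_gt0 O) // mul1r.
  by rewrite ltr_ln ?posrE //; have := r_pos O 3; move: rrho; lra.
have [x1 E1 x11] : exists2 x, exponent_range x & x < 1.
  have [e e0 [N NH]] := range_level range_one.
  have [a a0 [N' N'H]] := inner_bound.
  pose e' : R := Num.min (1 / 2) e.
  have e'0 : 0 < e' by rewrite lt_min e0 divr_gt0.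
  have e'e : e' <= e by rewrite ge_min lexx orbT.
  have e'1 : e' <= 1 / 2 by rewrite ge_min lexx.
  have [N2 N2H] := L_unbounded O (a / e').
  pose n := maxn N (maxn N' N2).
  have nN : (N <= n)%N by rewrite leq_max leqnn.
  have nN' : (N' <= n)%N by rewrite !leq_max leqnn orbT.
  have nN2 : (N2 <= n.+3)%N by apply: leq_trans (leq_addl 3 n); rewrite !leq_max leqnn !orbT.
  have Ln := L_gt0 O n.+3; set Ll := L n.+3 in Ln *.
  pose p : C := (expR ((1 - e') * Ll))%:C.
  have pn : normc p = expR ((1 - e') * Ll) by rewrite normc_real gtr0_norm // expR_gt0.
  have p0 : p != 0 by rewrite -normc_eq0 pn gt_eqF // expR_gt0.
  have Up : Un n.+3 p.
    apply: NH => //; rewrite pn expRK mulfK ?gt_eqF // ler_norml; lra.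
  have pr : normc p <= r n.+3.
    rewrite pn -[X in _ <= X]lnK ?posrE ?(r_pos O) // ler_expR -/Ll.
    by rewrite ler_piMl ?(ltW Ln) //; lra.
  exists (exponent n.+3 p); first exact: exponent_in_range.
  have := N'H n p nN' Up pr; rewrite pn expRK -/Ll mulrA ler_pM2r // => h.
  have aL : a / Ll <= e' by rewrite ler_pdivrMr // mulrC -ler_pdivrMr //; exact: N2H.
  have h2 : (1 + a / Ll) * (1 - e') <= (1 + e') * (1 - e') by rewrite ler_wpM2r //; lra.
  have : 0 < e' * e' by exact: mulr_gt0.
  lra.
pose e : R := Num.min (1 - x1) (x2 - 1).
have e1 : e <= 1 - x1 by rewrite ge_min lexx.
have e2 : e <= x2 - 1 by rewrite ge_min lexx orbT.
have e0 : 0 < e by rewrite lt_min !subr_gt0 x11.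
exists e => //; split.
- by apply: (range_interval E1 range_one); lra.
- by apply: (range_interval range_one E2); lra.
Qed.

End Orbit.
End ExponentRange.

(** * Hulls *)

Section Hull.
Variable R : realType.
Local Notation C := R[i].
Local Notation Re := (@complex.Re R).
Local Notation Im := (@complex.Im R).
Implicit Types (z w c : C) (A B G : set C) (f g : C -> C).

Lemma bounded_setCP A : bounded_set A <-> exists t : R, forall w, A w -> normc w <= t.
Proof.
split=> [[M [/complex_realP [m ->] MH]]|[t tH]].
  exists (m + 1) => w Aw; have := MH (m + 1)%:C _ w Aw.
  by rewrite /= normr_normc lecR; apply; rewrite ltcR ltrDl.
exists t%:C; split; first by rewrite complex_real.
move=> x tx w Aw; rewrite /= normr_normc; apply: le_trans (ltW tx).
by rewrite lecR; exact: tH.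
Qed.

Lemma compact_closed_separated A B : compact A -> closed B -> (forall z, A z -> ~ B z) ->
  exists2 d : R, 0 < d & forall a b, A a -> B b -> d <= normc (a - b).
Proof.
move=> cA cB AB; apply: contrapT => H.
have /choice [q qH] : forall n, exists ab : C * C,
    [/\ A ab.1, B ab.2 & normc (ab.1 - ab.2) < n.+1%:R^-1].
  move=> n; apply: contrapT => H2; apply: H; exists n.+1%:R^-1; first by rewrite invr_gt0.
  move=> a b Aa Bb; rewrite leNgt; apply/negP => ab; apply: H2; by exists (a, b).
have [p Ap pH] := @cluster_sequence R A (fun n => (q n).1) cA (fun n => let: And3 h _ _ := qH n in h).
have : (~` B) p by exact: AB.
move: cB => /closed_openC /openCP H2 /H2 [e e0 eB].
have [|n Nn nd] := pH (e / 2) (Num.truncn (2 / e)).+1; first by rewrite divr_gt0.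
have [_ Bb nb] := qH n.
apply: (eB (q n).2) => //; rewrite /disc /mkset.
have : n.+1%:R^-1 < e / 2.
  rewrite -[X in _ < X]invrK ltf_pV2 ?posrE ?invr_gt0 ?divr_gt0 // invf_div.
  apply: lt_le_trans (truncnS_gt _) _; rewrite ler_nat; exact: leqW.
move: nb; move: (n.+1%:R^-1) => t; have := normc_triangle (q n).2 (q n).1 p; rewrite (normcB (q n).2 (q n).1); lra.
Qed.

(** Otherwise the traces of the members on A generate a proper filter, and its cluster point lies in
    every member. *)
Lemma compact_avoids_member (F : set (set C)) A : compact A -> F !=set0 ->
  (forall Y, F Y -> closed Y) -> (forall Y1 Y2, F Y1 -> F Y2 -> F (Y1 `&` Y2)) ->
  (forall z, A z -> exists2 Y, F Y & ~ Y z) ->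
  exists2 Y, F Y & forall z, A z -> ~ Y z.
Proof.
move=> cA [Y0 FY0] Fcl FI avoid; apply: contrapT => H.
pose FF : set (set C) := [set S | exists2 Y, F Y & A `&` Y `<=` S].
have FFF : ProperFilter FF.
  split.
    move=> [Y FY Y0']; apply: H; exists Y => // z Az Yz; exact: (Y0' z).
  split.
  - by exists Y0.
  - move=> S1 S2 [Y1 FY1 h1] [Y2 FY2 h2]; exists (Y1 `&` Y2); first exact: FI.
    by move=> z [Az [z1 z2]]; split; [exact: h1|exact: h2].
  - by move=> S1 S2 S12 [Y FY h]; exists Y => // z /h; exact: S12.
have [|z [Az zc]] := cA FF FFF; first by exists Y0 => // z [].
have [Y FY Yz] := avoid z Az.
have [||w [[_ Yw] nYw]] := zc (A `&` Y) (~` Y).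
- by exists Y.
- by apply: open_nbhs_nbhs; split => //; exact: closed_openC (Fcl Y FY).
- exact: nYw.
Qed.

Section QuasiComponent.
Variables (X S : set C).
Hypotheses (cX : compact X) (SX : S `<=` X) (S0 : S !=set0) (cS : connected S).

Definition clopen_around (Y : set C) :=
  [/\ Y `<=` X, closed Y, closed (X `\` Y) & S `<=` Y].

Lemma clopen_aroundI Y1 Y2 : clopen_around Y1 -> clopen_around Y2 -> clopen_around (Y1 `&` Y2).
Proof.
move=> [h1 h2 h3 h4] [k1 k2 k3 k4]; split.
- by move=> z [/h1].
- exact: closedI.
- by rewrite setDIr; exact: closedU.
- by move=> z Sz; split; [exact: h4|exact: k4].
Qed.

Lemma clopen_aroundT : clopen_around X.
Proof.
split => //; last by rewrite setDv; exact: closed0.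
by apply: compact_closed => //; exact: norm_hausdorff.
Qed.

(** Unlike for a component, a point outside is by definition separated from S by a relatively clopen
    set. In the compact X it is nevertheless connected. *)
Definition quasi_component : set C := [set z | forall Y, clopen_around Y -> Y z].

Lemma quasi_closed : closed quasi_component.
Proof.
rewrite (_ : quasi_component = \bigcap_(Y in clopen_around) Y); first by apply: closed_bigI => Y [].
by apply/seteqP; split => z h Y /h.
Qed.

(* A clopen neighbourhood of the quasi-component that avoids the points off
   small neighbourhoods of A and B is split by them into two clopen parts. *)
Lemma quasi_split A B : closed A -> closed B -> (forall z, A z -> ~ B z) ->
  quasi_component = A `|` B -> S `<=` A -> B = set0.
Proof.
move=> cA cB AB QE SA.
have QX z : quasi_component z -> X z by move=> /(_ _ clopen_aroundT).
have cpA : compact A.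
  by apply: (subclosed_compact cA cX) => z Az; apply: QX; rewrite QE; left.
have [d d0 dH] := compact_closed_separated cpA cB AB.
pose near (D : set C) : set C := \bigcup_(a in D) disc a (d / 2).
have near_open D : open (near D) by apply: bigcup_open => a _; exact: disc_open.
have near_sub D : D `<=` near D.
  by move=> z Dz; exists z => //; apply: discxx; rewrite divr_gt0.
have near_disj z : near A z -> ~ near B z.
  move=> [a Aa az] [b Bb bz]; have := dH a b Aa Bb.
  have := normc_triangle a z b.
  by move: az bz; rewrite /disc /mkset (normcB z a); lra.
have clX : closed X by have [] := clopen_aroundT.
have [|||||Y FY YH] := @compact_avoids_member clopen_around (X `&` (~` (near A `|` near B))).
- apply: (subclosed_compact _ cX); last by move=> z [].
  by apply: closedI => //; rewrite closedC; exact: openU.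
- by exists X; exact: clopen_aroundT.
- by move=> Y [].
- exact: clopen_aroundI.
- move=> z [Xz nz]; apply: contrapT => H; apply: nz.
  have : quasi_component z.
    by move=> Y FY; apply: contrapT => Yz; apply: H; exists Y.
  by rewrite QE => -[/near_sub|/near_sub]; [left|right].
have [YX cY cY' SY] := FY.
have YAB z : Y z -> near A z \/ near B z.
  by move=> Yz; apply: contrapT => h; apply: (YH z) => //; split => //; exact: YX.
have FYA : clopen_around (Y `&` near A).
  split.
  - by move=> z [/YX].
  - rewrite (_ : _ `&` _ = Y `&` ~` near B); first by apply: closedI => //; rewrite closedC.
    apply/seteqP; split => z [Yz zH]; split => //; first exact: near_disj.
    by have [] := YAB z Yz.
  - rewrite setDIr; apply: closedU => //.
    by rewrite setDE; apply: closedI => //; rewrite closedC.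
  - by move=> z Sz; split; [exact: SY|exact/near_sub/SA].
apply/seteqP; split => // z Bz.
have Qz : quasi_component z by rewrite QE; right.
by have [_ /near_disj] := Qz _ FYA; apply; exact: near_sub.
Qed.

(** The connected S lies in one of two disjoint closed parts, and then [quasi_split] makes the other
    part empty. *)
Lemma quasi_connected : connected quasi_component.
Proof.
have SQ : S `<=` quasi_component by move=> z Sz Y [_ _ _]; exact.
move=> B B0 [G oG BG] [D cD BD].
have cQ := quasi_closed.
have cB : closed B by rewrite BD; exact: closedI.
have cB' : closed (quasi_component `&` ~` G) by apply: closedI => //; rewrite closedC.
have disj z : B z -> ~ (quasi_component `&` ~` G) z by rewrite BG => -[_ Gz] [].
have QE : quasi_component = B `|` (quasi_component `&` ~` G).
  by rewrite {1}BG -setIUr setUv setIT.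
have [SB|SB] := pselect (S `&` G !=set0).
  have SG : S `&` G = S.
    apply: cS => //; first by exists G.
    exists D => //; apply/seteqP; split => z [Sz zH]; split => //.
      have : B z by rewrite BG; split => //; exact: SQ.
      by rewrite BD => -[].
    have : B z by rewrite BD; split => //; exact: SQ.
    by rewrite BG => -[].
  have := quasi_split cB cB' disj QE; move=> H; rewrite QE H ?setU0 //.
  by move=> z; rewrite -{1}SG => -[Sz Gz]; rewrite BG; split => //; exact: SQ.
have : B = set0.
  apply: (quasi_split cB' cB); [by move=> z h1 h2; exact: (disj z)|by rewrite setUC|].
  by move=> z Sz; split; [exact: SQ|move=> Gz; apply: SB; exists z].
by move: B0 => [b Bb] B00; rewrite B00 in Bb.
Qed.

End QuasiComponent.

Lemma near_compact_closed A (t : R) : compact A -> closed [set z | exists2 a, A a & normc (z - a) <= t].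
Proof.
move=> cA; rewrite -[X in closed X]setCK closedC; apply/openCP => z zH.
have [A0|/set0P A0] := eqVneq A set0.
  by exists 1 => // w _ [a]; rewrite A0.
have [|a Aa aM] := @compact_maximum R (fun a => - normc (a - z)) A A0 cA.
  move=> a _ e e0; have [|d d0 dH] := @rcont_normc R (fun a => a - z) a _ e e0.
    by apply/cdiff_cont/cdiffB; [exact: cdiff_id|exact: cdiff_cst].
  by exists d => // w /dH; rewrite -opprD normrN.
have az : t < normc (a - z).
  by rewrite ltNge; apply/negP => h; apply: zH; exists a => //; rewrite normcB.
exists (normc (a - z) - t); first by rewrite subr_gt0.
move=> w wd [b Bb wb]; have := aM b Bb; move: wd; rewrite /disc /mkset.
have := normc_triangle b w z; rewrite (normcB b w); lra.
Qed.

(* The quasi-component of the circle |z| = T in the complement of G is connected,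
   so a clopen part Y of that complement contains the circle and misses the disc of
   radius rho; the points at small distance from Y form the compact set K. *)
Lemma hull_dominated G (rho T : R) : open G -> 0 < T -> 0 <= rho -> (forall w, G w -> normc w < T) ->
  (forall z, normc z <= rho -> ~ unbounded_complement G z) ->
  exists K, [/\ compact K, K `<=` G & forall g, (forall z, cdiff g z) ->
    forall z, normc z <= rho -> exists2 v, K v & normc (g z) <= normc (g v)].
Proof.
move=> oG T0 rho0 GT noU.
pose X := cdisc 0 T `&` ~` G; pose S : set C := [set z | normc z = T].
have cX : compact X.
  apply: (subclosed_compact _ (@cdisc_compact R 0 T)); last by move=> z [].
  by apply: closedI; [exact: cdisc_closed|rewrite closedC].
have ST : S T%:C by rewrite /S /mkset normc_real ger0_norm // ltW.
have S0 : S !=set0 by exists T%:C.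
have SX : S `<=` X.
  move=> z zT; split; first by rewrite /cdisc /mkset subr0 zT.
  by move=> /GT; rewrite zT ltxx.
have cS : connected S by exact: circle_connected.
pose Q := quasi_component X S.
have SQ : S `<=` Q by move=> z Sz Y [_ _ _]; exact.
(* The quasi-component together with |z| >= T is connected, unbounded and disjoint from G. *)
have QU z : Q z -> unbounded_complement G z.
  move=> Qz; pose E := Q `|` [set z | T <= normc z].
  have cE : connected E.
    apply: connectedU.
    - by exists T%:C; split; [exact: SQ|rewrite /mkset normc_real ger0_norm // ltW].
    - exact: quasi_connected.
    - exact: exterior_connected.
  have EG : E `<=` ~` G.
    move=> w [Qw|/= Tw]; first by have [_] := Qw X (clopen_aroundT cX SX).
    by move=> /GT; rewrite ltNge Tw.
  have EC : E `<=` connected_component (~` G) z.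
    by apply: connected_component_max => //; left.
  rewrite /unbounded_complement /mkset => /bounded_setCP [t tE].
  pose x : R := Num.max T (t + 1).
  have xT : T <= x by rewrite le_max lexx.
  have xt : t + 1 <= x by rewrite le_max lexx orbT.
  have xn : normc x%:C = x by rewrite normc_real ger0_norm // (le_trans (ltW T0)).
  have : normc x%:C <= t by apply/tE/EC; right; rewrite /mkset xn.
  by rewrite xn; move: xt; lra.
have [||||Y FY YH] := @compact_avoids_member (clopen_around X S) (cdisc 0 rho) (@cdisc_compact R _ _).
- by exists X; exact: clopen_aroundT.
- by move=> Y [].
- exact: clopen_aroundI.
- move=> z; rewrite /cdisc /mkset subr0 => zr; apply: contrapT => H; apply: (noU z zr); apply: QU.
  by move=> Y FY; apply: contrapT => Yz; apply: H; exists Y.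
have [YX cY cZ SY] := FY.
have cpY : compact Y by apply: (subclosed_compact cY cX).
have rT : rho < T.
  rewrite ltNge; apply/negP => Tr; apply: (YH T%:C); last exact: SY.
  by rewrite /cdisc /mkset subr0 normc_real ger0_norm // ltW.
have [|z Yz|d d0 dH] := @compact_closed_separated Y (X `\` Y `|` cdisc 0 rho) cpY.
- by apply: closedU => //; exact: cdisc_closed.
- by move=> [[]//|/YH].
(* The shell of points at distance between d / 3 and 2 d / 3 from Y misses Y, and X minus Y as well,
   so it lies in G. It contains all boundary points of the part of [P] outside [near], to which the
   disc of radius rho belongs; the circle |z| = T is removed together with Y. *)
pose near := [set z | exists2 y, Y y & normc (z - y) <= 2 * d / 3].
pose P := cdisc 0 T `&` ~` (\bigcup_(y in Y) disc y (d / 3)).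
have cP : compact P.
  apply: (subclosed_compact _ (@cdisc_compact R 0 T)); last by move=> z [].
  apply: closedI; first exact: cdisc_closed.
  by rewrite closedC; apply: bigcup_open => y _; exact: disc_open.
have cnear : closed near by exact: near_compact_closed.
have PG z : P z -> near z -> G z.
  move=> [zT Pz] [y Yy yz]; apply: contrapT => Gz; have [Yz'|Yz'] := pselect (Y z).
    by apply: Pz; exists z => //; apply: discxx; rewrite divr_gt0.
  have := dH y z Yy; rewrite normcB => H.
  have : d <= normc (z - y) by apply: H; left.
  move: d0 yz; lra.
have maxP g (M : R) : (forall z, cdiff g z) -> (forall z, P z -> near z -> normc (g z) <= M) ->
    forall z, normc z <= rho -> normc (g z) <= M.
  move=> dg gM z zr.
  apply: (@max_principle R P (disc 0 T `&` ~` near) (fun z => normc (g z)) M cP).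
  - apply: openI; first exact: disc_open.
    by rewrite openC.
  - move=> w [wT wn]; split; first by apply: ltW; exact: wT.
    move=> [y Yy yw]; apply: wn; exists y => //; move: yw; rewrite /disc /mkset; lra.
  - by move=> w _; apply: rcont_normc; exact: cdiff_cont.
  - by move=> w _; apply: submax_normc; exact: (@entire_holomorphic R setT g dg w I).
  - move=> w Pw nA; apply: gM => //; apply: contrapT => wn; apply: nA; split => //.
    have [wT wY] := Pw; rewrite /disc /mkset lt_neqAle wT andbT; apply/eqP; rewrite subr0 => wT'.
    by apply: wY; exists w; [exact: SY|apply: discxx; rewrite divr_gt0].
  - split; first by rewrite /cdisc /mkset subr0; apply: le_trans zr (ltW rT).
    move=> [y Yy yz]; have := dH y z Yy; rewrite normcB => H.
    have : d <= normc (z - y) by apply: H; right; rewrite /cdisc /mkset subr0.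
    by move: yz; rewrite /disc /mkset; lra.
have clP : closed P by apply: compact_closed cP; exact: norm_hausdorff.
have cK : compact (P `&` near).
  by apply: (subclosed_compact _ cP); [exact: closedI|move=> z []].
(* Over an empty shell the maximum principle would bound the constant 1 by 0. *)
have K0 : P `&` near !=set0.
  apply: contrapT => K0; have := maxP (fun=> 1) 0 (fun z => cdiff_cst 1 z) _ 0.
  rewrite normc0 normc1 => /(_ _ rho0) H; have : (1 : R) <= 0.
    by apply: H => z Pz nz; exfalso; apply: K0; exists z.
  by rewrite ler10.
exists (P `&` near); split => //; first by move=> z [Pz nz]; exact: PG.
move=> g dg z zr; have [|v Kv vM] := @compact_maximum R (fun z => normc (g z)) _ K0 cK.
  by move=> w _; apply: rcont_normc; exact: cdiff_cont.
by exists v => //; apply: maxP zr => // w Pw nw; exact: vM.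
Qed.
End Hull.

(** * Boundary components and maximal annuli *)

Section Boundaries.
Variable R : realType.
Local Notation C := R[i].
Local Notation Re := (@complex.Re R).
Local Notation Im := (@complex.Im R).
Implicit Types (z w c : C) (A B G : set C) (f g : C -> C).

Section Boundary.
Variables (G : set C).
Local Notation inner := (connected_component (~` G) 0).

Lemma inner_component_le (s t : R) : 0 < s < t -> (forall w, s < normc w < t -> G w) ->
  forall z, inner z -> normc z <= s.
Proof.
move=> /andP[s0 st] GA z iz; rewrite leNgt; apply/negP => sz.
have G0 : (~` G) 0 by have [B [B0 BG _] _] := iz; exact: BG.
pose u : R := (s + Num.min t (normc z)) / 2.
have mt : Num.min t (normc z) <= t by rewrite ge_min lexx.
have mz : Num.min t (normc z) <= normc z by rewrite ge_min lexx orbT.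
have sm : s < Num.min t (normc z) by rewrite lt_min st.
have := @connected_inside R inner u (@component_connected _ _ _) _ _ z iz.
have H1 w : inner w -> normc w <> u.
  move=> /connected_component_sub Gw wu; apply: Gw; apply: GA; rewrite wu /u; lra.
have H2 : exists2 w, inner w & normc w < u.
  exists 0; first exact: connected_component_refl.
  by rewrite normc0 /u; lra.
move=> /(_ H1 H2); rewrite /u; lra.
Qed.

Lemma inner_boundary_le (s t : R) : 0 < s < t -> (forall w, s < normc w < t -> G w) ->
  forall z, inner_boundary G z -> normc z <= s.
Proof.
move=> st GA z [cz _]; have cl : closed [set w : C | normc w <= s].
  exact: (@closed_sublevel R (@ComplexField.Normc.normc R) s (@normc_rcont R)).
apply: (cl z); apply: closureS cz => w; exact: inner_component_le st GA w.
Qed.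

Lemma inner_boundary_ge (q : R) : 0 < q -> (forall w, G w -> q <= normc w) ->
  forall z, inner_boundary G z -> q <= normc z.
Proof.
move=> q0 Gq z [_ iz]; rewrite leNgt; apply/negP => zq; apply: iz.
have sub : disc 0 q `<=` inner.
  apply: connected_component_max; [by rewrite /disc /mkset subr0 normc0| |exact: disc_connected].
  by move=> w; rewrite /disc /mkset subr0 => wq /Gq; rewrite leNgt wq.
rewrite /interior /mkset; apply: filterS sub _; apply: open_nbhs_nbhs; split; first exact: disc_open.
by rewrite /disc /mkset subr0.
Qed.

(** A disc about z that misses G and meets the component belongs to it entirely, so z would be an
    interior point. *)
Lemma inner_boundary_near z (e : R) : inner_boundary G z -> 0 < e ->
  exists2 w, G w & normc (w - z) < e.
Proof.
move=> [cz iz] e0; apply: contrapT => H; apply: iz.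
have DG : disc z e `<=` ~` G by move=> w wd Gw; apply: H; exists w.
have nz : nbhs z (disc z e) by apply: open_nbhs_nbhs; split; [exact: disc_open|exact: discxx].
have [w [iw wd]] := cz _ nz.
rewrite /interior /mkset; apply: filterS nz => v vd.
rewrite (same_connected_component iw).
by apply: (@connected_component_max _ _ (disc z e)) => //; exact: disc_connected.
Qed.

Lemma unbounded_complement_ge (s t : R) : 0 < s < t -> (forall w, s < normc w < t -> G w) ->
  forall z, unbounded_complement G z -> t <= normc z.
Proof.
move=> /andP[s0 st] GA z uz; rewrite leNgt; apply/negP => zt; apply: uz.
apply/bounded_setCP.
pose u : R := (t + Num.max s (normc z)) / 2.
have ms : s <= Num.max s (normc z) by rewrite le_max lexx.
have mz : normc z <= Num.max s (normc z) by rewrite le_max lexx orbT.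
have mt : Num.max s (normc z) < t by rewrite gt_max st.
exists u => w cw; apply: ltW.
have Gz : (~` G) z by have [B [Bz BG _] _] := cw; exact: BG.
apply: (@connected_inside R (connected_component (~` G) z) u) cw.
- exact: component_connected.
- move=> v /connected_component_sub Gv vu; apply: Gv; apply: GA; rewrite vu /u; lra.
- exists z; last by rewrite /u; lra.
  exact: connected_component_refl.
Qed.

Lemma outer_boundary_ge (s t : R) : 0 < s < t -> (forall w, s < normc w < t -> G w) ->
  forall z, outer_boundary G z -> t <= normc z.
Proof.
move=> st GA z [cz _]; have cl : closed [set w : C | t <= normc w].
  exact: (@closed_superlevel R (@ComplexField.Normc.normc R) t (@normc_rcont R)).
apply: (cl z); apply: closureS cz => w; exact: unbounded_complement_ge st GA w.
Qed.

(** The connected disc of radius rho contains no boundary point of the unbounded complement, so it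
    lies on one side, that of 0. *)
Lemma below_outer_boundary (rho : R) : 0 < rho -> ~ unbounded_complement G 0 ->
  (forall z, outer_boundary G z -> rho <= normc z) ->
  forall z, normc z < rho -> ~ unbounded_complement G z.
Proof.
move=> rho0 U0 bd z zr.
apply: (@connected_induction R (disc 0 rho) (fun z => ~ unbounded_complement G z)).
- exact: disc_connected.
- by exists 0 => //; rewrite /disc /mkset subr0 normc0.
- move=> w; rewrite /disc /mkset subr0 => wr nUw.
  apply: contrapT => H; have /bd : outer_boundary G w.
    split; last by move=> /interior_subset.
    move=> B /nbhsCP [d d0 dB]; apply: contrapT => UB; apply: H; exists d => // v _ vd Uv.
    by apply: UB; exists v; split => //; exact: dB.
  by rewrite leNgt wr.
- move=> w; rewrite /disc /mkset subr0 => wr /contrapT Uw.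
  have : interior (unbounded_complement G) w.
    apply: contrapT => iw; have /bd : outer_boundary G w by split => //; exact: subset_closure.
    by rewrite leNgt wr.
  rewrite /interior /mkset => /nbhsCP [d d0 dU]; exists d => // v _ /dU Uv; exact.
- by rewrite /disc /mkset subr0.
Qed.

End Boundary.

Lemma normc_gt_powR z (q x : R) : z != 0 -> 1 < q -> (q `^ x < normc z) = (x * ln q < ln (normc z)).
Proof.
move=> z0 q1; have q0 : 0 < q by exact: lt_trans q1.
by rewrite -ln_powR ltr_ln ?posrE ?powR_gt0 ?normc_gt0.
Qed.

Lemma normc_lt_powR z (q x : R) : z != 0 -> 1 < q -> (normc z < q `^ x) = (ln (normc z) < x * ln q).
Proof.
move=> z0 q1; have q0 : 0 < q by exact: lt_trans q1.
by rewrite -ln_powR ltr_ln ?posrE ?powR_gt0 ?normc_gt0.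
Qed.

Lemma ler_powR_exp (q x y : R) : 1 < q -> (q `^ x <= q `^ y) = (x <= y).
Proof.
move=> q1; have q0 : 0 < q by exact: lt_trans q1.
have -> : (q `^ x <= q `^ y) = (ln (q `^ x) <= ln (q `^ y)) by rewrite ler_ln ?posrE ?powR_gt0.
by rewrite !ln_powR ler_pM2r // ln_gt0.
Qed.

Lemma ltr_powR_exp (q x y : R) : 1 < q -> (q `^ x < q `^ y) = (x < y).
Proof. by move=> q1; rewrite !ltNge ler_powR_exp. Qed.

Lemma powR_point (q x : R) : 1 < q -> exists2 z : C, z != 0 & normc z = q `^ x /\ ln (normc z) = x * ln q.
Proof.
move=> q1; have q0 : 0 < q by exact: lt_trans q1.
exists (q `^ x)%:C.
  by rewrite -normc_eq0 normc_real normr_eq0 gt_eqF // powR_gt0.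
by rewrite normc_real ger0_norm ?powR_ge0 // ln_powR.
Qed.

Section MaximalAnnulus.
Variables (G : set C) (z : C) (q x y : R).
Hypotheses (q1 : 1 < q) (z0 : z != 0).
Hypothesis maxA : maximal_annulus G z (q `^ x) (q `^ y).

Lemma maximal_annulus_in : x * ln q < ln (normc z) < y * ln q.
Proof.
by have [_ _ /andP[h1 h2] _] := maxA; rewrite -normc_gt_powR // h1 -normc_lt_powR.
Qed.

Lemma maximal_annulus_sub w : w != 0 -> x * ln q < ln (normc w) < y * ln q -> G w.
Proof.
have [_ h _ _] := maxA; move=> w0 wxy; apply: h.
by rewrite /annulus /mkset normc_gt_powR // normc_lt_powR.
Qed.

Lemma maximal_annulus_max x' y' : x' * ln q < ln (normc z) < y' * ln q ->
  (forall w, w != 0 -> x' * ln q < ln (normc w) < y' * ln q -> G w) -> x <= x' /\ y' <= y.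
Proof.
move=> /andP[zx zy] sub; have l0 : 0 < ln q by exact: ln_gt0.
have q0 : 0 < q by exact: lt_trans q1.
have xy : x' < y' by rewrite -(ltr_pM2r l0); exact: lt_trans zy.
have [_ _ _ /(_ (q `^ x') (q `^ y'))] := maxA.
rewrite powR_gt0 //= -ltr_ln ?posrE ?powR_gt0 // !ln_powR ltr_pM2r // => /(_ xy) H.
have {}H : annulus (q `^ x') (q `^ y') `<=` annulus (q `^ x) (q `^ y).
  apply: H; last by rewrite /annulus /mkset normc_gt_powR // normc_lt_powR // zx.
  move=> w /andP[w1 w2]; have w0 : w != 0.
    by rewrite -normc_gt0; apply: le_lt_trans w1; exact: powR_ge0.
  by apply: sub => //; rewrite -normc_gt_powR // w1 -normc_lt_powR.
(* Points of modulus q^c turn the inclusion of annuli into one of exponent intervals. *)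
have key (c : R) : x' < c < y' -> x < c < y.
  have [w w0 [_ wl]] := powR_point c q1 => /andP[c1 c2].
  have : annulus (q `^ x) (q `^ y) w.
    apply: H; rewrite /annulus /mkset normc_gt_powR // normc_lt_powR // wl.
    by rewrite !ltr_pM2r // c1.
  by rewrite /annulus /mkset normc_gt_powR // normc_lt_powR // wl !ltr_pM2r.
split; rewrite leNgt; apply/negP => h.
  have m1 : Num.min x y' <= x by rewrite ge_min lexx.
  have m2 : Num.min x y' <= y' by rewrite ge_min lexx orbT.
  have m3 : x' < Num.min x y' by rewrite lt_min h.
  have [] := andP (key ((x' + Num.min x y') / 2) _); last by lra.
  lra.
have m1 : y <= Num.max y x' by rewrite le_max lexx.
have m2 : x' <= Num.max y x' by rewrite le_max lexx orbT.
have m3 : Num.max y x' < y' by rewrite gt_max h.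
have [] := andP (key ((y' + Num.max y x') / 2) _); last by lra.
lra.
Qed.

End MaximalAnnulus.
End Boundaries.

(** * Limits of the exponents *)

Section Asymptotics.
Variable R : realType.
Local Notation C := R[i].
Local Notation Re := (@complex.Re R).
Local Notation Im := (@complex.Im R).
Implicit Types (z w c : C) (A B G : set C) (f g : C -> C).

Section Orbit.
Variables (f : C -> C) (Un : nat -> set C) (z0 : C) (r aa bb : nat -> R).
Hypothesis O : annular_orbit f Un z0 r.
Hypothesis maxA : forall n, maximal_annulus (Un n) (iter n f z0) (r n `^ aa n) (r n `^ bb n).
Local Notation L n := (ln (r n)).
Local Notation E := (exponent_range f Un r).

Definition inf_exponent : R := inf E.
Definition sup_exponent : \bar R := ereal_sup (EFin @` E).
Local Notation alpha := inf_exponent.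
Local Notation beta := sup_exponent.

Lemma range_lbound : lbound E 0.
Proof. by move=> x /(range_gt0 O) /ltW. Qed.

Lemma range_inhabited : E !=set0.
Proof. by exists 1; exact: (range_one O). Qed.

Lemma inf_exponent_le x : E x -> alpha <= x.
Proof. by move=> Ex; apply: ge_inf => //; exists 0; exact: range_lbound. Qed.

Lemma inf_exponent_ge0 : 0 <= alpha.
Proof. apply: lb_le_inf; [exact: range_inhabited|exact: range_lbound]. Qed.

Lemma inf_exponent_lt1 : alpha < 1.
Proof.
have [e e0 [Ee _]] := range_near1 O; apply: le_lt_trans (inf_exponent_le Ee) _.
by rewrite gtrBl.
Qed.

Lemma inf_exponent_adherent (e : R) : 0 < e -> exists2 x, E x & x < alpha + e.
Proof.
by move=> e0; apply: inf_adherent => //; split; [exact: range_inhabited|exists 0; exact: range_lbound].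
Qed.

Lemma sup_exponent_ge x : E x -> (x%:E <= beta)%E.
Proof. by move=> Ex; apply: ereal_sup_ubound; exists x. Qed.

Lemma sup_exponent_gt1 : (1 < beta)%E.
Proof.
have [e e0 [_ Ee]] := range_near1 O; apply: lt_le_trans (sup_exponent_ge Ee).
by rewrite lte_fin ltrDl.
Qed.

(** Only x >= 1 is asked for: then |z| = (r n)^x encloses |z| = r n, as [outer_bound] requires. *)
Lemma sup_exponent_approx (y : R) : (forall x, 1 <= x < y -> exists2 c, E c & x <= c) ->
  (y%:E <= beta)%E.
Proof.
move=> H; rewrite leNgt; apply/negP => by_.
have b1 := sup_exponent_gt1; have ub := sup_exponent_ge.
move: by_ b1 ub; case: beta => [c| |] //; rewrite !lte_fin => cy c1 ub.
have [|x Ex xc] := H ((c + y) / 2); first by lra.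
have := ub x Ex; rewrite lee_fin; lra.
Qed.

Lemma cvg_sup_exponent (u : nat -> R) :
  (forall x, E x -> exists N, forall n, (N <= n)%N -> x <= u n) ->
  (exists N, forall n, (N <= n)%N -> ((u n)%:E <= beta)%E) ->
  (fun n => (u n)%:E) @ \oo --> beta.
Proof.
move=> lo [N hi].
have [b1 ub] := (sup_exponent_gt1, sup_exponent_ge).
have sup_lt (x : R) : (x%:E < beta)%E -> exists2 c, E c & x < c.
  move=> /ereal_sup_gt [_ [c Ec <-]]; rewrite lte_fin; by exists c.
move: hi b1 sup_lt; case: beta => [c| |] // hi b1 sup_lt.
  apply: cvg_EFin; first exact: nearW.
  rewrite /=; apply/cvgnP => e e0.
  have [|x Ex xc] := sup_lt (c - e); first by rewrite lte_fin gtrBl.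
  have [M MH] := lo x Ex; exists (maxn N M) => n; rewrite geq_max => /andP[/hi h1 /MH h2].
  by rewrite lee_fin in h1; rewrite /= ler_norml; lra.
apply/cvgeyPge => A.
have [|x Ex xA] := sup_lt A; first by rewrite ltry.
have [M MH] := lo x Ex; exists M => // n /= /MH h; rewrite lee_fin; lra.
Qed.

Let zE n : ln (normc (iter n f z0)) = L n.
Proof. by rewrite (orbit_modulus O). Qed.

Let zn0 n : iter n f z0 != 0.
Proof. by rewrite -normc_eq0 (orbit_modulus O) gt_eqF // (r_pos O). Qed.

Lemma annulus_exponents n : aa n < 1 < bb n.
Proof.
have := maximal_annulus_in (r_gt1 O n) (zn0 n) (maxA n); rewrite zE.
by rewrite -{2 3}[L n]mul1r !ltr_pM2r // (L_gt0 O).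
Qed.

Lemma annulus_sub n w : w != 0 -> aa n < ln (normc w) / L n < bb n -> Un n w.
Proof.
move=> w0; rewrite ltr_pdivlMr ?(L_gt0 O) // ltr_pdivrMr ?(L_gt0 O) //.
by move=> h; apply: (maximal_annulus_sub (r_gt1 O n) (maxA n)) => //.
Qed.

Lemma annulus_max n (x y : R) : x < 1 < y ->
  (forall w, w != 0 -> x < ln (normc w) / L n < y -> Un n w) -> x >= aa n /\ y <= bb n.
Proof.
move=> /andP[x1 y1] H.
have Ln := L_gt0 O n.
apply: (maximal_annulus_max (r_gt1 O n) (zn0 n) (maxA n)).
  by rewrite zE -{2 3}[L n]mul1r !ltr_pM2r // x1.
move=> w w0 wH; apply: H => //.
by rewrite ltr_pdivlMr // ltr_pdivrMr.
Qed.

(** By [inner_bound] a point w with ln |w| <= y L gives alpha <= (1 + a / L) y <= y + a / L for y <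
    1. It is used with y0 an exponent of the maximal annulus and of the inner boundary. *)
Lemma inner_limit : exists2 a : R, 0 < a & exists N, forall n (y0 : R), (N <= n)%N -> y0 < 1 ->
  (forall y, y0 < y < 1 -> exists2 w, Un n.+3 w & ln (normc w) <= y * L n.+3) ->
  alpha <= y0 + a / L n.+3.
Proof.
have [a a0 [N NH]] := inner_bound O; exists a => //; exists N => n y0 Nn y01 H.
have Ln := L_gt0 O n.+3; have aL : 0 < a / L n.+3 by exact: divr_gt0.
rewrite leNgt; apply/negP => lt.
pose m := Num.min 1 (alpha - a / L n.+3).
have m1 : m <= 1 by rewrite ge_min lexx.
have m2 : m <= alpha - a / L n.+3 by rewrite ge_min lexx orbT.
have m3 : y0 < m by rewrite lt_min y01 /=; lra.
pose y := (y0 + m) / 2.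
have y1 : y < 1 by rewrite /y; lra.
have [|w Uw wy] := H y; first by rewrite y1 andbT /y; lra.
have w1 : 1 < normc w by exact: (@Un_gt1 R f Un z0 r O n.+2).
have wr : normc w <= r n.+3.
  rewrite -ler_ln ?posrE ?(r_pos O) ?(lt_trans ltr01) //.
  by apply: le_trans wy _; rewrite ler_piMl ?(ltW Ln) // ltW.
have h := NH n w Nn Uw wr; have ax := inf_exponent_le (exponent_in_range O Uw).
have h1 : (1 + a / L n.+3) * ln (normc w) <= (1 + a / L n.+3) * (y * L n.+3).
  by rewrite ler_wpM2l //; lra.
have h2 : alpha * L n.+3 <= exponent f r n.+3 w * L n.+3 by rewrite ler_wpM2r // ltW.
have : alpha * L n.+3 <= (1 + a / L n.+3) * y * L n.+3.
  by rewrite -mulrA; apply: le_trans h2 (le_trans h h1).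
rewrite ler_pM2r // mulrDl mul1r => h3.
have : a / L n.+3 * y < a / L n.+3 by rewrite gtr_pMr.
have : y < m by rewrite /y; lra.
lra.
Qed.

Lemma aa_ge : exists2 a : R, 0 < a & exists N, forall n, (N <= n)%N -> alpha <= aa n.+3 + a / L n.+3.
Proof.
have [a a0 [N NH]] := inner_limit; exists a => //; exists N => n Nn; apply: NH => //.
  by have /andP[] := annulus_exponents n.+3.
have /andP[_ b1] := annulus_exponents n.+3.
move=> y /andP[y1 y2]; have [w w0 [_ wl]] := powR_point y (r_gt1 O n.+3).
exists w; last by rewrite wl.
apply: annulus_sub => //; rewrite wl mulfK ?gt_eqF ?(L_gt0 O) // y1 /=; lra.
Qed.

(** For x < 1 in the range and n large, U_n contains all points with exponent in [x, 1]. Together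
    with the outer half of the maximal annulus they form an annulus, and maximality gives aa <= x.
    The argument for [bb_ge] is symmetric. *)
Lemma aa_le (e : R) : 0 < e -> exists N, forall n, (N <= n)%N -> aa n.+3 <= alpha + e.
Proof.
move=> e0; have [x Ex xe] := inf_exponent_adherent e0.
have [x1|x1] := ltP x 1; last first.
  exists 0%N => n _; have /andP[+ _] := annulus_exponents n.+3; lra.
have [N NH] := range_fill O Ex (range_one O); exists N => n Nn.
have /andP[a1 b1] := annulus_exponents n.+3.
have [] := @annulus_max n.+3 x (bb n.+3); [by rewrite x1| |lra].
move=> w w0 /andP[w1 w2]; have [wl|wl] := leP (ln (normc w) / L n.+3) 1.
  by apply: NH => //; rewrite ltW.
by apply: annulus_sub => //; rewrite w2 andbT; lra.
Qed.

Lemma bb_ge x : E x -> exists N, forall n, (N <= n)%N -> x <= bb n.+3.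
Proof.
move=> Ex; have [x1|x1] := leP x 1.
  exists 0%N => n _; have /andP[_] := annulus_exponents n.+3; lra.
have [N NH] := range_fill O (range_one O) Ex; exists N => n Nn.
have /andP[a1 b1] := annulus_exponents n.+3.
have [] := @annulus_max n.+3 (aa n.+3) x; [by rewrite x1 a1| |lra].
move=> w w0 /andP[w1 w2]; have [wl|wl] := leP 1 (ln (normc w) / L n.+3).
  by apply: NH => //; rewrite wl ltW.
by apply: annulus_sub => //; rewrite w1 /=; lra.
Qed.

Section Index.
Variable n : nat.
Local Notation G := (Un n.+3).
Local Notation q := (r n.+3).
Let q1 : 1 < q := r_gt1 O n.+3.
Let Ln : 0 < L n.+3 := L_gt0 O n.+3.
Let q0 : 0 < q := r_pos O n.+3.

Lemma annulus_radii : 0 < q `^ aa n.+3 < q `^ bb n.+3.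
Proof.
rewrite powR_gt0 //= ltr_powR_exp //.
have /andP[] := annulus_exponents n.+3; lra.
Qed.

Lemma annulus_radii_sub w : q `^ aa n.+3 < normc w < q `^ bb n.+3 -> G w.
Proof. by have [_ h _ _] := maxA n.+3; move=> /h. Qed.

Lemma inner_exponent_le x : circle_exponents (inner_boundary G) q x -> x <= aa n.+3.
Proof.
move=> [p ip px]; have := inner_boundary_le annulus_radii annulus_radii_sub ip.
by rewrite px ler_powR_exp.
Qed.

(** Because U_{n+3} lies outside |z| = r (n+2) > 1, so does its inner boundary. *)
Lemma inner_exponent_gt0 x : circle_exponents (inner_boundary G) q x -> 0 < x.
Proof.
move=> [p ip px]; have := @inner_boundary_ge R G (r n.+2) (r_pos O _) _ p ip.
have h w : G w -> r n.+2 <= normc w by move=> /(orbit_gt O) /ltW.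
move=> /(_ h) pr; rewrite -(pmulr_lgt0 _ Ln) -ln_powR -px; apply: ln_gt0.
exact: lt_le_trans (r_gt1 O _) pr.
Qed.

Lemma inner_exponent_near x y : circle_exponents (inner_boundary G) q x -> x < y ->
  exists2 w, G w & normc w < q `^ y.
Proof.
move=> [p ip px] xy; have xy' : q `^ x < q `^ y by rewrite ltr_powR_exp.
have [|w Gw wp] := inner_boundary_near ip (_ : 0 < q `^ y - q `^ x); first by rewrite subr_gt0.
exists w => //; have := normc_leBD w p; rewrite px; lra.
Qed.

Lemma outer_exponent_ge x : circle_exponents (outer_boundary G) q x -> bb n.+3 <= x.
Proof.
move=> [p ip px]; have := outer_boundary_ge annulus_radii annulus_radii_sub ip.
by rewrite px ler_powR_exp.
Qed.

(** Below the smallest exponent of the outer boundary, discs do not meet the unbounded complement,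
    so [hull_dominated] applies to them with T = r (n+4). *)
Lemma outer_exponent_hull x y : is_smallest (circle_exponents (outer_boundary G) q) y -> x < y ->
  exists K, [/\ compact K, K `<=` G & forall k z, normc z = q `^ x ->
    exists2 v, K v & normc (iter k f z) <= normc (iter k f v)].
Proof.
move=> [_ ylb] xy.
have lo := outer_boundary_ge annulus_radii annulus_radii_sub.
have := annulus_radii => /andP[s0 st]; have t0 := lt_trans s0 st.
have bd z : outer_boundary G z -> q `^ y <= normc z.
  move=> oz; have z0' : 0 < normc z by exact: lt_le_trans t0 (lo z oz).
  rewrite -ler_ln ?posrE ?powR_gt0 // ln_powR -ler_pdivlMr //.
  apply: ylb; exists z => //; rewrite -[LHS]lnK ?posrE // /powR gt_eqF // divfK // gt_eqF //.
have U0 : ~ unbounded_complement G 0.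
  by move=> /(unbounded_complement_ge annulus_radii annulus_radii_sub); rewrite normc0 leNgt t0.
have xy' : q `^ x < q `^ y by rewrite ltr_powR_exp.
have [|||||K [cK KG KH]] := @hull_dominated R G (q `^ x) (r n.+4).
- exact: (orbit_open O).
- exact: (r_pos O).
- exact: powR_ge0.
- exact: (orbit_lt O).
- move=> z zx; apply: (@below_outer_boundary R G (q `^ y)) => //; first exact: powR_gt0.
  exact: le_lt_trans xy'.
exists K; split => // k z zx; apply: (KH (iter k f)); last by rewrite zx.
by move=> w; apply: cdiff_iter; exact: (orbit_diff O).
Qed.

Lemma bb_le_sup : ((bb n.+3)%:E <= beta)%E.
Proof.
apply: sup_exponent_approx => x /andP[x1 x2].
have [|||k z zr|c Ec xc] := @outer_bound R f Un z0 r O n (q `^ x) [set z | normc z = q `^ x].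
- by rewrite -[X in X <= _]powRr1 ?ler_powR_exp // ltW.
- exact: circle_compact.
- move=> z /= zx; apply: annulus_radii_sub; rewrite zx.
  have /andP[a1 _] := annulus_exponents n.+3.
  rewrite !ltr_powR_exp // x2 andbT; lra.
- by exists z.
by exists c => //; move: xc; rewrite ln_powR mulfK // gt_eqF.
Qed.

Lemma outer_exponent_le_sup y : is_smallest (circle_exponents (outer_boundary G) q) y ->
  (y%:E <= beta)%E.
Proof.
move=> ys; apply: sup_exponent_approx => x /andP[x1 x2].
have [K [cK KG KH]] := outer_exponent_hull ys x2.
have [|c Ec xc] := @outer_bound R f Un z0 r O n (q `^ x) K _ cK KG KH.
  by rewrite -[X in X <= _]powRr1 ?ler_powR_exp // ltW.
by exists c => //; move: xc; rewrite ln_powR mulfK // gt_eqF.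
Qed.

(** Near the inner boundary there is w in U_n with |w| < q^u, for u slightly above x, and
    [ratio_bound] compares it with the circle of exponent v slightly below y: alpha v <= beta u.
    Then u tends to x and v to y. *)
Lemma exponent_ratio x y : circle_exponents (inner_boundary G) q x ->
  is_smallest (circle_exponents (outer_boundary G) q) y ->
  ((y / x)%:E <= beta / alpha%:E)%E.
Proof.
move=> ix oy; have x0 := inner_exponent_gt0 ix.
have ub := sup_exponent_ge; have b1 := sup_exponent_gt1.
have a0 := inf_exponent_ge0; rewrite inver.
(* The extended inverse of 0 is +oo, so that the right side is +oo if alpha = 0, and also if beta =
   +oo. *)
have [az|az] := eqVneq alpha 0.
  by rewrite gt0_muley ?leey // (lt_trans _ b1) // lte_fin.
have {az}a0 : 0 < alpha by rewrite lt_neqAle eq_sym az.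
move: b1 ub; case: beta => [c| |] // b1 ub; last first.
  by rewrite gt0_mulye ?leey // lte_fin invr_gt0.
rewrite -EFinM lee_fin; rewrite lte_fin in b1.
have xa := inner_exponent_le ix; have yb := outer_exponent_ge oy.1.
have /andP[a1 bb1] := annulus_exponents n.+3.
have main u v : x < u < 1 -> 1 <= v < y -> alpha * v <= c * u.
  move=> /andP[xu u1] /andP[v1 vy].
  have [w Gw wu] := inner_exponent_near ix xu.
  have [K [cK KG KH]] := outer_exponent_hull oy vy.
  have w1 : 1 < normc w by exact: (@Un_gt1 R f Un z0 r O n.+2).
  have wl : ln (normc w) < u * L n.+3.
    by rewrite -ln_powR ltr_ln ?posrE ?powR_gt0 // (lt_trans ltr01).
  have [|e1 [e2 [E1 E2 H]]] := @ratio_bound R f Un z0 r O n w (q `^ v) K Gw _ cK KG KH.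
    apply/ltW/(lt_trans wu); rewrite ltr_powR_exp //; lra.
  have h1 := inf_exponent_le E1; have h2 := ub _ E2; rewrite lee_fin in h2.
  have e20 := range_gt0 O E2.
  move: H; rewrite ln_powR => H.
  have h3 : alpha * (v * L n.+3) <= e1 * (v * L n.+3).
    by rewrite ler_wpM2r // mulr_ge0 ?(ltW Ln) //; lra.
  have h4 : e2 * ln (normc w) <= e2 * (u * L n.+3) by rewrite ler_wpM2l // ltW.
  have h5 : e2 * (u * L n.+3) <= c * (u * L n.+3).
    by rewrite ler_wpM2r // mulr_ge0 ?(ltW Ln) //; lra.
  by rewrite -(ler_pM2r Ln) -!mulrA; lra.
suff : alpha * y <= c * x by move=> h; rewrite ler_pdivrMr // mulrAC ler_pdivlMr // mulrC.
rewrite leNgt; apply/negP => lt.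
pose D := alpha * y - c * x.
have D0 : 0 < D by rewrite /D; lra.
have ac : 0 < 2 * (alpha + c) by lra.
(* The first two terms keep u = x + e below 1 and v = y - e above 1; with the third, alpha v <= c u
   would give D <= e (alpha + c) <= D / 2. *)
pose e := Num.min (Num.min ((y - 1) / 2) ((1 - x) / 2)) (D / (2 * (alpha + c))).
have e1 : e <= (y - 1) / 2 by rewrite !ge_min lexx.
have e2 : e <= (1 - x) / 2 by rewrite !ge_min lexx orbT.
have e3 : e <= D / (2 * (alpha + c)) by rewrite ge_min lexx orbT.
have e0 : 0 < e.
  by rewrite !lt_min [in X in _ && X]divr_gt0 // andbT; apply/andP; split; lra.
have := main (x + e) (y - e); rewrite ler_pdivlMr // in e3.
move=> H; have : alpha * (y - e) <= c * (x + e) by apply: H; lra.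
move: e3; rewrite /D; lra.
Qed.

End Index.

Lemma inner_exponent_ge : exists2 a : R, 0 < a & exists N, forall n x, (N <= n)%N ->
  circle_exponents (inner_boundary (Un n.+3)) (r n.+3) x -> alpha <= x + a / L n.+3.
Proof.
have [a a0 [N NH]] := inner_limit; exists a => //; exists N => n x Nn ix; apply: NH => //.
  have := inner_exponent_le ix; have /andP[] := annulus_exponents n.+3; lra.
move=> y /andP[xy _]; have [w Gw wy] := inner_exponent_near ix xy.
exists w => //; rewrite -ln_powR ler_ln ?posrE ?powR_gt0 ?(r_pos O) ?(ltW wy) //.
exact: lt_trans (@Un_gt1 R f Un z0 r O n.+2 _ Gw).
Qed.

End Orbit.
End Asymptotics.

Lemma eventually_shift (P : nat -> Prop) (n0 : nat) :
  (exists N, forall n, (N <= n)%N -> P (n0 + n.+3)%N) -> exists N, forall n, (N <= n)%N -> P n.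
Proof.
move=> [N NH]; exists (n0 + N.+3)%N => n Nn.
have n0n : (n0 <= n)%N by exact: leq_trans (leq_addr _ _) Nn.
have N3 : (N.+3 <= n - n0)%N by rewrite leq_subRL.
have nE : (n0 + (n - n0 - 3).+3)%N = n.
  by rewrite -(addn3 (n - n0 - 3)) subnK ?subnKC //; exact: leq_trans N3.
rewrite -nE; apply: NH; rewrite leq_subRL; first by rewrite addnC addn3.
exact: leq_trans N3.
Qed.

Section MainTheorem.
Variable R : realType.
Local Notation C := R[i].
Local Notation Re := (@complex.Re R).
Local Notation Im := (@complex.Im R).
Implicit Types (z w c : C) (A B G : set C) (f g : C -> C).

Lemma iterates_annular_orbit f (U : set C) z0 n1 n0 : (forall z, cdiff f z) ->
  (~ exists p : {poly C}, forall z, f z = p.[z]) -> wandering_domain f U -> U z0 ->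
  (forall n, (n1 <= n)%N -> exists s t : R, [/\ 0 < s, s < normc (iter n f z0) < t &
     forall w, s < normc w < t -> (iter n f @` U) w]) ->
  (n1 <= n0)%N -> 1 < normc (iter n0 f z0) ->
  annular_orbit f (fun n => iter (n0 + n) f @` U) (iter n0 f z0)
    (fun n => normc (iter (n0 + n) f z0)).
Proof.
move=> df np wU Uz0 ra n10 r0.
have n1n n : (n1 <= n0 + n)%N by exact: leq_trans (leq_addr _ _).
split => //.
- by move=> n; exact: Un_open.
- by move=> n; apply: Un_connected.
- by move=> n; rewrite addnS; exact: UnS.
- by move=> n; rewrite -iterD addnC.
- move=> n; have [s [t [s0 /andP[sr rt] sub]]] := ra _ (n1n n); exists t => // w /andP[w1 w2].
  by apply: sub; rewrite w2 andbT; exact: lt_le_trans w1.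
- by rewrite addn0.
- by move=> n; rewrite addnS; exact: (r_lt df np wU Uz0 ra (n1n n)).
- by move=> n w; rewrite addnS; exact: (Un_lt df np wU Uz0 ra (n1n n)).
- by move=> n w; rewrite addnS; exact: (Un_gt df np wU Uz0 ra (n1n n)).
- move=> n k w wr; rewrite addnS addnA.
  exact: (iter_disc_lt df np wU Uz0 ra k (n1n n) wr).
- move=> d; have [N NH] := r_growth df np wU Uz0 ra d; exists N => n Nn.
  by rewrite !addnS; apply: NH; exact: leq_trans (leq_addl _ _).
Qed.

Section Limits.
Variables (f : C -> C) (Un : nat -> set C) (z0 : C) (r aa bb : nat -> R).
Hypothesis O : annular_orbit f Un z0 r.

Lemma exponents_near_inf (u : nat -> R) :
  (exists2 a : R, 0 < a & exists N, forall n, (N <= n)%N ->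
     inf_exponent f Un r <= u n + a / ln (r n.+3)) ->
  (forall e : R, 0 < e -> exists N, forall n, (N <= n)%N -> u n <= inf_exponent f Un r + e) ->
  forall e : R, 0 < e -> exists N, forall n, (N <= n)%N -> `|u n - inf_exponent f Un r| <= e.
Proof.
move=> [a a0 [N NH]] hi e e0; have [M MH] := hi e e0.
have [N' N'H] := L_unbounded O (a / e).
exists (maxn N (maxn M N')) => n; rewrite !geq_max => /and3P[/NH h1 /MH h2 N'n].
have : a / ln (r n.+3) <= e.
  rewrite ler_pdivrMr ?(L_gt0 O) // mulrC -ler_pdivrMr //; apply: N'H.
  exact: leq_trans (leq_addl 3 n).
by rewrite ler_norml; lra.
Qed.

End Limits.
End MainTheorem.

Theorem theorem1p5 (R : realType) (f : R[i] -> R[i]) (U : set R[i]) (z0 : R[i])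
    (r : nat -> R) (Un : nat -> set R[i]) (a_ b_ : nat -> R)
    (hf : transcendental_entire f)
    (hU : wandering_domain f U) (hUm : multiply_connected U) (hz0 : U z0)
    (hr : forall n, r n = normc (iter n f z0))
    (hUn : forall n, Un n = iter n f @` U)
    (hab : \forall n \near \oo,
      maximal_annulus (Un n) (iter n f z0) (r n `^ a_ n) (r n `^ b_ n)) :
  exists (a : R) (b : \bar R),
    [/\ 0 <= a < 1, (1 < b)%E,
        a_ @ \oo --> a,
        (fun n => (b_ n)%:E) @ \oo --> b &
        forall amin amax bmin bmax : nat -> R,
          (\forall n \near \oo,
            [/\ is_smallest (circle_exponents (inner_boundary (Un n)) (r n)) (amin n),
                is_largest (circle_exponents (inner_boundary (Un n)) (r n)) (amax n),
                is_smallest (circle_exponents (outer_boundary (Un n)) (r n)) (bmin n) &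
                is_largest (circle_exponents (outer_boundary (Un n)) (r n)) (bmax n)]) ->
          (\forall n \near \oo,
            [/\ ((bmin n)%:E <= b)%E, b_ n <= bmin n,
                ((bmin n / amin n)%:E <= b / a%:E)%E &
                b_ n / a_ n <= bmin n / amin n]) /\
          [/\ (fun n => (bmin n)%:E) @ \oo --> b,
              amin @ \oo --> a &
              amax @ \oo --> a]].
Proof.
have {hr} rE : r = (fun n => normc (iter n f z0)) by exact/funext.
have {hUn} UnE : Un = (fun n => iter n f @` U) by exact/funext.
have [df0 np] := hf; have df z : cdiff f z by exact/derivable_cdiff/df0.
have [n1 _ maxA] := hab.
have ra n : (n1 <= n)%N -> exists s t : R, [/\ 0 < s, s < normc (iter n f z0) < t &
    forall w, s < normc w < t -> (iter n f @` U) w].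
  move=> /maxA [/andP[s0 st] sub sz _]; exists (r n `^ a_ n), (r n `^ b_ n); split => //.
  by move=> w /sub; rewrite UnE.
(* From [n0] on |f^n z0| exceeds 1 and the logarithms are positive, so all sequences are reindexed
   to start there. *)
have [n0 n10 r0] := r_unbounded df np hU hz0 ra 1.
have O := iterates_annular_orbit df np hU hz0 ra n10 r0.
set G := (fun n => iter (n0 + n) f @` U) in O; set q := (fun n => normc (iter (n0 + n) f z0)) in O.
have GE n : Un (n0 + n)%N = G n by rewrite UnE.
have qE n : r (n0 + n)%N = q n by rewrite rE.
pose aa n := a_ (n0 + n)%N; pose bb n := b_ (n0 + n)%N.
have mA n : maximal_annulus (G n) (iter n f (iter n0 f z0)) (q n `^ aa n) (q n `^ bb n).
  have := maxA (n0 + n)%N (leq_trans n10 (leq_addr _ _)).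
  by rewrite GE qE -iterD [(n + n0)%N]addnC.
exists (inf_exponent f G q), (sup_exponent f G q).
have near_inf (u : nat -> R) : (forall e : R, 0 < e -> exists N, forall n, (N <= n)%N ->
    `|u (n0 + n.+3)%N - inf_exponent f G q| <= e) -> u @ \oo --> inf_exponent f G q.
  by move=> H; apply/cvgnP => e /H; exact: eventually_shift.
split.
- by rewrite (inf_exponent_ge0 O) (inf_exponent_lt1 O).
- exact: (sup_exponent_gt1 O).
- apply: near_inf; apply: (exponents_near_inf O); [exact: (aa_ge O mA)|exact: (aa_le O mA)].
- apply: (cvg_sup_exponent O) => [x Ex|]; apply: (@eventually_shift _ n0).
    by have [N NH] := bb_ge O mA Ex; exists N.
  by exists 0%N => n _; exact: (bb_le_sup O mA).
move=> amin amax bmin bmax [n2 _ ext].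
have {}ext n : (n2 <= n)%N ->
  [/\ is_smallest (circle_exponents (inner_boundary (G n.+3)) (q n.+3)) (amin (n0 + n.+3)%N),
      is_largest (circle_exponents (inner_boundary (G n.+3)) (q n.+3)) (amax (n0 + n.+3)%N) &
      is_smallest (circle_exponents (outer_boundary (G n.+3)) (q n.+3)) (bmin (n0 + n.+3)%N)].
  move=> n2n; have [] := ext (n0 + n.+3)%N; last by rewrite GE qE.
  by rewrite /mkset (leq_trans n2n) // -addn3 addnA addnAC leq_addl.
have facts n : (n2 <= n)%N -> [/\ 0 < amin (n0 + n.+3)%N, amin (n0 + n.+3)%N <= amax (n0 + n.+3)%N,
    amax (n0 + n.+3)%N <= aa n.+3 & bb n.+3 <= bmin (n0 + n.+3)%N].
  move=> /ext [[i1 i2] [j1 j2] [u1 _]]; split.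
  - exact: (inner_exponent_gt0 O i1).
  - exact: i2.
  - exact: (inner_exponent_le O mA j1).
  - exact: (outer_exponent_ge O mA u1).
split.
  suff [N NH] : exists N, forall n, (N <= n)%N -> [/\ ((bmin n)%:E <= sup_exponent f G q)%E,
      b_ n <= bmin n,
      ((bmin n / amin n)%:E <= sup_exponent f G q / (inf_exponent f G q)%:E)%E &
      b_ n / a_ n <= bmin n / amin n] by exists N.
  apply: (@eventually_shift _ n0); exists n2 => n n2n.
  have [a0 aM Ma bm] := facts n n2n; have [iA iB oA] := ext n n2n.
  have /andP[a1 b1] := annulus_exponents O mA n.+3.
  split => //.
  - exact: (outer_exponent_le_sup O mA oA).
  - exact: (exponent_ratio O mA iA.1 oA).
  have am : amin (n0 + n.+3)%N <= aa n.+3 by exact: le_trans Ma.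
  have aa0 : 0 < aa n.+3 by exact: lt_le_trans am.
  apply: ler_pM => //; first by apply: ltW; exact: lt_trans b1.
    by rewrite invr_ge0 ltW.
  by rewrite lef_pV2 ?posrE.
(* Every exponent on the inner boundary lies between alpha - a / L and [aa], so one pair of bounds
   serves both [amin] and [amax]. *)
have lower (u : nat -> R) : (forall n, (n2 <= n)%N ->
    circle_exponents (inner_boundary (G n.+3)) (q n.+3) (u n)) ->
    exists2 a : R, 0 < a & exists N, forall n, (N <= n)%N ->
      inf_exponent f G q <= u n + a / ln (q n.+3).
  move=> uH; have [a a0 [N NH]] := inner_exponent_ge O mA; exists a => //.
  exists (maxn N n2) => n; rewrite geq_max => /andP[Nn n2n].
  by apply: NH => //; exact: uH.
have upper (u : nat -> R) : (forall n, (n2 <= n)%N -> u n <= aa n.+3) ->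
    forall e : R, 0 < e -> exists N, forall n, (N <= n)%N -> u n <= inf_exponent f G q + e.
  move=> uH e /(aa_le O mA) [N NH]; exists (maxn N n2) => n; rewrite geq_max => /andP[Nn n2n].
  exact: le_trans (uH n n2n) (NH n Nn).
split.
- apply: (cvg_sup_exponent O) => [x Ex|]; apply: (@eventually_shift _ n0).
    have [N NH] := bb_ge O mA Ex; exists (maxn N n2) => n; rewrite geq_max => /andP[Nn n2n].
    by have [_ _ _] := facts n n2n; apply: le_trans; exact: NH.
  by exists n2 => n /ext [_ _]; exact: (outer_exponent_le_sup O mA).
- apply: near_inf; apply: (exponents_near_inf O); [apply: lower|apply: upper] => n n2n.
    by have [[]] := ext n n2n.
  by have [_ h1 h2 _] := facts n n2n; exact: le_trans h2.
- apply: near_inf; apply: (exponents_near_inf O); [apply: lower|apply: upper] => n n2n.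
    by have [_ []] := ext n n2n.
  by have [_ _] := facts n n2n.
Qed.
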